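(* Let $(M^{n+1},g)$ be a globally hyperbolic spacetime and let $X$ be a timelike conformal Killing vector field in $(M,g)$. Then there exist a spacetime $(\hat M^{n+1},\hat g)$, an open conformal embedding $\varphi:(M,g)\hookrightarrow(\hat M,\hat g)$, and a complete vector field $\hat X\in\mathfrak{X}(\hat M)$ which is a timelike Killing vector field of $(\hat M,\hat g)$ with $\hat g(\hat X,\hat X)\equiv -1$ and which extends the pushforward $\varphi_*X$ (i.e. $\hat X|_{\varphi(M)}=\varphi_*X$). Moreover, if $S\subset M$ is a smooth, spacelike (hence acausal) compact Cauchy hypersurface for $(M,g)$, then $(\hat M,\hat g)$ (together with $\varphi$ and $\hat X$) can be chosen so that $\varphi(S)$ is also a smooth, spacelike (hence acausal) compact Cauchy hypersurface for $(\hat M,\hat g)$.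
   Context: A spacetime is a connected, Hausdorff, second-countable, time-oriented $C^\infty$ Lorentzian manifold of dimension $n+1\geq 2$ (signature $(-,+,\dots,+)$). A vector field $X\in\mathfrak{X}(M)$ is a timelike conformal Killing vector field if it is timelike everywhere on $M$ and $\mathcal{L}_Xg=2\sigma g$ for some $\sigma\in C^\infty(M)$; it is not assumed complete. It is Killing if $\sigma\equiv 0$. An open conformal embedding $\varphi:(M,g)\hookrightarrow(\hat M,\hat g)$ is a smooth embedding onto an open subset such that $\varphi^*\hat g=\Omega^2 g$ for some positive $\Omega\in C^\infty(M)$. No assumption is made on the Ricci tensor, and compactness of Cauchy hypersurfaces is only used in the second assertion. *)

(* Defs.v *)
(* Smooth manifolds are given by maximal atlases, and tensor fields by their
   components in every chart. *)
From HB Require Import structures.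
From mathcomp Require Import all_boot all_order all_algebra.
From mathcomp Require Import all_classical all_reals all_analysis.
Set Implicit Arguments.
Unset Strict Implicit.
Unset Printing Implicit Defensive.
Import Order.TTheory GRing.Theory Num.Theory.
Import numFieldNormedType.Exports.
Local Open Scope classical_set_scope.
Local Open Scope ring_scope.

(* Meaningful for open U: f is of class C^k.+1 on U iff it is differentiable on
   U and all its directional derivatives are of class C^k on U. *)
Fixpoint Ck (R : realType) (V W : normedModType R) (k : nat) (U : set V)
    (f : V -> W) : Prop :=
  match k with
  | 0 => forall x, U x -> {for x, continuous f}
  | k'.+1 => (forall x, U x -> differentiable f x) /\
             (forall v, Ck k' U (fun x => 'D_v f x))
  end.

Definition smooth (R : realType) (V W : normedModType R) (U : set V)
    (f : V -> W) : Prop := forall k, Ck k U f.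

(* A chart is a homeomorphism from an open set cdom onto an open set of R^(n+1).
   The values of cfun outside of cdom and those of cinv outside of the image of
   cdom are irrelevant. *)
Record chart (R : realType) (n : nat) (M : topologicalType) := Chart {
  cdom : set M;
  cfun :> M -> 'rV[R]_n.+1;
  cinv : 'rV[R]_n.+1 -> M;
  cdom_open : open cdom;
  cimg_open : open (cfun @` cdom);
  cfunK : forall p, cdom p -> cinv (cfun p) = p;
  cfun_cts : forall p, cdom p -> {for p, continuous cfun};
  cinv_cts : forall x, (cfun @` cdom) x -> {for x, continuous cinv} }.

Definition chart_compat (R : realType) (n : nat) (M : topologicalType)
    (c d : chart R n M) : Prop :=
  smooth (c @` (cdom c `&` cdom d)) (d \o cinv c) /\
  smooth (d @` (cdom c `&` cdom d)) (c \o cinv d).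

Record manifold (R : realType) (n : nat) := Manifold {
  carrier :> topologicalType;
  atlas : set (chart R n carrier);
  atlas_cover : forall p : carrier, exists2 c, atlas c & cdom c p;
  atlas_compat : forall c d, atlas c -> atlas d -> chart_compat c d;
  atlas_max : forall c, (forall d, atlas d -> chart_compat c d) -> atlas c;
  manifold_hausdorff : hausdorff_space carrier;
  manifold_second_countable : @second_countable carrier }.

Definition chart_at (R : realType) (n : nat) (M : manifold R n)
    (c : chart R n M) (p : M) : Prop := atlas c /\ cdom c p.

Definition smooth_fun (R : realType) (n : nat) (M : manifold R n)
    (f : M -> R) : Prop :=
  forall c, atlas c -> smooth (c @` cdom c) (f \o cinv c).

Definition smooth_map (R : realType) (n : nat) (M N : manifold R n)
    (phi : M -> N) : Prop :=
  continuous phi /\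
  forall c d, atlas c -> atlas d ->
    smooth (c @` (cdom c `&` phi @^-1` cdom d)) (d \o phi \o cinv c).

(* The differential of phi at p in the charts c (around p) and d (around phi p);
   tangent vectors are row vectors, so that it acts by right multiplication. *)
Definition diff_mx (R : realType) (n : nat) (M N : manifold R n)
    (phi : M -> N) (c : chart R n M) (d : chart R n N) (p : M) :
    'M[R]_n.+1 := 'J (d \o phi \o cinv c) (c p).

(* X c p is the row of components of the tangent vector X_p in the chart c. *)
Record vector_field (R : realType) (n : nat) (M : manifold R n) :=
  VectorField {
  vcomp :> chart R n M -> M -> 'rV[R]_n.+1;
  vcomp_smooth : forall c, atlas c ->
    smooth (c @` cdom c) (vcomp c \o cinv c);
  vcomp_change : forall c d p, chart_at c p -> chart_at d p ->
    vcomp d p = vcomp c p *m diff_mx id c d p }.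

Definition lorentz_signature (R : realType) (n : nat) (G : 'M[R]_n.+1) : Prop :=
  exists2 P, P \in unitmx &
    P *m G *m P^T = diag_mx (\row_j (if j == ord0 then -1 else 1)).

(* g c p is the Gram matrix of the coordinate frame of the chart c at p.  Its
   symmetry follows from the signature condition. *)
Record lorentz_metric (R : realType) (n : nat) (M : manifold R n) :=
  LorentzMetric {
  gcomp :> chart R n M -> M -> 'M[R]_n.+1;
  gcomp_smooth : forall c, atlas c ->
    smooth (c @` cdom c) (gcomp c \o cinv c);
  gcomp_change : forall c d p, chart_at c p -> chart_at d p ->
    gcomp c p = diff_mx id c d p *m gcomp d p *m (diff_mx id c d p)^T;
  gcomp_lorentz : forall c p, chart_at c p -> lorentz_signature (gcomp c p) }.

Definition gdot (R : realType) (n : nat) (M : manifold R n)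
    (g : lorentz_metric M) (c : chart R n M) (p : M) (u v : 'rV[R]_n.+1) : R :=
  (u *m g c p *m v^T) 0 0.

Definition timelike_field (R : realType) (n : nat) (M : manifold R n)
    (g : lorentz_metric M) (X : vector_field M) : Prop :=
  forall c p, chart_at c p -> gdot g c p (X c p) (X c p) < 0.

(* The time orientation is the one for which the timelike vector field torient
   is future-directed. *)
Record spacetime (R : realType) (n : nat) := Spacetime {
  st_manifold :> manifold R n;
  metric : lorentz_metric st_manifold;
  torient : vector_field st_manifold;
  st_connected : connected [set: st_manifold];
  torient_timelike : timelike_field metric torient }.

(* (L_X g)_ij = X^k d_k g_ij + (d_i X^k) g_kj + g_ik (d_j X^k) *)
Definition lie_metric (R : realType) (n : nat) (M : manifold R n)
    (g : lorentz_metric M) (X : vector_field M) (c : chart R n M) (p : M) :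
    'M[R]_n.+1 :=
  let JX := 'J (X c \o cinv c) (c p) in
  'D_(X c p) (g c \o cinv c) (c p) + JX *m g c p + g c p *m JX^T.

Definition conformal_killing_with (R : realType) (n : nat) (M : spacetime R n)
    (X : vector_field M) (sigma : M -> R) : Prop :=
  smooth_fun sigma /\
  forall c p, chart_at c p ->
    lie_metric (metric M) X c p = (2 * sigma p) *: metric M c p.

Definition timelike_conformal_killing (R : realType) (n : nat)
    (M : spacetime R n) (X : vector_field M) : Prop :=
  timelike_field (metric M) X /\ exists sigma, conformal_killing_with X sigma.

Definition timelike_killing (R : realType) (n : nat) (M : spacetime R n)
    (X : vector_field M) : Prop :=
  timelike_field (metric M) X /\ conformal_killing_with X (fun=> 0).

Definition integral_curve (R : realType) (n : nat) (M : manifold R n)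
    (X : vector_field M) (gamma : R -> M) : Prop :=
  continuous gamma /\
  forall t c, chart_at c (gamma t) ->
    is_derive t 1 (c \o gamma) (X c (gamma t)).

Definition complete_field (R : realType) (n : nat) (M : manifold R n)
    (X : vector_field M) : Prop :=
  forall p, exists2 gamma, integral_curve X gamma & gamma 0 = p.

Definition smooth_embedding (R : realType) (n : nat) (M N : manifold R n)
    (phi : M -> N) : Prop :=
  [/\ smooth_map phi,
      forall c d p, chart_at c p -> chart_at d (phi p) ->
        row_free (diff_mx phi c d p),
      injective phi &
      forall U : set M, open U ->
        exists2 V : set N, open V & phi @` U = V `&` range phi].

Definition open_conformal_embedding (R : realType) (n : nat)
    (M N : spacetime R n) (phi : M -> N) : Prop :=
  [/\ smooth_embedding phi,
      open (range phi) &
      exists Omega : M -> R,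
        [/\ smooth_fun Omega,
            forall p, 0 < Omega p &
            forall c d p, chart_at c p -> chart_at d (phi p) ->
              diff_mx phi c d p *m metric N d (phi p) *m (diff_mx phi c d p)^T
              = Omega p ^+ 2 *: metric M c p]].

(* The restriction of Y to the image of phi is the pushforward of X. *)
Definition extends_pushforward (R : realType) (n : nat) (M N : manifold R n)
    (phi : M -> N) (X : vector_field M) (Y : vector_field N) : Prop :=
  forall c d p, chart_at c p -> chart_at d (phi p) ->
    Y d (phi p) = X c p *m diff_mx phi c d p.

Definition future_causal (R : realType) (n : nat) (M : spacetime R n)
    (c : chart R n M) (p : M) (v : 'rV[R]_n.+1) : Prop :=
  [/\ v != 0, gdot (metric M) c p v v <= 0 &
      gdot (metric M) c p (torient M c p) v < 0].

Definition future_timelike (R : realType) (n : nat) (M : spacetime R n)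
    (c : chart R n M) (p : M) (v : 'rV[R]_n.+1) : Prop :=
  gdot (metric M) c p v v < 0 /\ gdot (metric M) c p (torient M c p) v < 0.

(* Smooth curves on an open set J of the line whose velocity is in the cone K. *)
Definition smooth_curve_in (R : realType) (n : nat) (M : manifold R n)
    (K : chart R n M -> M -> 'rV[R]_n.+1 -> Prop) (J : set R) (gamma : R -> M) :
    Prop :=
  [/\ forall t, J t -> {for t, continuous gamma},
      forall c, atlas c -> smooth (J `&` gamma @^-1` cdom c) (c \o gamma) &
      forall t c, J t -> chart_at c (gamma t) ->
        K c (gamma t) (derive1 (c \o gamma) t)].

(* Piecewise smooth curves on an interval I: near each t in I, the curve agrees
   up to t with a smooth curve and from t on with a smooth curve, both with
   velocities in K and both defined on a neighbourhood of t.  By compactness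
   there are finitely many breaks in each compact subinterval of I. *)
Definition piecewise_curve_in (R : realType) (n : nat) (M : manifold R n)
    (K : chart R n M -> M -> 'rV[R]_n.+1 -> Prop) (I : set R) (gamma : R -> M) :
    Prop :=
  forall t, I t -> exists2 e : R, 0 < e & exists alpha beta : R -> M,
    [/\ smooth_curve_in K (ball t e) alpha,
        smooth_curve_in K (ball t e) beta,
        forall s, I s -> t - e < s <= t -> gamma s = alpha s &
        forall s, I s -> t <= s < t + e -> gamma s = beta s].

Definition causal_curve (R : realType) (n : nat) (M : spacetime R n) :=
  piecewise_curve_in (@future_causal R n M).

Definition timelike_curve (R : realType) (n : nat) (M : spacetime R n) :=
  piecewise_curve_in (@future_timelike R n M).

(* p < q : some future-directed causal curve goes from p to q. *)
Definition causally_precedes (R : realType) (n : nat) (M : spacetime R n)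
    (p q : M) : Prop :=
  exists a b : R, exists gamma : R -> M,
    [/\ a < b, causal_curve `[a, b] gamma, gamma a = p & gamma b = q].

Definition causal_future (R : realType) (n : nat) (M : spacetime R n)
    (p : M) : set M := [set q | p = q \/ causally_precedes p q].

Definition causal_past (R : realType) (n : nat) (M : spacetime R n)
    (q : M) : set M := [set p | p = q \/ causally_precedes p q].

Definition strongly_causal (R : realType) (n : nat) (M : spacetime R n) :
    Prop :=
  forall (p : M) (U : set M), nbhs p U ->
    exists V : set M, [/\ nbhs p V, V `<=` U &
      forall (a b : R) (gamma : R -> M), a < b -> causal_curve `[a, b] gamma ->
        V (gamma a) -> V (gamma b) -> forall t, a <= t <= b -> U (gamma t)].

Definition globally_hyperbolic (R : realType) (n : nat) (M : spacetime R n) :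
    Prop :=
  strongly_causal M /\
  forall p q : M, compact (causal_future p `&` causal_past q).

Definition future_endpoint (R : realType) (n : nat) (M : manifold R n)
    (I : set R) (gamma : R -> M) (p : M) : Prop :=
  forall U, nbhs p U ->
    exists2 t0, I t0 & forall t, I t -> t0 <= t -> U (gamma t).

Definition past_endpoint (R : realType) (n : nat) (M : manifold R n)
    (I : set R) (gamma : R -> M) (p : M) : Prop :=
  forall U, nbhs p U ->
    exists2 t0, I t0 & forall t, I t -> t <= t0 -> U (gamma t).

Definition inextendible (R : realType) (n : nat) (M : manifold R n)
    (I : set R) (gamma : R -> M) : Prop :=
  (forall p, ~ future_endpoint I gamma p) /\
  (forall p, ~ past_endpoint I gamma p).

(* Every inextendible timelike curve meets S exactly once.  Timelike curves are
   future-directed, which is no restriction up to reversing the parameter. *)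
Definition cauchy_hypersurface (R : realType) (n : nat) (M : spacetime R n)
    (S : set M) : Prop :=
  forall (I : set R) (gamma : R -> M), I !=set0 -> is_interval I ->
    timelike_curve I gamma -> inextendible I gamma ->
    exists! t, I t /\ S (gamma t).

Definition slice_chart (R : realType) (n : nat) (M : manifold R n) (S : set M)
    (c : chart R n M) : Prop :=
  atlas c /\ forall p, cdom c p -> (S p <-> c p 0 ord0 = 0).

Definition smooth_hypersurface (R : realType) (n : nat) (M : manifold R n)
    (S : set M) : Prop :=
  forall p, S p -> exists2 c, slice_chart S c & cdom c p.

(* In a slice chart, the vectors tangent to S are those whose component of
   index 0 vanishes. *)
Definition spacelike (R : realType) (n : nat) (M : spacetime R n) (S : set M) :
    Prop :=
  forall c p, slice_chart S c -> cdom c p -> S p ->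
    forall v : 'rV[R]_n.+1, v 0 ord0 = 0 -> v != 0 ->
      0 < gdot (metric M) c p v v.

Definition acausal (R : realType) (n : nat) (M : spacetime R n) (S : set M) :
    Prop :=
  forall p q, S p -> S q -> ~ causally_precedes p q.

(* Main.v *)
(* Up to replacing X by -X, X is future-directed, and dividing g by -g(X,X)
   makes X a unit Killing field.  Write (t, p) for the point that p would reach
   after flowing for the time t, and glue M x R along (t, p) ~ (s, q) whenever
   the local flow of X takes p to q in the time t - s.  The local flow is
   isometric, so the manifold structure, the metric and X descend to the
   quotient N, where X is complete and p |-> (0, p) is an open embedding.

   Only the Hausdorff property of N uses global hyperbolicity: it amounts to the
   closedness of the time-s flow relation, and if p_k -> p, q_k -> q and q_k is
   the flow of p_k at time s, then the orbit of p stays, as long as it is defined,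
   in the compact J+(p') /\ J-(q') for some p' << p and q << q', so it lasts until
   time s.

   If S is a compact spacelike Cauchy hypersurface of M, the inextendible orbits
   of X meet S exactly once, hence so do the orbits in N, and the time rho needed
   to reach S is a function on N.  The flow being isometric, the level sets of
   rho are spacelike, so that rho strictly decreases along causal curves, which
   gives acausality and at most one crossing.  A causal curve on which rho keeps
   its sign stays, in the direction of S, in a compact slab and accumulates at
   some q; in a slice chart at q its velocity v satisfies |v| <= k v_0, while the
   coordinate of index 0 is bounded along the curve by its value at q.  So the
   curve converges to q and is extendible. *)
Require Import Defs.
From HB Require Import structures.
From mathcomp Require Import all_boot all_order all_algebra.
From mathcomp Require Import all_classical all_reals all_analysis.
From mathcomp Require Import ring lra.
Set Implicit Arguments.
Unset Strict Implicit.
Unset Printing Implicit Defensive.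
Import Order.TTheory GRing.Theory Num.Theory.
Import numFieldNormedType.Exports.
Local Open Scope classical_set_scope.
Local Open Scope ring_scope.

(** * Calculus of C^k maps *)

(** The factor [R] of the gluing is only a set of indices: the quotient carries the final topology
    of the slice maps [iota_map t], so it keeps the dimension of M. Independence of the slice then
    means that flow maps at fixed times carry charts to charts and preserve X and g; this is why
    smooth dependence on initial data is developed.

    The flow is a ternary relation. The lifetime of a flow box may depend on the order k of
    differentiability, so properties at long times come from composing short flow steps.

    The hitting time rho is never differentiated: it is compared with a coordinate of a slice chart
    carried along the flow, by the intermediate value theorem along orbits. A slice chart does not
    tell on which side of S its coordinate of index 0 is positive, so the constant k bounding the
    cones carries a sign. *)

Section Ck_theory.
Context {R : realType}.
Implicit Types V W : normedModType R.

Lemma near_open (T : topologicalType) (U : set T) x : open U -> U x -> \forall y \near x, U y.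
Proof. by move=> oU Ux; apply: open_nbhs_nbhs. Qed.

Lemma near_eq_open V W (U : set V) (f g : V -> W) x :
  open U -> U x -> (forall y, U y -> f y = g y) -> \near x, f x = g x.
Proof. by move=> oU Ux fg; apply: filterS (near_open oU Ux). Qed.

Lemma near_eq_diff V W (f g : V -> W) x :
  (\near x, f x = g x) -> differentiable f x ->
  differentiable g x /\ 'd g x = 'd f x :> (V -> W).
Proof.
move=> fg df.
have cx : (h + x) @[h --> (0 : V)] --> x.
  by rewrite -{2}(add0r x); apply: cvgD; [exact: cvg_id|exact: cvg_cst].
have E : g \o shift x = cst (g x) + 'd f x +o_ 0 id.
  have fgx : f x = g x := nbhs_singleton fg.
  apply/eqaddoP => e e0.
  have /eqaddoP /(_ e e0) := diff_locally df.
  rewrite !near_simpl => H; near=> h.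
  rewrite /= -[X in `|X| <= _]/(g (h + x) - (g x + 'd f x h)) -fgx.
  have <- : f (h + x) = g (h + x).
    by near: h; exact: (cx _ fg).
  by near: h.
have dgf : 'd g x = 'd f x :> (V -> W) by apply: diff_unique => //; exact: diff_continuous.
split=> //; apply/diff_locallyP; rewrite dgf; split=> //.
exact: diff_continuous.
Unshelve. all: by end_near. Qed.

Lemma diff_nearE V W (f g : V -> W) x :
  (\near x, f x = g x) -> differentiable f x -> differentiable g x.
Proof. by move=> fg /(near_eq_diff fg)[]. Qed.

Lemma CkSP k V W (U : set V) (f : V -> W) :
  Ck k.+1 U f <->
  (forall x, U x -> differentiable f x) /\ (forall v, Ck k U ('D_v f)).
Proof. by []. Qed.

Lemma Ck_sub k V W (A B : set V) (f : V -> W) :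
  A `<=` B -> Ck k B f -> Ck k A f.
Proof.
elim: k f => [|k IH] f AB /=; first by move=> cf x /AB; apply: cf.
by move=> [df Df]; split=> [x /AB|v]; [apply: df|apply: IH].
Qed.

(** [Ck] quantifies over the points of U only, the derivatives being those of the ambient function.
    Regularity on a set can therefore be proved one point, and later one germ, at a time. *)
Lemma Ck_pointwise k V W (U : set V) (f : V -> W) :
  (forall x, U x -> Ck k [set x] f) -> Ck k U f.
Proof.
elim: k f => [|k IH] f H /=; first by move=> x /H; apply.
split=> [x /H[+ _]|v]; first exact.
by apply: IH => x /H[_]; apply.
Qed.

Lemma Ck_eq k V W (U : set V) (f g : V -> W) : open U ->
  (forall x, U x -> f x = g x) -> Ck k U f -> Ck k U g.
Proof.
move=> oU; elim: k f g => [|k IH] f g fg /=.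
  move=> cf x Ux; have nfg := near_eq_open oU Ux fg.
  rewrite /prop_for /continuous_at -(fg _ Ux); apply: cvg_trans (cf _ Ux).
  exact: near_eq_cvg.
move=> [df Df]; split=> [x Ux|v].
  by apply: diff_nearE (df _ Ux); apply: near_eq_open fg.
apply: IH (Df v) => x Ux; apply: near_eq_derive.
exact: near_eq_open fg.
Qed.

Lemma CkS k V W (U : set V) (f : V -> W) : Ck k.+1 U f -> Ck k U f.
Proof.
elim: k f => [|k IH] f /= [df Df].
  by move=> x Ux; apply/differentiable_continuous/df.
by split=> // v; apply: IH; apply: Df.
Qed.

Lemma Ck_le k l V W (U : set V) (f : V -> W) :
  (k <= l)%N -> Ck l U f -> Ck k U f.
Proof.
by move=> /subnKC <-; elim: (l - k)%N => [|m IH]; rewrite ?addn0// addnS =>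
  /CkS/IH.
Qed.

Lemma Ck_continuous k V W (U : set V) (f : V -> W) x :
  Ck k U f -> U x -> {for x, continuous f}.
Proof. by move=> /(Ck_le (leq0n k)); apply. Qed.

Lemma Ck_cst k V W (U : set V) (a : W) : Ck k U (fun=> a).
Proof.
elim: k a => [|k IH] a /=; first by move=> x _; apply: cvg_cst.
split=> [x _|v]; first exact: differentiable_cst.
by rewrite (_ : (fun x => 'D_v (fun=> a) x) = fun=> 0)//; apply/funext => x;
  rewrite derive_cst.
Qed.

Lemma Ck_linear k V W (U : set V) (f : {linear V -> W}) :
  continuous f -> Ck k U f.
Proof.
move=> cf; case: k => [|k] /=; first by move=> x _; apply: cf.
split=> [x _|v]; first exact: linear_differentiable.
rewrite (_ : (fun x => 'D_v f x) = fun=> f v); first exact: Ck_cst.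
apply/funext => x; rewrite deriveE; first by rewrite diff_lin.
exact: linear_differentiable.
Qed.

Lemma CkD k V W (U : set V) (f g : V -> W) : open U ->
  Ck k U f -> Ck k U g -> Ck k U (fun x => f x + g x).
Proof.
move=> oU; elim: k f g => [|k IH] f g /=.
  by move=> cf cg x Ux; apply: cvgD; [apply: cf|apply: cg].
move=> [df Df] [dg Dg]; split=> [x Ux|v].
  by apply: differentiableD; [apply: df|apply: dg].
apply: Ck_eq (IH _ _ (Df v) (Dg v)) => // x Ux.
by rewrite deriveD//; apply: diff_derivable; [apply: df|apply: dg].
Qed.

Lemma CkM k V (U : set V) (f g : V -> R) : open U ->
  Ck k U f -> Ck k U g -> Ck k U (fun x => f x * g x).
Proof.
move=> oU; elim: k f g => [|k IH] f g.
  by move=> cf cg x Ux; apply: cvgM; [apply: cf|apply: cg].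
move=> fC gC; have /CkSP[df Df] := fC; have /CkSP[dg Dg] := gC; split=> [x Ux|v].
  by apply: differentiableM; [apply: df|apply: dg].
have := CkD oU (IH _ _ (CkS fC) (Dg v)) (IH _ _ (CkS gC) (Df v)).
apply: Ck_eq => // x Ux.
by rewrite deriveM//; apply: diff_derivable; [apply: df|apply: dg].
Qed.

Lemma CkZl k V W (U : set V) (f : V -> R) (a : W) :
  open U -> Ck k U f -> Ck k U (fun x => f x *: a).
Proof.
move=> oU; elim: k f => [|k IH] f /=.
  by move=> cf x Ux; apply: cvgZr_tmp; apply: cf.
move=> [df Df]; split=> [x Ux|v].
  by apply: differentiableZl; apply: df.
apply: Ck_eq (IH _ (Df v)) => // x Ux.
have dfx := df _ Ux.
rewrite [RHS]deriveE; last exact: differentiableZl.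
by rewrite diffZl// deriveE.
Qed.

Lemma Ck_sum k V W (I : Type) (s : seq I) (P : pred I) (U : set V)
    (F : I -> V -> W) : open U ->
  (forall i, P i -> Ck k U (F i)) -> Ck k U (fun x => \sum_(i <- s | P i) F i x).
Proof.
move=> oU H; elim: s => [|i s IH].
  by apply: Ck_eq (@Ck_cst k _ W U 0) => // x _; rewrite big_nil.
case Pi: (P i).
  apply: Ck_eq (CkD oU (H i Pi) IH) => // x _; by rewrite big_cons Pi.
by apply: Ck_eq IH => // x _; rewrite big_cons Pi.
Qed.

Lemma Ck_entry k m n V (U : set V) (f : V -> 'M[R]_(m, n)) i j : open U ->
  Ck k U f -> Ck k U (fun x => f x i j).
Proof.
move=> oU; elim: k f => [|k IH] f /=.
  move=> cf x Ux.
  by apply: (continuous_comp (cf x Ux) (g := fun A : 'M[R]_(m, n) => A i j));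
    exact: coord_continuous.
move=> [df Df]; split=> [x Ux|v].
  by apply: (differentiable_comp (df x Ux) (g := fun A : 'M[R]_(m, n) => A i j));
    exact: differentiable_coord.
apply: Ck_eq (IH _ (Df v)) => // x Ux.
rewrite derive_mx ?mxE//; apply: diff_derivable; exact: df.
Qed.

Lemma Ck_mx k m n V (U : set V) (f : V -> 'M[R]_(m, n)) : open U ->
  (forall i j, Ck k U (fun x => f x i j)) -> Ck k U f.
Proof.
move=> oU H.
have : Ck k U (fun x => \sum_i \sum_j f x i j *: delta_mx i j : 'M[R]_(m, n)).
  by do 2![apply: Ck_sum => // ? _]; apply: CkZl.
by apply: Ck_eq => // x _; rewrite -matrix_sum_delta.
Qed.

Lemma Ck_mulmx k m n p V (U : set V) (f : V -> 'M[R]_(m, n))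
    (g : V -> 'M[R]_(n, p)) : open U ->
  Ck k U f -> Ck k U g -> Ck k U (fun x => f x *m g x).
Proof.
move=> oU fC gC; apply: Ck_mx => // i j.
have : Ck k U (fun x => \sum_l f x i l * g x l j).
  by apply: Ck_sum => // l _; apply: CkM => //; apply: Ck_entry.
by apply: Ck_eq => // x _; rewrite mxE.
Qed.

Lemma Ck_trmx k m n V (U : set V) (f : V -> 'M[R]_(m, n)) : open U ->
  Ck k U f -> Ck k U (fun x => (f x)^T).
Proof.
move=> oU fC; apply: Ck_mx => // i j; apply: Ck_eq (Ck_entry j i oU fC) => // x _.
by rewrite mxE.
Qed.

Lemma Ck_scale k m n V (U : set V) (a : V -> R) (f : V -> 'M[R]_(m, n)) :
  open U -> Ck k U a -> Ck k U f -> Ck k U (fun x => a x *: f x).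
Proof.
move=> oU aC fC; apply: Ck_mx => // i j.
by apply: Ck_eq (CkM oU aC (Ck_entry i j oU fC)) => // x _; rewrite mxE.
Qed.

Lemma derive_rowE n W (g : 'rV[R]_n -> W) x (v : 'rV[R]_n) :
  differentiable g x ->
  'D_v g x = \sum_i v 0 i *: 'D_(delta_mx 0 i) g x.
Proof.
move=> dg; rewrite deriveE// {1}(row_sum_delta v) linear_sum.
by apply: eq_bigr => i _; rewrite linearZ deriveE.
Qed.

Lemma derive_comp V V' W (f : V -> V') (g : V' -> W) x v :
  differentiable f x -> differentiable g (f x) ->
  'D_v (g \o f) x = 'D_('D_v f x) g (f x).
Proof.
move=> df dg; rewrite deriveE; last exact: differentiable_comp.
by rewrite diff_comp//= deriveE// deriveE.
Qed.

(** By the chain rule the directional derivatives of the composite are sums of products of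
    ['D_v f x 0 i] with partial derivatives of g at [f x]. The induction on k applies to the second
    factor, and g is scalar so that [CkM] handles the product. *)
Lemma Ck_comp_scalar k V n (U : set V) (A : set 'rV[R]_n) (f : V -> 'rV[R]_n)
    (g : 'rV[R]_n -> R) : open U -> (forall x, U x -> A (f x)) ->
  Ck k U f -> Ck k A g -> Ck k U (g \o f).
Proof.
move=> oU UA; elim: k f UA g => [|k IH] f UA g.
  by move=> cf cg x Ux; apply: continuous_comp; [apply: cf|apply: cg; apply: UA].
move=> fC gC; have /CkSP[df Df] := fC; have /CkSP[dg Dg] := gC; split=> [x Ux|v].
  by apply: differentiable_comp; [apply: df|apply: dg; apply: UA].
have : Ck k U (fun x => \sum_i 'D_v f x 0 i * ('D_(delta_mx 0 i) g \o f) x).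
  apply: Ck_sum => // i _; apply: CkM => //.
    by apply: Ck_entry.
  by apply: IH => //; apply: CkS.
apply: Ck_eq => // x Ux; have dgx := dg _ (UA _ Ux).
by rewrite (derive_comp v (df _ Ux) dgx) derive_rowE.
Qed.

Lemma Ck_comp k V m n p (U : set V) (A : set 'rV[R]_n) (f : V -> 'rV[R]_n)
    (g : 'rV[R]_n -> 'M[R]_(m, p)) : open U -> open A ->
  (forall x, U x -> A (f x)) ->
  Ck k U f -> Ck k A g -> Ck k U (g \o f).
Proof.
move=> oU oA UA fC gC; apply: Ck_mx => // i j.
exact: (Ck_comp_scalar oU UA fC (Ck_entry i j oA gC)).
Qed.

(** The derivative of 1/f is - (1/f)^2 Df, in which 1/f is already C^k by induction. *)
Lemma Ck_inv k V (U : set V) (f : V -> R) : open U ->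
  (forall x, U x -> f x != 0) -> Ck k U f -> Ck k U (fun x => (f x)^-1).
Proof.
move=> oU f0; elim: k => [|k IH].
  by move=> cf x Ux; apply: cvgV; [apply: f0|apply: cf].
move=> fC; have /CkSP[df Df] := fC; split=> [x Ux|v].
  by apply: differentiableV; [apply: df|apply: f0].
have IHC := IH (CkS fC).
have := CkM oU (Ck_cst k U (-1 : R)) (CkM oU (CkM oU IHC IHC) (Df v)).
apply: Ck_eq => // x Ux.
rewrite (deriveV (f0 _ Ux)); last by apply: diff_derivable; apply: df.
by rewrite /GRing.scale/= expr2 invfM; ring.
Qed.

Lemma Ck_affine k V (U : set R) (a b : V) : Ck k U (fun t => a + t *: b).
Proof.
have : Ck k setT (fun t : R => a + t *: b).
  apply: CkD => //; [exact: openT|exact: Ck_cst|].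
  apply: CkZl; first exact: openT.
  by apply: (@Ck_linear k R R setT idfun) => x; apply: cvg_id.
exact: Ck_sub.
Qed.

Lemma Ck_comp_real k m n (U A : set R) (f : R -> R) (g : R -> 'M[R]_(m, n)) :
  open U -> open A -> (forall x, U x -> A (f x)) ->
  Ck k U f -> Ck k A g -> Ck k U (g \o f).
Proof.
move=> oU oA UA; elim: k f UA m n g => [|k IH] f UA m n g.
  by move=> cf cg x Ux; apply: continuous_comp; [apply: cf|apply: cg; apply: UA].
move=> fC gC; have /CkSP[df Df] := fC; have /CkSP[dg Dg] := gC; split=> [x Ux|v].
  by apply: differentiable_comp; [apply: df|apply: dg; apply: UA].
have := Ck_scale oU (Df v) (IH _ UA _ _ _ (CkS fC) (Dg 1)).
apply: Ck_eq => // x Ux; have dgx := dg _ (UA _ Ux).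
rewrite (derive_comp v (df _ Ux) dgx).
rewrite /= (deriveE _ dgx) (deriveE ('D_v f x) dgx).
by rewrite -[in RHS](mulr1 ('D_v f x)) -[in RHS]/('D_v f x *: 1) linearZ.
Qed.

Lemma mul_jacobian m n (f : 'rV[R]_m -> 'rV[R]_n) x v :
  v *m jacobian f x = 'd f x v.
Proof. by rewrite /jacobian mul_rV_lin1. Qed.

Lemma jacobian_comp m n p (f : 'rV[R]_m -> 'rV[R]_n) (g : 'rV[R]_n -> 'rV[R]_p)
    x : differentiable f x -> differentiable g (f x) ->
  jacobian (g \o f) x = jacobian f x *m jacobian g (f x).
Proof.
move=> df dg; apply/row_matrixP => i.
by rewrite !rowE mulmxA !mul_jacobian diff_comp.
Qed.

Lemma jacobian_id n (x : 'rV[R]_n) : jacobian id x = 1%:M.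
Proof.
apply/row_matrixP => i; rewrite !rowE mul_jacobian mulmx1.
by rewrite (@diff_val _ _ _ _ _ _ _ (is_diff_id x)).
Qed.

Lemma near_eq_jacobian m n (f g : 'rV[R]_m -> 'rV[R]_n) x :
  (\near x, f x = g x) -> differentiable f x -> jacobian g x = jacobian f x.
Proof.
move=> fg df; have [_ E] := near_eq_diff fg df.
exact: (congr1 (fun h : 'rV[R]_m -> 'rV[R]_n => lin1_mx h) E).
Qed.

Lemma smooth_differentiable V W (U : set V) (f : V -> W) x :
  smooth U f -> U x -> differentiable f x.
Proof. by move=> /(_ 1)/CkSP[df _]; apply: df. Qed.

Lemma smooth_continuous V W (U : set V) (f : V -> W) x :
  smooth U f -> U x -> {for x, continuous f}.
Proof. by move=> /(_ 0); apply. Qed.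

Lemma smooth_derive V W (U : set V) (f : V -> W) v :
  smooth U f -> smooth U ('D_v f).
Proof. by move=> fC k; have /CkSP[_] := fC k.+1. Qed.

Lemma Ck_sqrt k V (U : set V) (f : V -> R) : open U ->
  (forall x, U x -> 0 < f x) -> Ck k U f -> Ck k U (fun x => Num.sqrt (f x)).
Proof.
move=> oU f0; elim: k => [|k IH].
  by move=> cf x Ux; apply: (continuous_comp (cf x Ux)); apply: sqrt_continuous.
move=> fC; have /CkSP[df Df] := fC; split=> [x Ux|v].
  apply: differentiable_comp; first exact: df.
  by apply/derivable1_diffP; have [] := is_derive1_sqrt (f0 _ Ux).
have IHC := IH (CkS fC).
(* The derivative of sqrt f is Df / (2 sqrt f). *)
have := CkM oU (Df v) (Ck_inv oU _ (CkM oU (Ck_cst k U (2 : R)) IHC)).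
have ne0 x : U x -> 2 * Num.sqrt (f x) != 0.
  by move=> Ux; rewrite mulf_neq0// gt_eqF// sqrtr_gt0; apply: f0.
move=> /(_ ne0); apply: Ck_eq => // x Ux.
have ds := is_derive1_sqrt (f0 _ Ux).
have dsf : differentiable Num.sqrt (f x) by apply/derivable1_diffP; case: ds.
rewrite (derive_comp v (df _ Ux) dsf) (deriveE _ dsf).
rewrite -(mulr1 ('D_v f x)) -[in RHS]/('D_v f x *: 1) linearZ.
by rewrite /= -(deriveE _ dsf) (@derive_val _ _ _ _ _ _ _ ds) mulr1.
Qed.

End Ck_theory.

(* Unification is otherwise tempted to unfold these epsilon terms. *)
#[global] Opaque jacobian derive diff.

(** * Ordinary differential equations *)

Section mean_value.
Context {R : realType}.
Implicit Types (a b c d t s r x y eps K L A B C : R).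

Lemma rV_coord_le n (v : 'rV[R]_n) i : `|v 0 i| <= `|v|.
Proof.
rewrite [leRHS]/Num.Def.normr/= mx_normrE.
exact: (le_bigmax 0 (fun ij : 'I_1 * 'I_n => `|v ij.1 ij.2|) (0, i)).
Qed.

Lemma rV_norm_le n (v : 'rV[R]_n) c :
  0 <= c -> (forall i, `|v 0 i| <= c) -> `|v| <= c.
Proof.
move=> c0 vc; rewrite [leLHS]/Num.Def.normr/= mx_normrE.
by apply: bigmax_le => // -[i j] _ /=; rewrite (ord1 i).
Qed.

Lemma is_derive_coord n (e : R -> 'rV[R]_n) t (d : 'rV[R]_n) i :
  is_derive t 1 e d -> is_derive t 1 (fun s => e s 0 i) (d 0 i).
Proof.
move=> [de <-]; apply: DeriveDef; first by have /derivable_mxP := de; apply.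
by rewrite derive_mx// mxE.
Qed.

Lemma is_derive_mx m n (e : R -> 'M[R]_(m, n)) t (d : 'M[R]_(m, n)) :
  (forall i j, is_derive t 1 (fun s => e s i j) (d i j)) -> is_derive t 1 e d.
Proof.
move=> H; have de : derivable e t 1 by apply/derivable_mxP => i j; case: (H i j).
apply: DeriveDef => //; apply/matrixP => i j; rewrite derive_mx// mxE.
by case: (H i j).
Qed.

Lemma is_derive_continuous n (e : R -> 'rV[R]_n) t (d : 'rV[R]_n) :
  is_derive t 1 e d -> {for t, continuous e}.
Proof.
by move=> [de _]; apply/differentiable_continuous/derivable1_diffP.
Qed.

Lemma is_derive_reflect n (e : R -> 'rV[R]_n) t (d : 'rV[R]_n) :
  is_derive (- t) 1 e d -> is_derive t 1 (fun s => e (- s)) (- d).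
Proof.
move=> de; apply: is_derive_mx => i j; rewrite (ord1 i).
have [dj1 dj2] := is_derive_coord j de.
have N : is_derive t (1 : R) (fun s : R => - s) (-1).
  exact: is_deriveN (is_derive_id _ _).
have F : is_derive (- t) (1 : R) (fun s => e s 0 j) (d 0 j) by [].
by have := is_derive1_comp F N; rewrite mulrN1 mxE.
Qed.

Lemma is_derive_translate n (e : R -> 'rV[R]_n) t c (d : 'rV[R]_n) :
  is_derive (t + c) 1 e d -> is_derive t 1 (fun s => e (s + c)) d.
Proof.
move=> de; apply: is_derive_mx => i j; rewrite (ord1 i).
have := is_derive_coord j de; rewrite -[t + c]/(shift c t) => F.
by have := is_derive1_comp F (is_derive_shift t 1 c); rewrite mulr1.
Qed.

(** The norm on row vectors is the maximum over the coordinates, so the scalar mean value theorem in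
    each coordinate gives the bound without loss in the constant. *)
Lemma mean_value_le n (e e' : R -> 'rV[R]_n) a b K : a <= b ->
  (forall t, a <= t <= b -> is_derive t 1 e (e' t)) ->
  (forall t, a <= t <= b -> `|e' t| <= K) ->
  `|e b - e a| <= K * (b - a).
Proof.
move=> ab de eK.
have K0 : 0 <= K by apply: le_trans (normr_ge0 _) (eK a _); rewrite lexx ab.
apply: rV_norm_le => [|i]; first by rewrite mulr_ge0// subr_ge0.
have D t : t \in `]a, b[ -> is_derive t 1 (fun s => e s 0 i) (e' t 0 i).
  by rewrite in_itv/= => /andP[/ltW ? /ltW ?]; apply/is_derive_coord/de/andP.
have C : {within `[a, b], continuous (fun s => e s 0 i)}.
  apply: derivable_within_continuous => t; rewrite in_itv/= => tab.
  by have [] := is_derive_coord i (de _ tab).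
have [c cab ec] := MVT_segment ab D C.
rewrite !mxE ec normrM (ger0_norm (_ : 0 <= b - a)) ?subr_ge0//.
apply: ler_wpM2r; first by rewrite subr_ge0.
by apply: le_trans (rV_coord_le _ _) (eK _ _); move: cab; rewrite in_itv.
Qed.

(** P stands for an order-convex set of parameters, in which a and b may come in either order. *)
Lemma mean_value_dist n (e e' : R -> 'rV[R]_n) (P : R -> Prop) a b K :
  (forall s t u, P s -> P t -> s <= u <= t -> P u) -> P a -> P b ->
  (forall t, P t -> is_derive t 1 e (e' t)) ->
  (forall t, P t -> `|e' t| <= K) ->
  `|e b - e a| <= K * `|b - a|.
Proof.
move=> Pi Pa Pb de eK; have [ab|/ltW ba] := leP a b.
  rewrite (ger0_norm (_ : 0 <= b - a)) ?subr_ge0//.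
  by apply: (@mean_value_le _ e e') => // t tab; [apply: de|apply: eK];
    apply: Pi tab.
rewrite distrC (distrC b) (ger0_norm (_ : 0 <= a - b)) ?subr_ge0//.
by apply: (@mean_value_le _ e e') => // t tab; [apply: de|apply: eK];
  apply: Pi tab.
Qed.

Lemma convex_ltn (B : R) (s t u : R) : `|s| < B -> `|t| < B -> s <= u <= t -> `|u| < B.
Proof.
rewrite !ltr_norml => /andP[s1 _] /andP[_ t2] /andP[su ut].
by rewrite (lt_le_trans s1 su) (le_lt_trans ut t2).
Qed.

Lemma convex_len (B : R) (s t u : R) : `|s| <= B -> `|t| <= B -> s <= u <= t -> `|u| <= B.
Proof.
rewrite !ler_norml => /andP[s1 _] /andP[_ t2] /andP[su ut].
by rewrite (le_trans s1 su) (le_trans ut t2).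
Qed.

(** Integrating from -B and subtracting the value at 0 makes every t with |t| < B, of either sign,
    an interior point of the interval of integration. *)
Lemma antiderivative (u : R -> R) B : 0 < B -> continuous u ->
  exists2 F : R -> R, F 0 = 0 & forall t, `|t| < B -> is_derive t 1 F (u t).
Proof.
move=> B0 cu; pose G (x : R) := Rintegral lebesgue_measure `[- B, x] u.
exists (fun x => G x - G 0) => [|t]; first by rewrite subrr.
rewrite ltr_norml => /andP[Bt tB].
have iu : (lebesgue_measure : measure _ R).-integrable `[- B, B] (EFin \o u).
  apply: continuous_compact_integrable; first exact: segment_compact.
  exact: continuous_subspaceT.
have [dG GE] := continuous_FTC1_closed tB iu Bt (cu t).
move: dG GE; rewrite -/G => dG GE.
have D : is_derive t 1 G (u t) := DeriveDef dG (etrans (esym (derive1E _ _)) GE).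
have := is_deriveB D (is_derive_cst (G 0) t 1); rewrite subr0.
by apply.
Qed.

Lemma antiderivative_rV n (u : R -> 'rV[R]_n) B : 0 < B -> continuous u ->
  exists2 F : R -> 'rV[R]_n, F 0 = 0 &
    forall t, `|t| < B -> is_derive t 1 F (u t).
Proof.
move=> B0 cu.
have /choice[F FP] i : exists F : R -> R, F 0 = 0 /\
    forall t, `|t| < B -> is_derive t 1 F (u t 0 i).
  have [F F0 dF] := @antiderivative (fun t => u t 0 i) B B0 (fun t =>
    @continuous_comp _ _ _ u (fun A : 'rV[R]_n => A 0 i) t (cu t)
      (@coord_continuous _ _ _ _ _ _)).
  by exists F.
exists (fun t => \row_i F i t) => [|t tB].
  by apply/rowP => i; rewrite !mxE; case: (FP i).
apply: is_derive_mx => i j; rewrite (ord1 i); have [_ /(_ t tB)] := FP j.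
by under [X in _ -> is_derive _ _ X _]eq_fun do rewrite mxE.
Qed.

Lemma le_geometric (a b c : R) :
  (forall k, a <= b + c / 2 ^+ k) -> a <= b.
Proof.
move=> H; rewrite leNgt; apply/negP => ba.
have d0 : 0 < a - b by rewrite subr_gt0.
pose k := Num.Def.archi_bound (c / (a - b)).
have := upper_nthrootP (leqnn k); rewrite ltr_pdivrMr// => ck.
have p0 : 0 < 2 ^+ k :> R by rewrite exprn_gt0.
have := H k; rewrite -lerBlDl ler_pdivlMr// mulrC => /le_lt_trans/(_ ck).
by rewrite ltxx.
Qed.

(** The explicit rate is what [le_geometric] consumes later: with it, inequalities between terms of
    the sequence pass to the limit. *)
Lemma cauchy_geometric n (u : nat -> 'rV[R]_n) C : 0 <= C ->
  (forall k, `|u k.+1 - u k| <= C / 2 ^+ k) ->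
  exists l, forall k, `|l - u k| <= 2 * C / 2 ^+ k.
Proof.
move=> C0 H.
have p0 k : 0 < 2 ^+ k :> R by rewrite exprn_gt0.
(* The subtracted tail makes the induction on j close; it is dropped right after. *)
have uj k j : `|u (k + j)%N - u k| <= 2 * C / 2 ^+ k - 2 * C / 2 ^+ (k + j).
  elim: j => [|j IH]; first by rewrite addn0 !subrr normr0.
  rewrite -(subrKA (u (k + j)%N)) (le_trans (ler_normD _ _))//.
  have := lerD (H (k + j)%N) IH; rewrite addnS => /le_trans; apply.
  rewrite exprS invfM.
  suff -> : C / 2 ^+ (k + j) = 2 * C / 2 ^+ (k + j) - 2 * C * (2^-1 / 2 ^+ (k + j)).
    by rewrite addrC addrA subrK.
  by field; rewrite gt_eqF.
have uj' k j : `|u (k + j)%N - u k| <= 2 * C / 2 ^+ k.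
  apply: le_trans (uj k j) _; rewrite gerBl.
  by rewrite divr_ge0 ?mulr_ge0// ltW.
have small (e : R) : 0 < e -> exists k, 2 * C / 2 ^+ k < e.
  move=> e0; exists (Num.Def.archi_bound (2 * C / e)).
  have := upper_nthrootP (leqnn (Num.Def.archi_bound (2 * C / e))).
  rewrite ltr_pdivrMr// => h; rewrite ltr_pdivrMr; last exact: p0.
  by rewrite [e * _]mulrC.
have /cauchy_cvgP/cvg_ex[l ul] : cauchy (u @ \oo).
  apply: cauchy_exP => e e0; have [k ke] := small e e0.
  exists (u k); exists k => // j /= kj.
  rewrite -ball_normE/= distrC -(subnKC kj).
  exact: le_lt_trans (uj' _ _) ke.
exists l => k.
apply/ler_addgt0Pr => e e0.
have /cvgrPdist_lt/(_ e e0)[N _ HN] := ul.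
have := HN (k + N)%N (leq_addl _ _) => lN.
rewrite -(subrKA (u (k + N)%N)) (le_trans (ler_normD _ _))// addrC lerD//.
exact: ltW.
Qed.

Lemma lipschitz_continuous (V W : normedModType R) (f : V -> W) L (x : V) r : 0 < r ->
  (forall y : V, `|y - x| < r -> `|f y - f x| <= L * `|y - x|) ->
  {for x, continuous f}.
Proof.
move=> r0 H; apply/cvgrPdist_lt => e e0.
pose d := Num.min r (e / (`|L| + 1)).
have L1 : 0 < `|L| + 1 by rewrite ltr_wpDl.
have d0 : 0 < d by rewrite lt_min r0 divr_gt0.
apply/nbhs_normP; exists d => //= y /=; rewrite lt_min distrC => /andP[yr ye].
rewrite distrC; apply: le_lt_trans (H _ yr) _.
move: ye; rewrite ltr_pdivlMr// => ye; apply: le_lt_trans ye.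
rewrite mulrC ler_wpM2l// (le_trans (ler_norm _))// lerDl//.
Qed.

(** The condition eps * L <= 1/2 takes the place of an exponential factor: the maximum m of |e| over
    [0, t] satisfies m <= A + (L m + K) eps, whence m / 2 <= A + K eps. *)
Lemma gronwall_short n (e e' : R -> 'rV[R]_n) A L K eps : 0 <= L -> 0 <= K ->
  eps * L <= 2^-1 ->
  (forall t, `|t| < eps -> is_derive t 1 e (e' t)) ->
  (forall t, `|t| < eps -> `|e' t| <= L * `|e t| + K) ->
  `|e 0| <= A ->
  forall t, `|t| < eps -> `|e t| <= 2 * (A + K * eps).
Proof.
move=> L0 K0 eL.
(* One side suffices: the reflected curve s |-> e (- s) satisfies the same hypotheses. *)
suff H (e1 e1' : R -> 'rV[R]_n) t : 0 <= t -> t < eps ->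
    (forall t, `|t| < eps -> is_derive t 1 e1 (e1' t)) ->
    (forall t, `|t| < eps -> `|e1' t| <= L * `|e1 t| + K) ->
    `|e1 0| <= A -> `|e1 t| <= 2 * (A + K * eps).
  move=> de eK eA t teps; have [t0|/ltW t0] := leP 0 t.
    by apply: H de eK eA => //; rewrite -(ger0_norm t0).
  have := H (fun s => e (- s)) (fun s => - e' (- s)) (- t); rewrite opprK; apply.
  - by rewrite oppr_ge0.
  - by rewrite -(ler0_norm t0).
  - by move=> s; rewrite -normrN => /de; apply: is_derive_reflect.
  - by move=> s; rewrite normrN -(normrN s); apply: eK.
  - by rewrite oppr0.
move=> t0 te de eK eA.
have C : {within `[0, t], continuous (fun s => `|e1 s|)}.
  apply: continuous_in_subspaceT => s; rewrite inE/= in_itv/= => /andP[s0 st].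
  apply: (@continuous_comp _ _ _ e1 Num.norm); last exact: norm_continuous.
  apply: is_derive_continuous (de s _).
  by rewrite ger0_norm// (le_lt_trans st).
have [c] := EVT_max t0 C; rewrite in_itv/= => /andP[c0 ct] cmax.
have ceps : c < eps := le_lt_trans ct te.
have M : `|e1 c - e1 0| <= (L * `|e1 c| + K) * (c - 0).
  apply: (@mean_value_le _ e1 e1') => // s /andP[s0 sc].
    by apply: de; rewrite ger0_norm// (le_lt_trans sc).
  apply: le_trans (eK s _) _; first by rewrite ger0_norm// (le_lt_trans sc).
  by rewrite lerD2r ler_wpM2l// cmax// in_itv/= s0 (le_trans sc ct).
have e1c0 := normr_ge0 (e1 c).
have e1c : `|e1 c| <= A + (L * `|e1 c| + K) * c.
  rewrite -{1}(subrK (e1 0) (e1 c)) (le_trans (ler_normD _ _))// addrC.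
  by rewrite lerD// -[X in _ * X]subr0.
have cL : c * L <= 2^-1 by apply: le_trans eL; rewrite ler_wpM2r// ltW.
have h1 : `|e1 c| * (c * L) <= `|e1 c| * 2^-1 by rewrite ler_wpM2l.
have h2 : K * c <= K * eps by rewrite ler_wpM2l// ltW.
apply: (@le_trans _ _ `|e1 c|); first by apply: cmax; rewrite in_itv/= t0 lexx.
by nra.
Qed.

End mean_value.

(** * Picard iteration *)

Section picard.
Context {R : realType}.
Implicit Types (a b c d t s r eps K L A B C D Mb : R).

Lemma near_norm_ball (V : normedModType R) (x0 x : V) r :
  `|x - x0| < r -> \forall y \near x, `|y - x0| < r.
Proof.
move=> xr; apply/nbhs_normP; exists (r - `|x - x0|); rewrite /= ?subr_gt0//.
move=> y /=; rewrite distrC ltrBrDr; apply: le_lt_trans.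
by rewrite -(subrKA x) (le_trans (ler_normD _ _)).
Qed.

Lemma open_norm_ball (V : normedModType R) (x0 : V) r :
  open [set y | `|y - x0| < r].
Proof. by rewrite openE => x /near_norm_ball. Qed.

(** Retraction of the line onto [-eps, eps]. Composing with it turns the Picard iterates into total
    functions with global bounds, so that functions on an interval need no separate treatment. *)
Definition clamp eps t := Num.max (- eps) (Num.min eps t).

Lemma clamp_norm eps t : 0 <= eps -> `|clamp eps t| <= eps.
Proof.
move=> e0; rewrite /clamp ler_norml le_max lexx/= ge_max ge_min lexx/= andbT.
by rewrite ge0_cp.
Qed.

Lemma clamp_id eps t : `|t| < eps -> clamp eps t = t.
Proof.
rewrite ltr_norml => /andP[t1 t2]; rewrite /clamp.
by rewrite (min_idPr (ltW t2)) (max_idPr (ltW t1)).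
Qed.

Lemma clamp_dist eps s t : 0 <= eps -> `|clamp eps t - clamp eps s| <= `|t - s|.
Proof.
move=> e0; wlog st : s t / s <= t => [H|].
  by have [/H//|/ltW/H] := leP s t; rewrite distrC (distrC s).
rewrite [leRHS]ger0_norm ?subr_ge0// ler_norml /clamp.
by case: (leP eps t) => ?; case: (leP eps s) => ?; case: (leP (- eps) eps) => ?;
  case: (leP (- eps) t) => ?; case: (leP (- eps) s) => ?; lra.
Qed.

Lemma is_derive_comp (V W : normedModType R) (g : V -> W) (z : R -> V) t (d' : V) :
  is_derive t 1 z d' -> differentiable g (z t) ->
  is_derive t 1 (g \o z) ('D_d' g (z t)).
Proof.
move=> [dz <-] dg; have dz' : differentiable z t by apply/derivable1_diffP.
apply: DeriveDef; first by apply: diff_derivable; apply: differentiable_comp.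
exact: derive_comp.
Qed.

Lemma is_derive_affine (V : normedModType R) (x v : V) t :
  is_derive t (1 : R) (fun s => x + s *: v) v.
Proof.
have D := is_derive_cst x t (1 : R).
have := is_deriveD D (@DeriveDef _ _ _ t 1 ( *:%R ^~ v) v _ _).
rewrite add0r; apply.
- apply: diff_derivable; exact: (@ex_diff _ _ _ _ _ _ _ (is_diff_scalel t v)).
- rewrite deriveE; last exact: (@ex_diff _ _ _ _ _ _ _ (is_diff_scalel t v)).
  by rewrite (@diff_val _ _ _ _ _ _ _ (is_diff_scalel t v)) scale1r.
Qed.

(** The contraction factor 1/2 comes from eps * L <= 1/2, and the bound on |x - x0| + Mb * eps keeps
    all iterates inside the ball where f is controlled. *)
Lemma picard n (f : 'rV[R]_n -> 'rV[R]_n) (x0 x : 'rV[R]_n) r Mb L eps :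
  0 < eps -> 0 <= Mb -> 0 <= L ->
  (forall y, `|y - x0| < r -> `|f y| <= Mb) ->
  (forall y z, `|y - x0| < r -> `|z - x0| < r -> `|f y - f z| <= L * `|y - z|) ->
  `|x - x0| + Mb * eps < r -> eps * L <= 2^-1 ->
  exists2 phi : R -> 'rV[R]_n, phi 0 = x & forall t, `|t| < eps ->
    is_derive t 1 phi (f (phi t)) /\ `|phi t - x0| < r.
Proof.
move=> e0 M0 L0 fM fL xr eL; set C := Mb * eps in xr.
have C0 : 0 <= C by rewrite mulr_ge0// ltW.
have r0 : 0 < r by apply: le_lt_trans xr; rewrite addr_ge0.
(* Invariant of the iteration: the curve stays within C of x and is Mb-Lipschitz. Both clauses pass
   to pointwise limits. *)
pose good (z : R -> 'rV[R]_n) := (forall t, `|z t - x| <= C) /\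
  (forall s t, `|z t - z s| <= Mb * `|t - s|).
have good_ball z t : good z -> `|z t - x0| < r.
  move=> [zC _]; rewrite -(subrKA x) (le_lt_trans (ler_normD _ _))//.
  by rewrite addrC (le_lt_trans _ xr)// lerD2l.
have good_cts z : good z -> continuous (f \o z).
  move=> gz t; apply: (@continuous_comp _ _ _ z f).
    by apply: (@lipschitz_continuous _ R _ z Mb t 1) => // y _; apply: gz.2.
  have d0 : 0 < r - `|z t - x0| by rewrite subr_gt0 good_ball.
  apply: (lipschitz_continuous (L := L) d0) => y yr; apply: fL.
    rewrite -(subrKA (z t)) (le_lt_trans (ler_normD _ _))//.
    by rewrite -ltrBrDr.
  exact: good_ball.
(* Antiderivatives are only known to exist, so the Picard operator is obtained by choice; its values
   on curves that are not good are unconstrained. Radius 2 * eps puts the closed interval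
   [-eps, eps] in the interior. *)
have [nx nxP] : exists nx : (R -> 'rV[R]_n) -> R -> 'rV[R]_n, forall z, good z ->
    exists F, [/\ F 0 = 0, forall t, `|t| < 2 * eps -> is_derive t 1 F (f (z t))
      & forall t, nx z t = x + F (clamp eps t)].
  have /choice[nx nxP] z : exists z' : R -> 'rV[R]_n, good z ->
      exists F, [/\ F 0 = 0, forall t, `|t| < 2 * eps ->
        is_derive t 1 F (f (z t)) & forall t, z' t = x + F (clamp eps t)].
    have [gz|] := pselect (good z); last by exists z.
    have e20 : 0 < 2 * eps by rewrite mulr_gt0.
    have [F F0 dF] := antiderivative_rV e20 (good_cts _ gz).
    by exists (fun t => x + F (clamp eps t)) => _; exists F.
  by exists nx.
have ltc t : `|t| <= eps -> `|t| < 2 * eps.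
  by move=> te; apply: le_lt_trans te _; rewrite ltr_pMl// ltr1n.
have nx_good z : good z -> good (nx z).
  move=> gz; have [F [F0 dF nxE]] := nxP _ gz.
  have lip s t : `|F (clamp eps t) - F (clamp eps s)| <= Mb * `|clamp eps t - clamp eps s|.
    apply: (@mean_value_dist _ _ F (f \o z) (fun t => `|t| <= eps)).
    - exact: convex_len.
    - exact/clamp_norm/ltW.
    - exact/clamp_norm/ltW.
    - by move=> u /ltc/dF.
    - by move=> u _; apply/fM/good_ball.
  split=> [t|s t].
    rewrite nxE addrC addKr -[F _]subr0 -F0.
    have -> : (0 : R) = clamp eps 0 by rewrite clamp_id// normr0.
    apply: le_trans (lip _ _) _; rewrite ler_wpM2l//.
    by rewrite (clamp_id (_ : `|0| < eps)) ?normr0// subr0 clamp_norm// ltW.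
  rewrite !nxE opprD addrACA subrr add0r (le_trans (lip _ _))//.
  by rewrite ler_wpM2l// clamp_dist// ltW.
have nx_contr z w D : good z -> good w -> (forall t, `|z t - w t| <= D) ->
    forall t, `|nx z t - nx w t| <= D / 2.
  move=> gz gw zwD t; have [F [F0 dF ->]] := nxP _ gz.
  have [G [G0 dG ->]] := nxP _ gw.
  rewrite opprD addrACA subrr add0r.
  have D0 : 0 <= D := le_trans (normr_ge0 _) (zwD 0).
  have := @mean_value_dist _ _ (F - G) (fun t => f (z t) - f (w t))
    (fun t => `|t| <= eps) 0 (clamp eps t) (L * D).
  rewrite -[(F - G) 0]/(F 0 - G 0) F0 G0 !subr0.
  rewrite -[(F - G) _]/(F _ - G _) => H; apply: le_trans (H _ _ _ _ _) _.
  - exact: convex_len.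
  - by rewrite normr0 ltW.
  - exact/clamp_norm/ltW.
  - by move=> u /ltc ue; apply: is_deriveB; [apply: dF|apply: dG].
  - move=> u _; apply: le_trans (fL _ _ _ _) _; try exact: good_ball.
    by rewrite ler_wpM2l.
  have := clamp_norm t (ltW e0) => ce.
  have : D * (eps * L) <= D * 2^-1 by rewrite ler_wpM2l.
  have : L * D * `|clamp eps t| <= L * D * eps by rewrite ler_wpM2l// mulr_ge0.
  by lra.
pose z k := iter k nx (fun=> x).
have gz k : good (z k).
  elim: k => [|k IH]; last exact: nx_good.
  by split=> *; rewrite subrr normr0// mulr_ge0.
have dz k t : `|z k.+1 t - z k t| <= C / 2 ^+ k.
  elim: k t => [|k IH] t; first by rewrite expr0 divr1; have [+ _] := gz 1%N; apply.
  have := nx_contr _ _ _ (gz k.+1) (gz k) IH t; rewrite /= exprSr invfM.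
  by rewrite mulrA.
have /choice[phi phiP] t : exists l, forall k, `|l - z k t| <= 2 * C / 2 ^+ k.
  exact: (@cauchy_geometric _ _ (fun k => z k t)).
have gphi : good phi.
  split=> [t|s t].
    apply: (@le_geometric _ _ _ (2 * C)) => k.
    rewrite -(subrKA (z k t)) (le_trans (ler_normD _ _))// addrC lerD//.
    by have [+ _] := gz k; apply.
  apply: (@le_geometric _ _ _ (2 * C + 2 * C)) => k.
  have -> : phi t - phi s = (z k t - z k s) + ((phi t - z k t) - (phi s - z k s)).
    by apply/rowP => i; rewrite !mxE; ring.
  rewrite (le_trans (ler_normD _ _))// lerD//; first by have [_] := gz k; apply.
  by rewrite (le_trans (ler_normB _ _))// mulrDl lerD.
(* The limit is a fixed point: [nx phi] and [phi] are both within a multiple of 2^-k of the iterate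
   [z k.+1]. *)
have phiE t : nx phi t = phi t.
  apply/eqP; rewrite -subr_eq0 -normr_le0.
  apply: (@le_geometric _ _ _ (2 * C)) => k; rewrite add0r.
  rewrite -(subrKA (z k.+1 t)) (le_trans (ler_normD _ _))//.
  have h1 := nx_contr _ _ _ gphi (gz k) (phiP^~ k) t.
  have h2 := phiP t k.+1; rewrite distrC in h2.
  apply: le_trans (lerD h1 h2) _.
  rewrite exprS invfM; set q := (2 ^+ k)^-1.
  by rewrite le_eqVlt; apply/orP; left; apply/eqP; field.
have [F [F0 dF nxE]] := nxP _ gphi.
exists phi => [|t te].
  by rewrite -phiE nxE clamp_id ?normr0// F0 addr0.
split; last exact: good_ball.
have D : is_derive t 1 (fun s => x + F s) (f (phi t)).
  rewrite -[f (phi t)]add0r; apply: is_deriveD.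
  by apply: dF; rewrite ltc// ltW.
(* Where |t| < eps the clamp is locally the identity, so the fixed-point equation can be
   differentiated. *)
apply: near_eq_is_derive D.
have : \forall s \near t, `|s| < eps.
  have : `|t - 0| < eps by rewrite subr0.
  by move=> /near_norm_ball; apply: filterS => s; rewrite subr0.
by apply: filterS => s se; rewrite -phiE nxE clamp_id.
Qed.

End picard.

(** * Local bounds on a smooth map and its derivatives *)

Section local_bounds.
Context {R : realType}.
Implicit Types (a b c d t s r eps K L A B C D Mb : R).

Lemma locally_bounded (V W : normedModType R) (g : V -> W) (x : V) :
  {for x, continuous g} -> exists2 B, 0 <= B & \forall y \near x, `|g y| <= B.
Proof.
move=> cg; exists (`|g x| + 1); first by rewrite addr_ge0.
have /cvgrPdist_lt/(_ 1 ltr01) := cg; apply: filterS => y.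
by move=> /ltW h; rewrite -lerBlDl (le_trans (lerB_dist _ _))// distrC.
Qed.


Lemma locally_bounded_sum (I : finType) (V W : normedModType R)
    (g : I -> V -> W) (x : V) : (forall i, {for x, continuous (g i)}) ->
  exists2 B, 0 <= B & \forall y \near x, \sum_i `|g i y| <= B.
Proof.
move=> cg.
have /choice[B BP] i : exists B, 0 <= B /\ \forall y \near x, `|g i y| <= B.
  by have [B B0 gB] := locally_bounded (cg i); exists B.
exists (\sum_i B i); first by apply: sumr_ge0 => i _; case: (BP i).
have : \forall y \near x, forall i, `|g i y| <= B i.
  by apply: filter_forall => i; case: (BP i).
by apply: filterS => y gB; apply: ler_sum.
Qed.

Lemma le_term_sum (I : finType) (F : I -> R) i :
  (forall j, 0 <= F j) -> F i <= \sum_j F j.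
Proof. by move=> F0; rewrite (bigD1 i)//= lerDl sumr_ge0. Qed.

Lemma ball_convex (V : normedModType R) (x0 x v : V) r s : 0 <= s <= 1 ->
  `|x - x0| < r -> `|x + v - x0| < r -> `|x + s *: v - x0| < r.
Proof.
move=> /andP[s0 s1] h1 h2.
have -> : x + s *: v - x0 = (1 - s) *: (x - x0) + s *: (x + v - x0).
  rewrite (addrAC x v) (scalerDr s (x - x0)) addrA -scalerDl subrK scale1r addrAC.
  by [].
rewrite (le_lt_trans (ler_normD _ _))// !normrZ.
rewrite (ger0_norm s0) (ger0_norm (_ : 0 <= 1 - s)) ?subr_ge0//.
have s1' : 0 <= 1 - s by rewrite subr_ge0.
set m := Num.max `|x - x0| `|x + v - x0|.
have mr : m < r by rewrite gt_max h1.
have : (1 - s) * `|x - x0| <= (1 - s) * m by rewrite ler_wpM2l// le_max lexx.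
have : s * `|x + v - x0| <= s * m by rewrite ler_wpM2l// le_max lexx orbT.
by lra.
Qed.

Lemma diff_row_le n (W : normedModType R) (g : 'rV[R]_n -> W) (x v : 'rV[R]_n)
    B : differentiable g x -> \sum_i `|'D_(delta_mx 0 i) g x| <= B ->
  `|'D_v g x| <= B * `|v|.
Proof.
move=> dg gB; rewrite derive_rowE//.
rewrite (le_trans (ler_norm_sum _ _ _))//.
apply: le_trans (ler_wpM2r (normr_ge0 v) gB); rewrite mulr_suml.
by apply: ler_sum => i _; rewrite normrZ mulrC ler_wpM2l// rV_coord_le.
Qed.

Lemma lipschitz_ball n p (g : 'rV[R]_n -> 'rV[R]_p) (x0 : 'rV[R]_n) r B :
  (forall x : 'rV[R]_n, `|x - x0| < r -> differentiable g x) ->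
  (forall x : 'rV[R]_n, `|x - x0| < r -> \sum_i `|'D_(delta_mx 0 i) g x| <= B) ->
  forall x y : 'rV[R]_n, `|x - x0| < r -> `|y - x0| < r -> `|g y - g x| <= B * `|y - x|.
Proof.
move=> dg gB x y xr yr; set v := y - x.
have xv : x + v = y by rewrite /v addrC subrK.
have H := @mean_value_le _ _ (g \o (fun s => x + s *: v))
  (fun s => 'D_v g (x + s *: v)) 0 1 (B * `|v|) ler01.
rewrite /= scale0r addr0 scale1r xv subr0 mulr1 in H.
have sr s : 0 <= s <= 1 -> `|x + s *: v - x0| < r.
  by move=> s01; apply: ball_convex => //; rewrite xv.
apply: H => s /sr sr'.
  by apply: is_derive_comp; [exact: is_derive_affine|exact: dg].
by apply: diff_row_le; [exact: dg|exact: gB].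
Qed.

(** Constants valid on one ball: Mb for f, L for its first derivatives, K for the second-order
    Taylor remainder. Existence and uniqueness of solutions rest on [sb_norm] and [sb_lip];
    differentiability of the flow adds [sb_dnorm] and [sb_taylor]. *)
Record smooth_bounds n p (f : 'rV[R]_n -> 'rV[R]_p) (x0 : 'rV[R]_n) r Mb L K :
    Prop := SmoothBounds {
  sb_diff : forall x : 'rV[R]_n, `|x - x0| < r -> differentiable f x;
  sb_norm : forall x : 'rV[R]_n, `|x - x0| < r -> `|f x| <= Mb;
  sb_dnorm : forall x v : 'rV[R]_n, `|x - x0| < r -> `|'D_v f x| <= L * `|v|;
  sb_lip : forall x y : 'rV[R]_n, `|x - x0| < r -> `|y - x0| < r ->
    `|f y - f x| <= L * `|y - x|;
  sb_taylor : forall x y : 'rV[R]_n, `|x - x0| < r -> `|y - x0| < r ->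
    `|f y - f x - 'D_(y - x) f x| <= K * `|y - x| ^+ 2 }.

Lemma smooth_local_bounds n p (f : 'rV[R]_n -> 'rV[R]_p) (U : set 'rV[R]_n) x0 :
  open U -> U x0 -> smooth U f ->
  exists r Mb L K, [/\ 0 < r, 0 <= Mb, 0 <= L /\ 0 <= K,
    forall x : 'rV[R]_n, `|x - x0| < r -> U x & smooth_bounds f x0 r Mb L K].
Proof.
move=> oU Ux0 fC.
have D1 i := smooth_derive (delta_mx 0 i) fC.
have D2 i j := smooth_derive (delta_mx 0 j) (D1 i).
have [Mb M0 fM] := locally_bounded (smooth_continuous fC Ux0).
have [L L0 fL] := locally_bounded_sum (fun i => smooth_continuous (D1 i) Ux0).
have [K K0 fK] := locally_bounded_sum (I := ('I_n * 'I_n)%type)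
  (fun ij => smooth_continuous (D2 ij.1 ij.2) Ux0).
have : \forall y \near x0, [/\ U y, `|f y| <= Mb,
    \sum_i `|'D_(delta_mx 0 i) f y| <= L &
    \sum_(ij : 'I_n * 'I_n) `|'D_(delta_mx 0 ij.2) ('D_(delta_mx 0 ij.1) f) y| <= K].
  apply: filterS (filterI (near_open oU Ux0) (filterI fM (filterI fL fK))).
  by move=> y [? [? []]].
move=> /nbhs_normP[r /= r0 Hr].
have {}Hr (y : 'rV[R]_n) : `|y - x0| < r -> [/\ U y, `|f y| <= Mb,
    \sum_i `|'D_(delta_mx 0 i) f y| <= L &
    \sum_(ij : 'I_n * 'I_n) `|'D_(delta_mx 0 ij.2) ('D_(delta_mx 0 ij.1) f) y| <= K].
  by move=> yr; apply: Hr; rewrite /= distrC.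
have UB (y : 'rV[R]_n) : `|y - x0| < r -> U y by move=> /Hr[].
have dfB (y : 'rV[R]_n) : `|y - x0| < r -> differentiable f y.
  by move=> /UB; apply: smooth_differentiable fC.
(* Each of the n partial derivatives is K-Lipschitz, whence n K in the remainder. *)
exists r, Mb, L, (\sum_(i < n) K); split=> //.
  by split=> //; apply: sumr_ge0.
split=> //.
- by move=> x /Hr[].
- by move=> x v xr; apply: diff_row_le; [exact: dfB|case: (Hr _ xr)].
- by apply: lipschitz_ball => // x /Hr[].
move=> x y xr yr; have [v vE] : exists v : 'rV[R]_n, v = y - x by exists (y - x).
have xv : x + v = y by rewrite vE addrC subrK.
rewrite -vE.
have sr s : 0 <= s <= 1 -> `|x + s *: v - x0| < r.
  by move=> s01; apply: ball_convex => //; rewrite xv.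
(* Taylor remainder: the mean value inequality on [0, 1] for s |-> f (x + s v) - s D_v f (x). *)
have H := @mean_value_le _ _ (fun s => (f \o (fun s => x + s *: v)) s - (s *: 'D_v f x))
  (fun s => 'D_v f (x + s *: v) - 'D_v f x) 0 1 ((\sum_(i < n) K) * `|v| ^+ 2) ler01.
rewrite /= !scale0r addr0 !scale1r xv !subr0 mulr1 addrAC in H.
apply: H => s /[dup] s01 /sr sr'.
  apply: is_deriveB.
    by apply: is_derive_comp; [exact: is_derive_affine|exact: dfB].
  by have := is_derive_affine 0 ('D_v f x) s; under eq_fun do rewrite add0r.
have [z zE] : exists z : 'rV[R]_n, z = x + s *: v by exists (x + s *: v).
rewrite -zE in sr' *.
rewrite (derive_rowE v (dfB _ sr')) (derive_rowE v (dfB _ xr)).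
rewrite -sumrB (le_trans (ler_norm_sum _ _ _))// mulr_suml.
apply: ler_sum => i _; rewrite -scalerBr normrZ expr2 mulrCA.
have vi := rV_coord_le v i.
apply: ler_pM => //.
apply: (@le_trans _ _ (K * `|z - x|)).
  apply: (@lipschitz_ball _ _ ('D_(delta_mx 0 i) f) x0 r) => // w wr.
    exact: smooth_differentiable (D1 i) (UB _ wr).
  have [_ _ _] := Hr _ wr; apply: le_trans.
  rewrite -(pair_bigA _ (fun i j => `|'D_(delta_mx 0 j) ('D_(delta_mx 0 i) f) w|))/=.
  apply: (@le_term_sum _ (fun i => \sum_j `|'D_(delta_mx 0 j) ('D_(delta_mx 0 i) f) w|)).
  by move=> j; apply: sumr_ge0.
rewrite zE addrAC subrr add0r normrZ ler_wpM2l//.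
case/andP: s01 => s0 s1; rewrite (ger0_norm s0).
by rewrite ler_piMl.
Qed.

End local_bounds.

(** * Smooth dependence of solutions on the initial point *)

Section smooth_dependence.
Context {R : realType}.
Implicit Types (a b c d t s r eps K L A B C D Mb : R).

Lemma is_derive_lsubmx n1 n2 (e : R -> 'rV[R]_(n1 + n2)) t
    (d' : 'rV[R]_(n1 + n2)) : is_derive t 1 e d' ->
  is_derive t 1 (fun s => lsubmx (e s)) (lsubmx d').
Proof.
move=> de; apply: is_derive_mx => i j; rewrite (ord1 i) mxE.
by under eq_fun do rewrite mxE; apply: is_derive_coord.
Qed.

Lemma is_derive_rsubmx n1 n2 (e : R -> 'rV[R]_(n1 + n2)) t
    (d' : 'rV[R]_(n1 + n2)) : is_derive t 1 e d' ->
  is_derive t 1 (fun s => rsubmx (e s)) (rsubmx d').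
Proof.
move=> de; apply: is_derive_mx => i j; rewrite (ord1 i) mxE.
by under eq_fun do rewrite mxE; apply: is_derive_coord.
Qed.

Lemma Ck_id k (V : normedModType R) (U : set V) : Ck k U id.
Proof. exact: (@Ck_linear _ k V V U idfun (fun x => cvg_id)). Qed.

Lemma Ck_lsubmx k m n1 n2 (V : normedModType R) (U : set V)
    (f : V -> 'M[R]_(m, n1 + n2)) : open U ->
  Ck k U f -> Ck k U (fun x => lsubmx (f x)).
Proof.
move=> oU fC; apply: Ck_mx => // i j.
by under eq_fun do rewrite mxE; apply: Ck_entry.
Qed.

Lemma Ck_rsubmx k m n1 n2 (V : normedModType R) (U : set V)
    (f : V -> 'M[R]_(m, n1 + n2)) : open U ->
  Ck k U f -> Ck k U (fun x => rsubmx (f x)).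
Proof.
move=> oU fC; apply: Ck_mx => // i j.
by under eq_fun do rewrite mxE; apply: Ck_entry.
Qed.

Lemma Ck_row_mx k m n1 n2 (V : normedModType R) (U : set V)
    (f : V -> 'M[R]_(m, n1)) (g : V -> 'M[R]_(m, n2)) : open U ->
  Ck k U f -> Ck k U g -> Ck k U (fun x => row_mx (f x) (g x)).
Proof.
move=> oU fC gC; apply: Ck_mx => // i j; case: (split_ordP j) => l ->.
  by under eq_fun do rewrite row_mxEl; apply: Ck_entry.
by under eq_fun do rewrite row_mxEr; apply: Ck_entry.
Qed.

Lemma mulmxr_continuous n p (M : 'M[R]_(n, p)) :
  continuous (fun u : 'rV[R]_n => u *m M).
Proof.
move=> u; have := Ck_mulmx openT (Ck_id 0 [set: 'rV[R]_n]) (Ck_cst 0 setT M).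
exact.
Qed.

Lemma row_mx_norm_lt n1 n2 (u : 'rV[R]_n1) (v : 'rV[R]_n2) c :
  `|u| < c -> `|v| < c -> `|row_mx u v| < c.
Proof.
move=> uc vc; apply: (@le_lt_trans _ _ (Num.max `|u| `|v|)); last by rewrite gt_max uc.
apply: rV_norm_le => [|i]; first by rewrite le_max normr_ge0.
rewrite le_max; case: (split_ordP i) => l ->.
  by rewrite row_mxEl rV_coord_le.
by rewrite row_mxEr rV_coord_le orbT.
Qed.

Lemma derive_dir_sum (V W : normedModType R) (g : V -> W) x n (a : 'I_n -> R)
    (u : 'I_n -> V) : differentiable g x ->
  'D_(\sum_i a i *: u i) g x = \sum_i a i *: 'D_(u i) g x.
Proof.
move=> dg; rewrite (deriveE _ dg) linear_sum; apply: eq_bigr => i _.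
by rewrite linearZ (deriveE _ dg).
Qed.

Lemma derive_dirD (V W : normedModType R) (g : V -> W) x (u v : V) :
  differentiable g x -> 'D_(u + v) g x = 'D_u g x + 'D_v g x.
Proof. by move=> dg; rewrite !(deriveE _ dg) linearD. Qed.

Lemma derive_dirZ (V W : normedModType R) (g : V -> W) x (v : V) a :
  differentiable g x -> 'D_(a *: v) g x = a *: 'D_v g x.
Proof. by move=> dg; rewrite !(deriveE _ dg) linearZ. Qed.

(** Criterion by which the solution of the linearised equation is recognised as the derivative of
    the flow. *)
Lemma quadratic_error_diff (V W : normedModType R) (g : V -> W)
    (l : {linear V -> W}) (x : V) r C : 0 < r -> 0 <= C -> continuous l ->
  (forall v, `|v| < r -> `|g (x + v) - g x - l v| <= C * `|v| ^+ 2) ->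
  differentiable g x /\ forall v, 'D_v g x = l v.
Proof.
move=> r0 C0 cl H.
have E : g \o shift x = cst (g x) + l +o_ 0 id.
  apply/eqaddoP => e e0; have C1 : 0 < C + 1 by rewrite ltr_wpDl.
  have e2 : 0 < e / (C + 1) by apply: divr_gt0.
  apply/nbhs_normP; exists (Num.min r (e / (C + 1))); first by rewrite /= lt_min r0.
  move=> v /=; rewrite sub0r normrN lt_min => /andP[vr ve].
  rewrite -[X in `|X| <= _]/(g (v + x) - (g x + l v)) opprD addrA [v + x]addrC.
  apply: le_trans (H v vr) _; rewrite expr2 mulrA ler_wpM2r//.
  apply: (@le_trans _ _ ((C + 1) * `|v|)).
    by rewrite ler_wpM2r// lerDl.
  by rewrite mulrC -ler_pdivlMr// ltW.
have dg : 'd g x = l :> (V -> W) by apply: diff_unique.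
have df : differentiable g x by apply/diff_locallyP; rewrite dg.
by split=> // v; rewrite (deriveE _ df) dg.
Qed.

Lemma gronwall_solutions n (f : 'rV[R]_n -> 'rV[R]_n) (x0 : 'rV[R]_n) r L eps
    (z w : R -> 'rV[R]_n) : 0 <= L -> eps * L <= 2^-1 ->
  (forall x y, `|x - x0| < r -> `|y - x0| < r -> `|f y - f x| <= L * `|y - x|) ->
  (forall t, `|t| < eps -> is_derive t 1 z (f (z t)) /\ `|z t - x0| < r) ->
  (forall t, `|t| < eps -> is_derive t 1 w (f (w t)) /\ `|w t - x0| < r) ->
  forall t, `|t| < eps -> `|w t - z t| <= 2 * `|w 0 - z 0|.
Proof.
move=> L0 eL fL Hz Hw t te.
have := @gronwall_short _ _ (w - z) (fun t => f (w t) - f (z t))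
  `|w 0 - z 0| L 0 eps L0 (lexx 0) eL; rewrite mul0r addr0; apply => //.
- by move=> s /[dup]/Hz[? _] /Hw[? _]; apply: is_deriveB.
- by move=> s /[dup]/Hz[_ ?] /Hw[_ ?]; rewrite addr0; apply: fL.
Qed.

(** Regularity is asked in the initial point at each fixed time, not jointly in time and point. For
    k = 0 the flow is merely continuous in x, hence the guard 0 < k on the variational equation
    [fb_variation]. *)
Record flow_box n k (f : 'rV[R]_n -> 'rV[R]_n) (U : set 'rV[R]_n)
    (x0 : 'rV[R]_n) eps r (Phi : R -> 'rV[R]_n -> 'rV[R]_n) : Prop := FlowBox {
  fb_eps : 0 < eps;
  fb_rad : 0 < r;
  fb_init : forall x : 'rV[R]_n, `|x - x0| < r -> Phi 0 x = x;
  fb_derive : forall (x : 'rV[R]_n) t, `|x - x0| < r -> `|t| < eps ->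
    is_derive t 1 (Phi^~ x) (f (Phi t x));
  fb_in : forall (x : 'rV[R]_n) t, `|x - x0| < r -> `|t| < eps -> U (Phi t x);
  fb_Ck : forall t, `|t| < eps -> Ck k [set x | `|x - x0| < r] (Phi t);
  fb_variation : (0 < k)%N -> forall (x v : 'rV[R]_n) t,
    `|x - x0| < r -> `|t| < eps ->
    is_derive t 1 (fun s => 'D_v (Phi s) x) ('D_('D_v (Phi t) x) f (Phi t x)) }.

Lemma flow_box0 n (f : 'rV[R]_n -> 'rV[R]_n) (U : set 'rV[R]_n) x0 :
  open U -> U x0 -> smooth U f ->
  exists eps r Phi, flow_box 0 f U x0 eps r Phi.
Proof.
move=> oU Ux0 fC.
have [r [Mb [L [K [r0 M0 [L0 K0] rU sb]]]]] := smooth_local_bounds oU Ux0 fC.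
have M1 : 0 < Mb + 1 by rewrite ltr_wpDl.
have L1 : 0 < L + 1 by rewrite ltr_wpDl.
(* The first bound keeps solutions issued from the half ball inside the ball, the second is the
   contraction condition; adding 1 avoids a division by zero. *)
pose eps := Num.min (r / 2 / (Mb + 1)) (2^-1 / (L + 1)).
have e0 : 0 < eps by rewrite lt_min !divr_gt0.
have eM : Mb * eps < r / 2.
  have : eps * (Mb + 1) <= r / 2 by rewrite -ler_pdivlMr// ge_min lexx.
  by move: e0; nra.
have eL : eps * L <= 2^-1.
  have : eps * (L + 1) <= 2^-1 by rewrite -ler_pdivlMr// ge_min lexx orbT.
  by move: e0; nra.
have rr : r / 2 < r by rewrite ltr_pdivrMr// ltr_pMr// ltr1n.
have /choice[phi phiP] x : exists phi : R -> 'rV[R]_n, `|x - x0| < r / 2 ->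
    phi 0 = x /\ forall t, `|t| < eps ->
      is_derive t 1 phi (f (phi t)) /\ `|phi t - x0| < r.
  have [xr|] := pselect (`|x - x0| < r / 2); last by exists (fun=> 0).
  have [|phi p0 dp] := @picard _ _ f x0 x r Mb L eps e0 M0 L0 (sb_norm sb)
    (fun y z yr zr => sb_lip sb zr yr) _ eL.
    by rewrite (splitr r) ltrD.
  by exists phi.
exists eps, (r / 2), (fun t x => phi x t); split=> //.
- by rewrite divr_gt0.
- by move=> x /phiP[].
- by move=> x t /phiP[_ H] /H[].
- by move=> x t /phiP[_ H] /H[_ /rU].
- move=> t te x /= xr.
  have [d d0 dx] : exists2 d, 0 < d & forall y, `|y - x| < d -> `|y - x0| < r / 2.
    have /nbhs_normP[d /= d0 H] := near_norm_ball xr.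
    by exists d => // y yd; apply: H; rewrite /= distrC.
  apply: (lipschitz_continuous (L := 2) d0) => y /dx yr.
  have [p0 pP] := phiP _ xr; have [q0 qP] := phiP _ yr.
  rewrite -{2}q0 -{2}p0.
  exact: (gronwall_solutions L0 eL (sb_lip sb) pP qP).
Qed.

(** The field induced by f on the tangent bundle: its flow is (x, v) |-> (Phi t x, D_v (Phi t)
    x). *)
Definition tangent_system n (f : 'rV[R]_n -> 'rV[R]_n) (z : 'rV[R]_(n + n)) :=
  row_mx (f (lsubmx z)) ('D_(rsubmx z) f (lsubmx z)).

Lemma smooth_tangent_system n (f : 'rV[R]_n -> 'rV[R]_n) (U : set 'rV[R]_n) :
  open U -> smooth U f ->
  open [set z : 'rV[R]_(n + n) | U (lsubmx z)] /\
  smooth [set z : 'rV[R]_(n + n) | U (lsubmx z)] (tangent_system f).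
Proof.
move=> oU fC; set U1 := [set z | _].
have oU1 : open U1.
  by apply: open_comp => // z _; exact: continuous_lsubmx.
split=> // k; have lC : Ck k U1 (lsubmx : 'rV[R]_(n + n) -> 'rV[R]_n).
  by apply: Ck_lsubmx => //; exact: Ck_id.
apply: Ck_row_mx => //; first by apply: Ck_comp lC (fC k).
have : Ck k U1 (fun z => \sum_i (rsubmx z) 0 i *:
    ('D_(delta_mx 0 i) f \o lsubmx) z).
  apply: Ck_sum => // i _; apply: Ck_scale => //.
    by apply: Ck_entry => //; apply: Ck_rsubmx => //; exact: Ck_id.
  by apply: Ck_comp lC (smooth_derive _ fC k).
apply: Ck_eq => // z Uz.
by rewrite [RHS]derive_rowE//; exact: smooth_differentiable fC Uz.
Qed.

(** A C^k flow box of the tangent system contains, in its second block, a candidate for the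
    derivative of the flow of f. Gronwall identifies it with the derivative, which is therefore
    C^k. *)
Lemma flow_boxS k n (f : 'rV[R]_n -> 'rV[R]_n) (U : set 'rV[R]_n) x0 :
  (forall m (F : 'rV[R]_m -> 'rV[R]_m) (A : set 'rV[R]_m) y0,
    open A -> A y0 -> smooth A F ->
    exists eps r Phi, flow_box k F A y0 eps r Phi) ->
  open U -> U x0 -> smooth U f ->
  exists eps r Phi, flow_box k.+1 f U x0 eps r Phi.
Proof.
move=> IH oU Ux0 fC.
have [r [Mb [L [K [r0 M0 [L0 K0] rU sb]]]]] := smooth_local_bounds oU Ux0 fC.
pose Br := [set x : 'rV[R]_n | `|x - x0| < r].
have oBr : open Br by exact: open_norm_ball.
have fBr : smooth Br f by move=> l; apply: Ck_sub (fC l); exact: rU.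
have [oU1 FC] := smooth_tangent_system oBr fBr.
have U1z0 : Br (lsubmx (row_mx x0 (0 : 'rV[R]_n))).
  by rewrite row_mxKl /Br/= subrr normr0.
have [eps1 [r1 [Psi fb]]] := IH _ _ _ _ oU1 U1z0 FC.
have e10 := fb_eps fb; have r10 := fb_rad fb.
have L1 : 0 < L + 1 by rewrite ltr_wpDl.
pose eps := Num.min eps1 (2^-1 / (L + 1)).
have e0 : 0 < eps by rewrite lt_min e10 !divr_gt0.
have ee1 t : `|t| < eps -> `|t| < eps1 by rewrite lt_min => /andP[].
have eL : eps * L <= 2^-1.
  have : eps * (L + 1) <= 2^-1 by rewrite -ler_pdivlMr// ge_min lexx orbT.
  by move: e0; nra.
(* The box of the tangent system is controlled only for velocities of norm below r1. The derivative
   along a basis vector is obtained by launching lam times that vector and dividing the result by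
   lam. *)
pose lam := r1 / 2.
have lam0 : 0 < lam by rewrite divr_gt0.
have lamr : lam < r1 by rewrite ltr_pdivrMr// ltr_pMr// ltr1n.
have inz (x v : 'rV[R]_n) : `|x - x0| < r1 -> `|v| < r1 ->
    `|row_mx x v - row_mx x0 0| < r1.
  by move=> xr vr; rewrite opp_row_mx add_row_mx oppr0 addr0 row_mx_norm_lt.
pose Phi t x := lsubmx (Psi t (row_mx x 0)) : 'rV[R]_n.
have Psi_l (x v : 'rV[R]_n) t : `|x - x0| < r1 -> `|v| < r1 -> `|t| < eps1 ->
    is_derive t 1 (fun s => lsubmx (Psi s (row_mx x v)))
      (f (lsubmx (Psi t (row_mx x v)))) /\
    `|lsubmx (Psi t (row_mx x v)) - x0| < r.
  move=> xr vr te; have zr := inz _ _ xr vr; split; last exact: fb_in fb _ _ zr te.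
  have := is_derive_lsubmx (fb_derive fb zr te).
  by rewrite /tangent_system row_mxKl.
have Phi_sol x t : `|x - x0| < r1 -> `|t| < eps1 ->
    is_derive t 1 (Phi^~ x) (f (Phi t x)) /\ `|Phi t x - x0| < r.
  by move=> xr te; apply: Psi_l => //; rewrite normr0.
have Phi0 x : `|x - x0| < r1 -> Phi 0 x = x.
  by move=> xr; rewrite /Phi (fb_init fb) ?row_mxKl// inz// normr0.
(* The first block does not depend on the initial velocity, by uniqueness of solutions of the
   equation for f. *)
have Psi_lE (x v : 'rV[R]_n) t : `|x - x0| < r1 -> `|v| < r1 -> `|t| < eps ->
    lsubmx (Psi t (row_mx x v)) = Phi t x.
  move=> xr vr te; apply/eqP; rewrite -subr_eq0 -normr_le0.
  have := gronwall_solutions L0 eL (sb_lip sb)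
    (fun t te => Phi_sol x t xr (ee1 t te))
    (fun t te => Psi_l x v t xr vr (ee1 t te)) te.
  by rewrite Phi0// (fb_init fb) ?inz// row_mxKl subrr normr0 mulr0.
have Phi_lip x y t : `|x - x0| < r1 -> `|y - x0| < r1 -> `|t| < eps ->
    `|Phi t y - Phi t x| <= 2 * `|y - x|.
  move=> xr yr te.
  have := gronwall_solutions L0 eL (sb_lip sb)
    (fun t te => Phi_sol x t xr (ee1 t te))
    (fun t te => Phi_sol y t yr (ee1 t te)) te.
  by rewrite (Phi0 x)// (Phi0 y).
have norm_e (i : 'I_n) : `|lam *: delta_mx 0 i : 'rV[R]_n| < r1.
  apply: le_lt_trans lamr; apply: rV_norm_le => [|j]; first exact: ltW.
  rewrite !mxE eqxx/= normrM (gtr0_norm lam0).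
  by case: (j == i); rewrite ?normr1 ?mulr1// normr0 mulr0 ltW.
pose Ai t x i := lam^-1 *: rsubmx (Psi t (row_mx x (lam *: delta_mx 0 i))) : 'rV[R]_n.
pose Am t x := \matrix_i Ai t x i.
have AmE t x (v : 'rV[R]_n) : v *m Am t x = \sum_i v 0 i *: Ai t x i.
  by rewrite mulmx_sum_row; apply: eq_bigr => i _; rewrite rowK.
have Ai_der x i t : `|x - x0| < r1 -> `|t| < eps ->
    is_derive t 1 (fun s => Ai s x i) ('D_(Ai t x i) f (Phi t x)).
  move=> xr te; have zr := inz _ _ xr (norm_e i).
  have := is_derive_rsubmx (fb_derive fb zr (ee1 _ te)).
  rewrite /tangent_system row_mxKr (Psi_lE x _ t xr (norm_e i) te) => D.
  have [_ xir] := Phi_sol x t xr (ee1 _ te).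
  rewrite (derive_dirZ _ _ (sb_diff sb xir)).
  exact: is_deriveZ.
have A_der x (v : 'rV[R]_n) t : `|x - x0| < r1 -> `|t| < eps ->
    is_derive t 1 (fun s => v *m Am s x) ('D_(v *m Am t x) f (Phi t x)).
  move=> xr te; have [_ xir] := Phi_sol x t xr (ee1 _ te).
  under eq_fun do rewrite AmE.
  rewrite AmE (derive_dir_sum _ _ (sb_diff sb xir)).
  rewrite (_ : (fun s => _) = \sum_i (fun s => v 0 i *: Ai s x i)).
    by apply: is_derive_sum => i; apply: is_deriveZ; apply: Ai_der.
  by apply/funext => s; rewrite fct_sumE.
have A0 x (v : 'rV[R]_n) : `|x - x0| < r1 -> v *m Am 0 x = v.
  move=> xr; rewrite AmE [RHS]row_sum_delta; apply: eq_bigr => i _.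
  rewrite /Ai (fb_init fb); last exact: inz.
  by rewrite row_mxKr (scalerA lam^-1) mulVf ?gt_eqF// scale1r.
have PhiD x t : `|x - x0| < lam -> `|t| < eps ->
    differentiable (Phi t) x /\ forall v, 'D_v (Phi t) x = v *m Am t x.
  move=> xr te; have xr1 := lt_trans xr lamr.
  (* The error e(s) = Phi s (x + v) - Phi s x - v A_s vanishes at s = 0 and satisfies |e'| <= L |e|
     + K (2 |v|)^2, the factor 2 being the Lipschitz constant of the flow. Gronwall turns this into
     the stated constant. *)
  apply: (@quadratic_error_diff _ _ (Phi t) (mulmxr (Am t x)) x lam
    (2 * (K * 4 * eps)) lam0).
  - by rewrite mulr_ge0// mulr_ge0 ?mulr_ge0// ltW.
  - exact: mulmxr_continuous.
  move=> v vr.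
  have xvr : `|x + v - x0| < r1.
    by rewrite addrAC (le_lt_trans (ler_normD _ _))// (splitr r1) ltrD.
  rewrite (_ : 2 * _ * _ = 2 * (0 + (K * (2 * `|v|) ^+ 2) * eps)); last first.
    by rewrite exprMn; ring.
  pose e s := Phi s (x + v) - Phi s x - v *m Am s x.
  apply: (@gronwall_short _ _ e (fun s => f (Phi s (x + v)) - f (Phi s x) -
    'D_(v *m Am s x) f (Phi s x)) 0 L _ eps L0) => //.
  - by rewrite mulr_ge0// sqr_ge0.
  - move=> s se; have [d1 _] := Phi_sol _ s xvr (ee1 _ se).
    have [d2 _] := Phi_sol _ s xr1 (ee1 _ se).
    by apply: is_deriveB (A_der x v s xr1 se); apply: is_deriveB.
  - move=> s se; have [_ b1] := Phi_sol _ s xvr (ee1 _ se).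
    have [_ b2] := Phi_sol _ s xr1 (ee1 _ se).
    have -> : f (Phi s (x + v)) - f (Phi s x) - 'D_(v *m Am s x) f (Phi s x) =
      'D_(e s) f (Phi s x) + (f (Phi s (x + v)) - f (Phi s x) -
        'D_(Phi s (x + v) - Phi s x) f (Phi s x)).
      have -> : 'D_(Phi s (x + v) - Phi s x) f (Phi s x) =
          'D_(e s) f (Phi s x) + 'D_(v *m Am s x) f (Phi s x).
        by rewrite -(derive_dirD _ _ (sb_diff sb b2)) /e subrK.
      by rewrite [in RHS]opprD addrCA addNKr.
    rewrite (le_trans (ler_normD _ _))// lerD//; first exact: sb_dnorm sb _ _ b2.
    apply: le_trans (sb_taylor sb b2 b1) _; rewrite ler_wpM2l//.
    rewrite ler_pXn2r ?nnegrE ?mulr_ge0//.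
    by have := Phi_lip _ _ s xr1 xvr se; rewrite [x + v]addrC addrK.
  - by rewrite /e !Phi0// A0// [x + v]addrC addrK subrr normr0.
exists eps, lam, Phi; split=> //.
- by move=> x xr; apply/Phi0/(lt_trans xr).
- by move=> x t xr /ee1 te; have [] := Phi_sol x t (lt_trans xr lamr) te.
- by move=> x t xr /ee1 te; have [_ /rU] := Phi_sol x t (lt_trans xr lamr) te.
- move=> t te; have oB : open [set x : 'rV[R]_n | `|x - x0| < lam].
    exact: open_norm_ball.
  split=> [x xr|v]; first by have [] := PhiD x t xr te.
  have : Ck k [set x : 'rV[R]_n | `|x - x0| < lam]
      (fun x => \sum_i v 0 i *: (lam^-1 *: rsubmx
        ((Psi t \o (fun x => row_mx x (lam *: delta_mx 0 i))) x)) : 'rV[R]_n).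
    apply: Ck_sum => // i _; apply: Ck_scale => //; first exact: Ck_cst.
    apply: Ck_scale => //; first exact: Ck_cst.
    apply: Ck_rsubmx => //.
    apply: (Ck_comp (A := [set z | `|z - row_mx x0 0| < r1])) => //.
    - exact: open_norm_ball.
    - by move=> x xr /=; apply: inz => //; exact: lt_trans lamr.
    - by apply: Ck_row_mx => //; [exact: Ck_id|exact: Ck_cst].
    - exact: fb_Ck fb _ (ee1 _ te).
  apply: Ck_eq => // x xr; have [_ ->] := PhiD x t xr te.
  by rewrite AmE.
- move=> _ x v t xr te; have [_ ->] := PhiD x t xr te.
  have := A_der x v t (lt_trans xr lamr) te.
  apply: near_eq_is_derive.
  have : `|t - 0| < eps by rewrite subr0.
  move=> /near_norm_ball; apply: filterS => s; rewrite subr0 => se.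
  by have [_ ->] := PhiD x s xr se.
Qed.

Lemma flow_box_exists k n (f : 'rV[R]_n -> 'rV[R]_n) (U : set 'rV[R]_n) x0 :
  open U -> U x0 -> smooth U f ->
  exists eps r Phi, flow_box k f U x0 eps r Phi.
Proof.
elim: k n f U x0 => [|k IH] n f U x0; first exact: flow_box0.
by apply: flow_boxS => m F A y0; apply: IH.
Qed.

End smooth_dependence.

(** * Flows on manifolds *)

Section real_induction.
Context {R : realType}.
Implicit Types (a b t s e : R).

(** Connectedness of [a, b] in the form used by the continuation arguments below: P propagates a
    little to the right of each point and passes to left limits, so the supremum of the u such that
    P holds on [a, u] can only be b. *)
Lemma real_induction (P : R -> Prop) a b :
  P a ->
  (forall t, a <= t < b -> P t ->
    exists2 e, 0 < e & forall s, t < s < t + e -> s <= b -> P s) ->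
  (forall t, a < t <= b -> (forall s, a <= s < t -> P s) -> P t) ->
  forall t, a <= t <= b -> P t.
Proof.
move=> Pa Pr Pl t /andP[at_ tb].
pose E := [set u | a <= u <= b /\ forall s, a <= s <= u -> P s].
have Ea : E a.
  split; first by rewrite lexx (le_trans at_).
  by move=> s /andP[as_ sa]; rewrite (le_anti (introT andP (conj sa as_))).
have ubE : has_ubound E by exists b => u [/andP[]].
have supE : has_sup E by split => //; exists a.
set T := sup E.
have aT : a <= T by apply: ub_le_sup.
have Tb : T <= b by apply: ge_sup; [exists a|move=> u [/andP[]]].
have PT s : a <= s < T -> P s.
  move=> /andP[as_ sT]; have d0 : 0 < T - s by rewrite subr_gt0.
  have [u [_ Hu] us] := sup_adherent d0 supE.
  by apply: Hu; rewrite as_/= ltW//; move: us; rewrite subKr.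
have PTT : P T.
  have [aT'|] := ltP a T; first by apply: Pl => //; rewrite aT'.
  by move=> Ta; rewrite (le_anti (introT andP (conj Ta aT))).
have [Tlt|bT] := ltP T b; last first.
  have [tT|Tt] := ltP t T; first by apply: PT; rewrite at_.
  by rewrite (le_anti (introT andP (conj (le_trans tb bT) Tt))).
have [e e0 He] := Pr T (introT andP (conj aT Tlt)) PTT.
pose u := Num.min b (T + e / 2).
have Tu : T < u by rewrite lt_min Tlt ltrDl divr_gt0.
have : E u.
  split; first by rewrite (le_trans aT (ltW Tu)) ge_min lexx.
  move=> s /andP[as_ su]; have [sT|] := ltP s T; first by apply: PT; rewrite as_.
  rewrite le_eqVlt => /orP[/eqP <-//|Ts]; apply: He.
    rewrite Ts (le_lt_trans su)// gt_min ltrD2l.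
    by rewrite [X in _ || X](_ : _ = true) ?orbT// ltr_pdivrMr// ltr_pMr// ltr1n.
  by rewrite (le_trans su)// ge_min lexx.
by move=> /(ub_le_sup ubE); rewrite leNgt Tu.
Qed.

End real_induction.

(** * Charts and their transition maps *)

Section chart_theory.
Context {R : realType} {n : nat}.

Lemma chart_img (M : topologicalType) (c : chart R n M) x :
  (c @` cdom c) x -> cdom c (cinv c x) /\ c (cinv c x) = x.
Proof. by move=> [p cp <-]; rewrite cfunK. Qed.

Lemma near_chart (M : topologicalType) (c : chart R n M) p (P : M -> Prop) :
  cdom c p -> (\forall q \near p, P q) ->
  \forall x \near c p, (c @` cdom c) x /\ P (cinv c x).
Proof.
move=> cp nP; have ic : (c @` cdom c) (c p) by exists p.
have h1 : \forall x \near c p, (c @` cdom c) x := near_open (cimg_open (c := c)) ic.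
have h2 : \forall x \near c p, P (cinv c x).
  by apply: (cinv_cts ic); rewrite cfunK.
exact: filterI h1 h2.
Qed.

Lemma chart_img_open (M : topologicalType) (c : chart R n M) (A : set M) :
  open A -> open (c @` (cdom c `&` A)).
Proof.
move=> oA; rewrite openE => _ [p [cp Ap] <-].
suff : \forall x \near c p, (c @` (cdom c `&` A)) x by [].
apply: filterS (near_chart cp (near_open oA Ap)) => x [/chart_img[cx cxx] Ax].
by exists (cinv c x).
Qed.

Lemma open_chart_preimage (M : topologicalType) (c : chart R n M)
    (A : set 'rV[R]_n.+1) : open A -> open (cdom c `&` c @^-1` A).
Proof.
move=> oA; rewrite openE => p [cp Ap].
suff : \forall q \near p, (cdom c `&` c @^-1` A) q by [].
have h2 : \forall q \near p, A (c q) := cfun_cts cp (near_open oA Ap).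
exact: filterI (near_open (cdom_open c) cp) h2.
Qed.

Context {M : manifold R n}.
Implicit Types c d e : chart R n M.

Lemma transition_smooth c d : atlas c -> atlas d ->
  smooth (c @` (cdom c `&` cdom d)) (d \o cinv c).
Proof. by move=> ac ad; have [] := atlas_compat ac ad. Qed.

Lemma transition_diff c d p : chart_at c p -> chart_at d p ->
  differentiable (d \o cinv c) (c p).
Proof.
move=> [ac cp] [ad dp]; apply: smooth_differentiable (transition_smooth ac ad) _.
by exists p.
Qed.

(** Chain rule through an intermediate chart. The two coordinate expressions agree only where F
    stays in the domain of d, which continuity of F at p ensures near p. *)
Lemma jacobian_chart_comp (F G : M -> M) c d e p q :
  cdom c p -> cdom d q -> F p = q -> {for p, continuous F} ->
  differentiable (d \o F \o cinv c) (c p) ->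
  differentiable (e \o G \o cinv d) (d q) ->
  differentiable (e \o (G \o F) \o cinv c) (c p) /\
  jacobian (e \o (G \o F) \o cinv c) (c p) =
  jacobian (d \o F \o cinv c) (c p) *m jacobian (e \o G \o cinv d) (d q).
Proof.
move=> cp dq Fpq cF dF dG.
have E : (d \o F \o cinv c) (c p) = d q by rewrite /= cfunK// Fpq.
have N : \forall x \near c p, ((e \o G \o cinv d) \o (d \o F \o cinv c)) x =
    (e \o (G \o F) \o cinv c) x.
  have /(near_chart cp) : \forall x \near p, cdom d (F x).
    by apply: cF; rewrite Fpq; exact: near_open (cdom_open d) dq.
  by apply: filterS => x [_ dFx] /=; rewrite cfunK.
have dG' : differentiable (e \o G \o cinv d) ((d \o F \o cinv c) (c p)) by rewrite E.
have dGF := differentiable_comp dF dG'.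
split; first exact: diff_nearE N dGF.
rewrite (near_eq_jacobian N dGF) (jacobian_comp dF dG').
exact: (congr1 (fun z => _ *m jacobian _ z) E).
Qed.

Lemma diff_mx_trans c d e p : chart_at c p -> chart_at d p -> chart_at e p ->
  diff_mx id c e p = diff_mx id c d p *m diff_mx id d e p.
Proof.
move=> cp dp ep; have [_ E] := @jacobian_chart_comp id id c d e p p cp.2 dp.2
  erefl (@cvg_id _ _) (transition_diff cp dp) (transition_diff dp ep).
exact: E.
Qed.

Lemma diff_mx_id c p : chart_at c p -> diff_mx id c c p = 1%:M.
Proof.
move=> [ac cp]; rewrite /diff_mx.
rewrite (@near_eq_jacobian _ _ _ id) ?jacobian_id//.
by apply: filterS (near_chart cp filterT) => x [/chart_img[_ +] _] => /= ->.
Qed.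

Lemma diff_mxV c d p : chart_at c p -> chart_at d p ->
  diff_mx id c d p *m diff_mx id d c p = 1%:M.
Proof. by move=> cp dp; rewrite -diff_mx_trans// diff_mx_id. Qed.

End chart_theory.

(** * Integral curves and the flow relation *)

Section integral_curves.
Context {R : realType} {n : nat} {M : manifold R n}.
Variable X : vector_field M.
Implicit Types (a b t s h : R) (p q : M) (c d : chart R n M) (gamma : R -> M).

Definition curve_at gamma t := {for t, continuous gamma} /\
  forall c, chart_at c (gamma t) -> is_derive t 1 (c \o gamma) (X c (gamma t)).

Definition curve_on a b gamma := forall t, a < t < b -> curve_at gamma t.

Lemma near_itvoo a b t : a < t < b -> \forall s \near t, a < s < b.
Proof.
move=> tab; have := @near_in_itvoo _ a b t; rewrite in_itv/= => /(_ tab).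
by apply: filterS => s; rewrite in_itv.
Qed.

Lemma curve_at_eq gamma delta t : (\forall s \near t, gamma s = delta s) ->
  curve_at gamma t -> curve_at delta t.
Proof.
move=> gd [cg Dg]; have gdt : gamma t = delta t := nbhs_singleton gd.
split.
  rewrite /prop_for /continuous_at -gdt; apply: cvg_trans cg.
  exact: near_eq_cvg.
rewrite -gdt => c /Dg; apply: near_eq_is_derive.
by apply: filterS gd => s /= ->.
Qed.

(** One chart suffices, since velocities and components of X transform by the same Jacobian. *)
Lemma curve_at_chart gamma t c : {for t, continuous gamma} ->
  chart_at c (gamma t) -> is_derive t 1 (c \o gamma) (X c (gamma t)) ->
  curve_at gamma t.
Proof.
move=> cg cp Dc; split=> // d dp.
have D := is_derive_comp Dc (transition_diff cp dp).
have E : 'D_(X c (gamma t)) (d \o cinv c) (c (gamma t)) = X d (gamma t).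
  by rewrite deriveEjacobian; [rewrite (vcomp_change X cp dp)|exact: transition_diff].
rewrite /= E in D; apply: near_eq_is_derive D.
have : \forall s \near t, cdom c (gamma s).
  by apply: cg; apply: near_open (cdom_open c) cp.2.
by apply: filterS => s /= cs; rewrite cfunK.
Qed.

Lemma curve_on_shift a b gamma s : curve_on a b gamma ->
  curve_on (a - s) (b - s) (fun t => gamma (t + s)).
Proof.
move=> H t; rewrite ltrBlDr ltrBrDr => /H[cg Dg]; split.
  apply: (@continuous_comp _ _ _ (fun t => t + s) gamma) => //.
  by apply: cvgD; [exact: cvg_id|exact: cvg_cst].
by move=> c /Dg; exact: is_derive_translate.
Qed.

Lemma curve_on_chart c a b (phi : R -> 'rV[R]_n.+1) : atlas c ->
  (forall t, a < t < b -> (c @` cdom c) (phi t) /\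
    is_derive t 1 phi (X c (cinv c (phi t)))) ->
  curve_on a b (cinv c \o phi).
Proof.
move=> ac H t tab; have [ct Dt] := H t tab.
have [cp cE] := chart_img ct.
apply: (@curve_at_chart _ _ c) => //.
  by apply: continuous_comp; [exact: is_derive_continuous Dt|exact: cinv_cts].
apply: near_eq_is_derive Dt; apply: filterS (near_itvoo tab) => s sab.
by have [/chart_img[_ +] _] := H s sab => /= ->.
Qed.

Lemma field_smooth c (A : set M) : atlas c ->
  smooth (c @` (cdom c `&` A)) (X c \o cinv c).
Proof.
by move=> ac k; apply: Ck_sub (vcomp_smooth X ac k) => _ [p [cp _] <-]; exists p.
Qed.

(** The box is built in the image of [cdom c] intersected with A, so that trajectories remain in A
    as well; this confinement later yields continuity jointly in time and point. *)
Lemma local_flow k c p (A : set M) : chart_at c p -> open A -> A p ->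
  exists eps r Phi, flow_box k (X c \o cinv c) (c @` (cdom c `&` A)) (c p) eps r Phi
  /\ forall q, cdom c q -> `|c q - c p| < r ->
    [/\ curve_on (- eps) eps (fun t => cinv c (Phi t (c q))),
        cinv c (Phi 0 (c q)) = q &
        forall t, `|t| < eps -> (cdom c `&` A) (cinv c (Phi t (c q)))].
Proof.
move=> [ac cp] oA Ap.
have cAp : (c @` (cdom c `&` A)) (c p) by exists p.
have [eps [r [Phi fb]]] :=
  flow_box_exists k (chart_img_open oA) cAp (field_smooth A ac).
exists eps, r, Phi; split=> // q cq qr; split.
- apply: (@curve_on_chart c) => // t teps.
  have te : `|t| < eps by rewrite ltr_norml.
  have [x [cx _] xE] := fb_in fb qr te.
  have D := fb_derive fb qr te.
  by split; [exists x|exact: D].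
- by rewrite (fb_init fb qr) cfunK.
- move=> t te; have [x [cx Ax] <-] := fb_in fb qr te.
  by rewrite cfunK.
Qed.

Lemma curve_unique_local gamma delta a b t : a < t < b ->
  curve_on a b gamma -> curve_on a b delta -> gamma t = delta t ->
  \forall s \near t, gamma s = delta s.
Proof.
move=> tab cg cd gd; have [c ac cp] := atlas_cover (gamma t).
have oc := cdom_open c.
have cpi : (c @` (cdom c `&` cdom c)) (c (gamma t)) by exists (gamma t).
have [r [Mb [L [K [r0 _ [L0 _] _ sb]]]]] :=
  smooth_local_bounds (chart_img_open oc) cpi (field_smooth (cdom c) ac).
have near_in zeta : curve_on a b zeta -> zeta t = gamma t ->
    \forall s \near t, [/\ a < s < b, cdom c (zeta s) & `|c (zeta s) - c (gamma t)| < r].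
  move=> /(_ t tab)[cz _] zt.
  have czt : cdom c (zeta t) by rewrite zt.
  have b0 : `|c (zeta t) - c (gamma t)| < r by rewrite zt subrr normr0.
  have h1 : \forall s \near t, cdom c (zeta s) := cz _ (near_open oc czt).
  have h2 : \forall s \near t, `|c (zeta s) - c (gamma t)| < r.
    exact: (continuous_comp cz (cfun_cts czt) (near_norm_ball b0)).
  by apply: filterS3 (near_itvoo tab) h1 h2 => s.
have nn : \forall s \near t,
    [/\ a < s < b, cdom c (gamma s) & `|c (gamma s) - c (gamma t)| < r] /\
    [/\ a < s < b, cdom c (delta s) & `|c (delta s) - c (gamma t)| < r].
  exact: filterI (near_in _ cg erefl) (near_in _ cd (esym gd)).
have /nbhs_normP[e /= e0 He] := nn.
have L1 : 0 < L + 1 by rewrite ltr_wpDl.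
pose eps := Num.min e (2^-1 / (L + 1)).
have eps0 : 0 < eps by rewrite lt_min e0 !divr_gt0.
have eL : eps * L <= 2^-1.
  have : eps * (L + 1) <= 2^-1 by rewrite -ler_pdivlMr// ge_min lexx orbT.
  by move: eps0; nra.
have sol zeta : curve_on a b zeta ->
    (forall s, `|s| < eps -> cdom c (zeta (s + t)) /\
      `|c (zeta (s + t)) - c (gamma t)| < r /\ a < s + t < b) ->
    forall s, `|s| < eps -> is_derive s 1 (fun s => c (zeta (s + t)))
      ((X c \o cinv c) (c (zeta (s + t)))) /\ `|c (zeta (s + t)) - c (gamma t)| < r.
  move=> cz Hz s /Hz[cs [rs sab]]; split=> //; rewrite /= cfunK//.
  have [_ /(_ c (conj ac cs))] := cz _ sab.
  exact: (@is_derive_translate _ _ (c \o zeta)).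
have Hs s : `|s| < eps -> `|t - (s + t)| < e.
  by rewrite opprD addrCA subrr addr0 normrN lt_min => /andP[].
have := gronwall_solutions L0 eL (sb_lip sb)
  (sol _ cg (fun s se => let: conj (And3 u v w) _ := He _ (Hs s se) in conj v (conj w u)))
  (sol _ cd (fun s se => let: conj _ (And3 u v w) := He _ (Hs s se) in conj v (conj w u))).
rewrite /= add0r gd subrr normr0 mulr0 => G.
apply/nbhs_normP; exists eps => // s /=; rewrite distrC => se.
have := G _ se; rewrite subrK normr_le0 subr_eq0 => /eqP E.
have [[_ c1 _] [_ c2 _]] := He _ (Hs _ se).
by rewrite subrK in c1 c2; rewrite -(cfunK c1) -E cfunK.
Qed.

(** Agreement propagates by local uniqueness and passes to limits because M is Hausdorff. *)
Lemma curve_unique gamma delta a b t0 : a < t0 < b ->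
  curve_on a b gamma -> curve_on a b delta -> gamma t0 = delta t0 ->
  forall t, a < t < b -> gamma t = delta t.
Proof.
move=> t0ab cg cd g0 t tab.
have cl u : a < u < b ->
    (forall e : R, 0 < e -> exists2 s, `|u - s| < e & gamma s = delta s) ->
    gamma u = delta u.
  move=> uab H; apply: (@manifold_hausdorff _ _ M) => A B nA nB.
  have [gu _] := cg _ uab; have [du _] := cd _ uab.
  have nAB : \forall s \near u, A (gamma s) /\ B (delta s).
    by apply: filterI; [exact: gu|exact: du].
  have /nbhs_normP[e /= e0 He] := nAB.
  have [s us E] := H e e0; have [As Bs] := He s us.
  by exists (gamma s); split=> //; rewrite E.
(* v, of absolute value 1, is the direction of travel: both sides of t0 are covered by one induction
   on the elapsed time. *)
have side (v : R) (l : R) : `|v| = 1 -> 0 <= l -> a < t0 + v * l < b ->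
    gamma (t0 + v * l) = delta (t0 + v * l).
  move=> v1 l0 tl.
  have inab u : 0 <= u <= l -> a < t0 + v * u < b.
    move=> /andP[u0 ul]; have [/andP[at0 t0b] /andP[atl tlb]] := conj t0ab tl.
    have [v0|v0] := leP 0 v.
      apply/andP; split.
        by apply: lt_le_trans at0 _; rewrite lerDl mulr_ge0.
      by apply: le_lt_trans tlb; rewrite lerD2l ler_wpM2l.
    apply/andP; split.
      by apply: (@lt_le_trans _ _ (t0 + v * l)); rewrite ?lerD2l ?ler_wnM2l// ltW.
    by apply: (@le_lt_trans _ _ t0); rewrite ?gerDl ?nmulr_rle0.
  apply: (@real_induction _ (fun u => gamma (t0 + v * u) = delta (t0 + v * u)) 0 l).
  - by rewrite mulr0 addr0.
  - move=> u /andP[u0 ul] E.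
    have := curve_unique_local (inab u (introT andP (conj u0 (ltW ul)))) cg cd E.
    move=> /nbhs_normP[e /= e0 He]; exists e => // s /andP[us se] _.
    apply: He => /=; rewrite opprD addrACA subrr add0r -mulrBr normrM v1 mul1r.
    by rewrite distrC ger0_norm ?subr_ge0 1?ltW// ltrBlDl.
  - move=> u /andP[u0 ul] H; apply: cl; first by apply: inab; rewrite (ltW u0).
    move=> e e0; pose s := Num.max 0 (u - e / 2).
    have su : s < u by rewrite gt_max u0 gtrBl divr_gt0.
    exists (t0 + v * s); last by apply: H; rewrite le_max lexx.
    rewrite opprD addrACA subrr add0r -mulrBr normrM v1 mul1r.
    rewrite ger0_norm ?subr_ge0 1?ltW// ltrBlDl -ltrBlDr lt_max; apply/orP; right.
    by rewrite ltrD2l ltrN2 ltr_pdivrMr// ltr_pMr// ltr1n.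
  - by rewrite l0 lexx.
have [t0t|tt0] := leP t0 t.
  have := side 1 (t - t0); rewrite mul1r (addrC t0) subrK normr1 subr_ge0.
  exact.
have E : t0 + -1 * (t0 - t) = t by ring.
have := side (-1) (t0 - t); rewrite E normrN1 subr_ge0.
by apply=> //; exact: ltW.
Qed.

(** Graph of the local flow. No choice of a maximal solution enters: any integral curve on an open
    interval containing 0 and s is a witness. *)
Definition flow_rel s p q := exists a b gamma,
  [/\ a < 0 < b, a < s < b, curve_on a b gamma, gamma 0 = p & gamma s = q].

Lemma flow_rel0 p : flow_rel 0 p p.
Proof.
have [c ac cp] := atlas_cover p.
have [eps [r [Phi [fb H]]]] := local_flow 0 (conj ac cp) openT I.
have := H p cp; rewrite subrr normr0 => /(_ (fb_rad fb))[cv v0 _].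
have e0 := fb_eps fb.
by exists (- eps), eps, (fun t => cinv c (Phi t (c p))); rewrite oppr_lt0 e0.
Qed.

Lemma flow_rel_unique s p q q' : flow_rel s p q -> flow_rel s p q' -> q = q'.
Proof.
move=> [a [b [g [/andP[a0 b0] /andP[as_ sb] cg g0 <-]]]].
move=> [a' [b' [g' [/andP[a0' b0'] /andP[as' sb'] cg' g0' <-]]]].
apply: (@curve_unique _ _ (Num.max a a') (Num.min b b') 0).
- by rewrite gt_max lt_min a0 a0' b0 b0'.
- by move=> t; rewrite gt_max lt_min => /andP[/andP[ta _] /andP[tb _]];
    apply: cg; rewrite ta.
- by move=> t; rewrite gt_max lt_min => /andP[/andP[_ ta] /andP[_ tb]];
    apply: cg'; rewrite ta.
- by rewrite g0.
- by rewrite gt_max lt_min as_ as' sb sb'.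
Qed.

Lemma flow_rel_curve a b gamma s t : curve_on a b gamma -> a < s < b ->
  a < t < b -> flow_rel (t - s) (gamma s) (gamma t).
Proof.
move=> cg sab tab; exists (a - s), (b - s), (fun u => gamma (u + s)).
by rewrite subr_lt0 subr_gt0 !ltrD2r add0r subrK; split=> //;
  exact: curve_on_shift.
Qed.

Lemma flow_relV s p q : flow_rel s p q -> flow_rel (- s) q p.
Proof.
move=> [a [b [g [ab0 abs cg <- <-]]]]; rewrite -[- s]sub0r.
exact: flow_rel_curve cg abs ab0.
Qed.

Lemma flow_relD s t p q r : flow_rel s p q -> flow_rel t q r ->
  flow_rel (s + t) p r.
Proof.
move=> [a [b [g [/andP[a0 b0] /andP[as_ sb] cg g0 gs]]]].
move=> [a' [b' [g' [/andP[a0' b0'] /andP[as' sb'] cg' g0' g's]]]].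
have cg's := curve_on_shift (s := - s) cg'; rewrite !opprK in cg's.
(* Concatenation: g on its interval, the shifted g' elsewhere. They agree on the overlap by
   uniqueness, so near every parameter the result coincides with one of the two. *)
pose gl u := if a < u < b then g u else g' (u - s).
have glE u : a' + s < u < b' + s -> gl u = g' (u - s).
  move=> /andP[u1 u2]; rewrite /gl; case: ifP => // /andP[u3 u4].
  apply: (@curve_unique g (fun u => g' (u - s)) (Num.max a (a' + s))
    (Num.min b (b' + s)) s).
  - by rewrite gt_max lt_min as_ sb gtrDr a0' ltrDr.
  - by move=> t'; rewrite gt_max lt_min => /andP[/andP[ta _] /andP[tb _]];
      apply: cg; rewrite ta.
  - by move=> t'; rewrite gt_max lt_min => /andP[/andP[_ ta] /andP[_ tb]];
      apply: cg's; rewrite ta.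
  - by rewrite gs subrr g0'.
  - by rewrite gt_max lt_min u1 u2 u3 u4.
have st : a' + s < s + t < b' + s by rewrite (addrC s) !ltrD2r as'.
exists (Num.min a (a' + s)), (Num.max b (b' + s)), gl; split.
- by rewrite gt_min a0 lt_max b0.
- by move: st => /andP[? ?]; rewrite gt_min lt_max; apply/andP; split; apply/orP; right.
- move=> u uab; have [u1|u1] := boolP (a < u < b).
    apply: curve_at_eq (cg _ u1); apply: filterS (near_itvoo u1) => v vab.
    by rewrite /gl vab.
  have u2 : a' + s < u < b' + s.
    move: u1 uab; rewrite gt_min lt_max negb_and -!leNgt.
    have a's : a' + s < s by rewrite gtrDr.
    have b's : s < b' + s by rewrite ltrDr.
    move=> /orP[u1|u1] /andP[/orP[v1|v1] /orP[v2|v2]].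
    - by rewrite ltNge u1 in v1.
    - by rewrite ltNge u1 in v1.
    - by rewrite v1 (le_lt_trans u1)// (lt_trans as_).
    - by rewrite v1.
    - by rewrite ltNge u1 in v2.
    - by rewrite v2 (lt_trans a's)// (lt_le_trans sb).
    - by rewrite ltNge u1 in v2.
    - by rewrite v1.
  apply: curve_at_eq (cg's _ u2); apply: filterS (near_itvoo u2) => v vab.
  by rewrite glE.
- by rewrite /gl a0 b0.
- by rewrite glE// addrC addKr.
Qed.

(** A property of flow steps that composes and holds for short times holds for all times. The
    admissible time eps has to be uniform near p: at a left limit, the last step starts from a
    nearby point of the orbit and not from the limit itself. *)
Lemma flow_induction (Q : R -> M -> M -> Prop) :
  (forall s t p q r, Q s p q -> Q t q r -> Q (s + t) p r) ->
  (forall p, exists2 eps, 0 < eps & \forall x \near p,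
    forall h y, `|h| < eps -> flow_rel h x y -> Q h x y) ->
  forall s p q, flow_rel s p q -> Q s p q.
Proof.
move=> Qtrans Qloc s p q [a [b [g [ab0 abs cg g0 <-]]]].
have [v [l [v1 l0 sE]]] : exists v l : R, [/\ `|v| = 1, 0 <= l & s = v * l].
  have [s0|s0] := leP 0 s; first by exists 1, s; rewrite normr1 mul1r.
  by exists (-1), (- s); rewrite normrN1 mulrNN mul1r oppr_ge0 ltW.
have inab u : 0 <= u <= l -> a < v * u < b.
  move=> /andP[u0 ul]; move: ab0 abs => /andP[a0 b0]; rewrite sE => /andP[as_ sb].
  have [v0|v0] := leP 0 v.
    by rewrite (lt_le_trans a0) ?mulr_ge0//= (le_lt_trans _ sb)// ler_wpM2l.
  apply/andP; split.
    by apply: lt_le_trans as_ _; rewrite ler_wnM2l// ltW.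
  by apply: le_lt_trans b0; rewrite nmulr_rle0.
have vd u w : `|v * u - v * w| = `|u - w| by rewrite -mulrBr normrM v1 mul1r.
rewrite sE.
apply: (@real_induction _ (fun u => Q (v * u) p (g (v * u))) 0 l).
- rewrite mulr0 g0; have [eps e0 /nbhs_singleton H] := Qloc p.
  by apply: H; [rewrite normr0|exact: flow_rel0].
- move=> u /andP[u0 ul] Qu; have [eps e0 /nbhs_singleton H] := Qloc (g (v * u)).
  exists eps => // w /andP[uw we] wl.
  have -> : v * w = v * u + (v * w - v * u) by rewrite addrC subrK.
  apply: Qtrans Qu _; rewrite [v * u + _]addrC subrK; apply: H.
    by rewrite vd ger0_norm ?subr_ge0 1?ltW// ltrBlDl.
  apply: flow_rel_curve cg _ _; apply: inab; first by rewrite u0 ltW.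
  by rewrite (le_trans u0 (ltW uw)).
- move=> u /andP[u0 ul] H; have [eps e0 nH] := Qloc (g (v * u)).
  have uab : a < v * u < b by apply: inab; rewrite (ltW u0).
  have [cu _] := cg _ uab.
  have /nbhs_normP[e /= ee0 He] := cu _ nH.
  pose m := Num.min e eps.
  have m0 : 0 < m by rewrite lt_min ee0.
  pose w := Num.max 0 (u - m / 2).
  have wu : w < u by rewrite gt_max u0 gtrBl divr_gt0.
  have uw : `|u - w| < m.
    rewrite ger0_norm ?subr_ge0 1?ltW// ltrBlDl -ltrBlDr lt_max; apply/orP; right.
    by rewrite ltrD2l ltrN2 ltr_pdivrMr// ltr_pMr// ltr1n.
  have w0 : 0 <= w by rewrite le_max lexx.
  have -> : v * u = v * w + (v * u - v * w) by rewrite addrC subrK.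
  apply: Qtrans (H w _) _; first by rewrite w0.
  rewrite [v * w + _]addrC subrK; move: uw; rewrite lt_min => /andP[uwe uweps].
  have wab : a < v * w < b by apply: inab; rewrite w0 (le_trans (ltW wu)).
  have F := flow_rel_curve cg wab uab.
  by apply: (He (v * w)) F; rewrite /= vd.
- by rewrite l0 lexx.
Qed.

End integral_curves.

(** * Germs of C^k maps and matrix identities *)

Section Ck_germs.
Context {R : realType}.
Implicit Types V W : normedModType R.

Definition Ck_near k V W (f : V -> W) (x : V) :=
  \forall y \near x, Ck k [set y] f.

Lemma Ck_near_open k V W (U : set V) (f : V -> W) x :
  open U -> U x -> Ck k U f -> Ck_near k f x.
Proof.
move=> oU Ux fC; apply: filterS (near_open oU Ux) => y Uy.
by apply: Ck_sub fC => _ ->.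
Qed.

Lemma Ck_nearP k V W (f : V -> W) x :
  Ck_near k f x -> exists U : set V, [/\ open U, U x & Ck k U f].
Proof.
move=> fC; exists [set y | Ck k [set y] f]°; split.
- exact: open_interior.
- exact: fC.
- by apply: Ck_pointwise => y /interior_subset.
Qed.

Lemma Ck_near_eq k V W (f g : V -> W) x : (\near x, f x = g x) ->
  Ck_near k f x -> Ck_near k g x.
Proof.
move=> fg /Ck_nearP[U [oU Ux fC]].
pose A := U `&` [set y | f y = g y]°.
have oA : open A by apply: openI => //; exact: open_interior.
apply: (@Ck_near_open _ _ _ A) => //.
apply: Ck_eq (Ck_sub _ fC) => //; last by move=> y [].
by move=> y [_ /interior_subset].
Qed.

Lemma Ck_near_comp k V m n p (f : V -> 'rV[R]_n) (g : 'rV[R]_n -> 'M[R]_(m, p)) x :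
  Ck_near k f x -> Ck_near k g (f x) -> Ck_near k (g \o f) x.
Proof.
move=> /Ck_nearP[U [oU Ux fC]] /Ck_nearP[A [oA Afx gC]].
pose B := U `&` (f @^-1` A)°.
have oB : open B by apply: openI => //; exact: open_interior.
have fB : Ck k B f by apply: Ck_sub fC => y [].
apply: (@Ck_near_open _ _ _ B) => //.
  have h : \forall y \near x, A (f y) := Ck_continuous fC Ux (near_open oA Afx).
  by split=> //; exact: h.
by apply: Ck_comp fB gC => // y [_ /interior_subset].
Qed.

Lemma Ck_near_continuous k V W (f : V -> W) x :
  Ck_near k f x -> {for x, continuous f}.
Proof. by move=> /nbhs_singleton/Ck_continuous; apply. Qed.

Lemma smooth_near V W (U : set V) (f : V -> W) :
  (forall k x, U x -> Ck_near k f x) -> smooth U f.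
Proof.
by move=> H k; apply: Ck_pointwise => x Ux; exact: nbhs_singleton (H k x Ux).
Qed.

Lemma Ck_near_diff V W (f : V -> W) x : Ck_near 1 f x -> differentiable f x.
Proof. by move=> /nbhs_singleton/CkSP[df _]; apply: df. Qed.

Lemma is_derive_unique V (e : R -> V) (t : R) (d1 d2 : V) :
  is_derive t 1 e d1 -> is_derive t 1 e d2 -> d1 = d2.
Proof. by move=> [_ <-] [_ <-]. Qed.

Lemma is_derive_mulmx m n p (A : R -> 'M[R]_(m, n)) (B : R -> 'M[R]_(n, p))
    (t : R) (dA : 'M[R]_(m, n)) (dB : 'M[R]_(n, p)) :
  is_derive t 1 A dA -> is_derive t 1 B dB ->
  is_derive t 1 (fun s => A s *m B s) (dA *m B t + A t *m dB).
Proof.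
move=> [dA1 dA2] [dB1 dB2]; apply: is_derive_mx => i j.
have DA l : is_derive t 1 (fun s => A s i l) (dA i l).
  by apply: DeriveDef; [have /derivable_mxP := dA1; apply|rewrite -dA2 derive_mx// mxE].
have DB l : is_derive t 1 (fun s => B s l j) (dB l j).
  by apply: DeriveDef; [have /derivable_mxP := dB1; apply|rewrite -dB2 derive_mx// mxE].
rewrite (_ : (fun s => _) = \sum_l (fun s => A s i l * B s l j)); last first.
  by apply/funext => s; rewrite mxE fct_sumE.
have -> : (dA *m B t + A t *m dB) i j =
    \sum_l (A t i l *: dB l j + B t l j *: dA i l).
  rewrite !mxE -big_split; apply: eq_bigr => l _.
  by rewrite addrC [dA i l * _]mulrC.
by apply: is_derive_sum => l; exact: is_deriveM.
Qed.

Lemma is_derive_trmx m n (A : R -> 'M[R]_(m, n)) (t : R) (dA : 'M[R]_(m, n)) :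
  is_derive t 1 A dA -> is_derive t 1 (fun s => (A s)^T) dA^T.
Proof.
move=> [dA1 dA2]; apply: is_derive_mx => i j.
under eq_fun do rewrite mxE.
apply: DeriveDef; first by have /derivable_mxP := dA1; apply.
by rewrite mxE -dA2 derive_mx// mxE.
Qed.

Lemma mx_form_inj n (P Q : 'M[R]_n) :
  (forall v w : 'rV[R]_n, v *m P *m w^T = v *m Q *m w^T) -> P = Q.
Proof.
move=> H; apply/matrixP => i j.
have := congr1 (fun A : 'M[R]_1 => A 0 0) (H (delta_mx 0 i) (delta_mx 0 j)).
by rewrite /= !trmx_delta -!rowE -!colE !mxE.
Qed.

Lemma mx_congr_comp2 n (P Q G : 'M[R]_n) :
  P *m (Q *m G *m Q^T) *m P^T = P *m Q *m G *m (P *m Q)^T.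
Proof. by rewrite trmx_mul !mulmxA. Qed.

Lemma mx_congr_comp3 n (P Q S G : 'M[R]_n) :
  P *m (Q *m (S *m G *m S^T) *m Q^T) *m P^T =
  P *m Q *m S *m G *m (P *m Q *m S)^T.
Proof. by rewrite !trmx_mul !mulmxA. Qed.

Lemma mx_congr_inj n (B B' P Q : 'M[R]_n) : B' *m B = 1%:M ->
  B *m P *m B^T = B *m Q *m B^T -> P = Q.
Proof.
move=> K E; have H S : S = B' *m (B *m S *m B^T) *m B'^T.
  by rewrite !mulmxA K mul1mx -mulmxA -trmx_mul K trmx1 mulmx1.
by rewrite (H P) E -H.
Qed.

End Ck_germs.

(** * Flow maps at fixed times *)

Section flow_maps.
Context {R : realType} {n : nat} {M : manifold R n}.
Variable X : vector_field M.
Implicit Types (a b t s h : R) (p q : M) (c d e : chart R n M) (k : nat).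

(** A total function, with the default value p outside of [flow_dom s]. *)
Definition flow s p : M := xget p [set q | flow_rel X s p q].
Definition flow_dom s := [set p | exists q, flow_rel X s p q].

Lemma flowE s p q : flow_rel X s p q -> flow s p = q.
Proof.
move=> F; apply: flow_rel_unique (F).
exact: (@xgetPex _ p [set q | flow_rel X s p q] (ex_intro _ q F)).
Qed.

Lemma flow_domP s p : flow_dom s p -> flow_rel X s p (flow s p).
Proof. by move=> [q F]; rewrite (flowE F). Qed.

Lemma flow_relW s p q : flow_rel X s p q -> flow_dom s p.
Proof. by exists q. Qed.

Lemma curve_on_flow a b gamma t : curve_on X a b gamma -> a < 0 < b ->
  a < t < b -> flow_rel X t (gamma 0) (gamma t).
Proof.
by move=> cg ab0 tab; have := flow_rel_curve cg ab0 tab; rewrite subr0.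
Qed.

Lemma flow_curve p : exists a b gamma, [/\ a < 0 < b, curve_on X a b gamma,
  gamma 0 = p & forall t, a < t < b -> flow t p = gamma t].
Proof.
have [a [b [g [ab0 _ cg g0 _]]]] := flow_rel0 X p.
exists a, b, g; split=> // t tab; apply: flowE.
by rewrite -g0; exact: (curve_on_flow cg ab0 tab).
Qed.

Lemma transition_Ck k c d p : chart_at c p -> chart_at d p ->
  Ck_near k (d \o cinv c) (c p).
Proof.
move=> [ac cp] [ad dp]; apply: Ck_near_open (transition_smooth ac ad k).
  by apply: chart_img_open; exact: cdom_open.
by exists p.
Qed.

Lemma flow_regular k s p q : flow_rel X s p q ->
  [/\ flow_rel X s p q, \forall x \near p, flow_dom s x,
      {for p, continuous (flow s)} &
      forall c d, chart_at c p -> chart_at d q ->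
        Ck_near k (d \o flow s \o cinv c) (c p)].
Proof.
move: s p q; apply: flow_induction.
  move=> s t p q r [F1 D1 C1 S1] [F2 D2 C2 S2].
  have E1 := flowE F1; have E2 := flowE F2.
  have D12 : \forall x \near p, flow_dom t (flow s x) by apply: C1; rewrite E1.
  have E : \forall x \near p, flow t (flow s x) = flow (s + t) x.
    apply: filterS2 D1 D12 => x /flow_domP Fx /flow_domP Fy.
    by rewrite (flowE (flow_relD Fx Fy)).
  split.
  - exact: flow_relD F1 F2.
  - apply: filterS2 D1 D12 => x /flow_domP Fx /flow_domP Fy.
    exact: flow_relW (flow_relD Fx Fy).
  - have C : {for p, continuous (flow t \o flow s)}.
      by apply: continuous_comp => //; rewrite E1.
    rewrite /prop_for /continuous_at -(nbhs_singleton E).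
    by apply: cvg_trans C; apply: near_eq_cvg; apply: filterS E => x /= ->.
  move=> c d cp dr; have [e ae eq] := atlas_cover q.
  have eqq : chart_at e q by split.
  have Sc := S1 c e cp eqq; have Sd := S2 e d eqq dr.
  have Ec : (e \o flow s \o cinv c) (c p) = e q by rewrite /= (cfunK cp.2) E1.
  have : Ck_near k ((d \o flow t \o cinv e) \o (e \o flow s \o cinv c)) (c p).
    by apply: Ck_near_comp => //; rewrite Ec.
  apply: Ck_near_eq.
  have N : \forall x \near p, cdom e (flow s x).
    by apply: C1; rewrite E1; exact: near_open (cdom_open e) eq.
  apply: filterS (near_chart cp.2 (filterI E N)) => x [_ [Ex Nx]].
  by rewrite /= cfunK// Ex.
move=> p0; have [c0 ac0 cp0] := atlas_cover p0.
have [eps [r [Phi [fb H]]]] := local_flow X k (conj ac0 cp0) openT I.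
have e0 := fb_eps fb.
exists eps => //.
pose V := cdom c0 `&` [set x | `|c0 x - c0 p0| < r].
have oV : open V.
  exact: (@open_chart_preimage _ _ _ c0 _ (open_norm_ball (c0 p0) r)).
have Vp0 : V p0 by split=> //; rewrite /= subrr normr0 (fb_rad fb).
apply: filterS (near_open oV Vp0) => x Vx h y heps Fxy.
have heps' : - eps < h < eps by rewrite -ltr_norml.
have FV z : V z -> flow_rel X h z (cinv c0 (Phi h (c0 z))).
  move=> [cz zr]; have [cv v0 _] := H z cz zr.
  have e00 : - eps < 0 < eps by rewrite oppr_lt0 e0.
  by rewrite -{1}v0; exact: curve_on_flow cv e00 heps'.
have NV := near_open oV Vx.
have E : \forall z \near x, cinv c0 (Phi h (c0 z)) = flow h z.
  by apply: filterS NV => z /FV/flowE.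
have Cx := fb_Ck fb heps.
have oB : open [set z : 'rV[R]_n.+1 | `|z - c0 p0| < r] by exact: open_norm_ball.
have CP : Ck_near k (Phi h) (c0 x) by apply: Ck_near_open Cx => //; exact: Vx.2.
have [cp0' pE] : cdom c0 (cinv c0 (Phi h (c0 x))) /\
    c0 (cinv c0 (Phi h (c0 x))) = Phi h (c0 x).
  by have [z [cz _] zE] := fb_in fb Vx.2 heps; rewrite -zE cfunK.
have yE : y = cinv c0 (Phi h (c0 x)) := flow_rel_unique Fxy (FV _ Vx).
have img : (c0 @` cdom c0) (Phi h (c0 x)) by exists (cinv c0 (Phi h (c0 x))).
split=> //.
- by apply: filterS NV => z /FV/flow_relW.
- have C : {for x, continuous (cinv c0 \o (Phi h \o c0))}.
    apply: continuous_comp; last exact: cinv_cts img.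
    by apply: continuous_comp; [exact: cfun_cts Vx.1|exact: Ck_near_continuous CP].
  rewrite /prop_for /continuous_at -(nbhs_singleton E).
  by apply: cvg_trans C; apply: near_eq_cvg; apply: filterS E => z /= ->.
move=> c d cx dy; have c0x : chart_at c0 x by split=> //; exact: Vx.1.
have c0y : chart_at c0 y by rewrite yE.
have T1 := transition_Ck k cx c0x; have T2 := transition_Ck k c0y dy.
have : Ck_near k ((d \o cinv c0) \o (Phi h \o (c0 \o cinv c))) (c x).
  apply: Ck_near_comp; first by apply: Ck_near_comp => //; rewrite /= (cfunK cx.2).
  by move: T2; rewrite /= (cfunK cx.2) yE pE.
apply: Ck_near_eq; apply: filterS (near_chart cx.2 E) => z [_ Ez].
by rewrite /= Ez.
Qed.

Lemma flow_dom_open s : open (flow_dom s).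
Proof.
rewrite openE => p /flow_domP F; by have [_ D _ _] := flow_regular 0 F.
Qed.

Lemma flow_continuous s p : flow_dom s p -> {for p, continuous (flow s)}.
Proof. by move=> /flow_domP F; have [] := flow_regular 0 F. Qed.

Lemma flow_Ck k s p c d : flow_dom s p -> chart_at c p -> chart_at d (flow s p) ->
  Ck_near k (d \o flow s \o cinv c) (c p).
Proof. by move=> /flow_domP F cp dq; have [_ _ _] := flow_regular k F; apply. Qed.

Lemma flow_diff s p c d : flow_dom s p -> chart_at c p -> chart_at d (flow s p) ->
  differentiable (d \o flow s \o cinv c) (c p).
Proof. by move=> D cp dq; apply/Ck_near_diff/flow_Ck. Qed.

Lemma flow_comp s t p : flow_dom s p -> flow_dom t (flow s p) ->
  flow (s + t) p = flow t (flow s p).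
Proof. by move=> /flow_domP F /flow_domP G; exact: flowE (flow_relD F G). Qed.

Lemma flow_domV s p : flow_dom s p -> flow_dom (- s) (flow s p).
Proof. by move=> /flow_domP/flow_relV/flow_relW. Qed.

Lemma flowK s p : flow_dom s p -> flow (- s) (flow s p) = p.
Proof. by move=> /flow_domP/flow_relV/flowE. Qed.

(* Differentiate [flow s (flow h p) = flow h (flow s p)] at [h = 0]. *)
Lemma flow_field s p c d : flow_dom s p -> chart_at c p -> chart_at d (flow s p) ->
  X d (flow s p) = X c p *m jacobian (d \o flow s \o cinv c) (c p).
Proof.
move=> D cp dq; have [a [b [g [ab0 cg g0 gE]]]] := flow_curve p.
have [a' [b' [g' [ab0' cg' g0' gE']]]] := flow_curve (flow s p).
have dF := flow_diff D cp dq.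
have := flow_domP D => F.
have [c1 D1] := cg _ ab0; have [c2 D2] := cg' _ ab0'.
rewrite g0 in D1; rewrite g0' in D2.
have Dl := D1 c cp; have Dr := D2 d dq.
have dF' : differentiable (d \o flow s \o cinv c) ((c \o g) 0) by rewrite /= g0.
have DL := is_derive_comp Dl dF'.
rewrite /= g0 (deriveEjacobian _ dF) in DL.
have DL' : is_derive (0 : R) 1 (d \o g')
    (X c p *m jacobian (d \o flow s \o cinv c) (c p)).
  apply: near_eq_is_derive DL.
  have N : \forall h \near (0 : R), cdom c (g h).
    by apply: c1; rewrite g0; exact: near_open (cdom_open c) cp.2.
  have N2 : \forall h \near (0 : R), flow_dom s (g h).
    by apply: c1; rewrite g0; exact: near_open (@flow_dom_open s) D.
  apply: filterS2 (filterI (near_itvoo ab0) (near_itvoo ab0')) (filterI N N2).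
  move=> h [hab hab'] [ch sh] /=; rewrite cfunK// -(gE' h hab').
  have Fh := curve_on_flow cg ab0 hab; rewrite g0 in Fh.
  rewrite (flowE (_ : flow_rel X h (flow s p) (flow s (g h))))//.
  have := flow_relD (flow_relV F) (flow_relD Fh (flow_domP sh)).
  by rewrite addrCA addNr addr0.
exact: is_derive_unique Dr DL'.
Qed.

Definition flow_pull_dom s c := [set p | flow_dom s p /\ cdom c (flow s p)].

Lemma flow_pull_dom_open s c : open (flow_pull_dom s c).
Proof.
rewrite openE => p [D cp].
suff : \forall x \near p, flow_pull_dom s c x by [].
have h1 : \forall x \near p, flow_dom s x := near_open (@flow_dom_open s) D.
have h2 : \forall x \near p, cdom c (flow s x).
  exact: (flow_continuous D (near_open (cdom_open c) cp)).
exact: filterI h1 h2.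
Qed.

Lemma flow_pull_img s c : (c \o flow s) @` flow_pull_dom s c =
  c @` (cdom c `&` flow_dom (- s)).
Proof.
apply/seteqP; split=> _ [p [h1 h2] <-].
  by exists (flow s p) => //; split=> //; exact: flow_domV.
have D := flow_domV h2; rewrite opprK in D.
have K := flowK h2; rewrite opprK in K.
by exists (flow (- s) p) => /=; rewrite /flow_pull_dom/= ?K.
Qed.

Lemma flow_pull_img_open s c : open ((c \o flow s) @` flow_pull_dom s c).
Proof. by rewrite flow_pull_img; apply: chart_img_open; exact: flow_dom_open. Qed.

Lemma flow_pullK s c p : flow_pull_dom s c p ->
  (flow (- s) \o cinv c) ((c \o flow s) p) = p.
Proof. by move=> [D cp] /=; rewrite cfunK// flowK. Qed.

Lemma flow_pull_cts s c p : flow_pull_dom s c p ->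
  {for p, continuous (c \o flow s)}.
Proof.
move=> [D cp]; apply: continuous_comp; first exact: flow_continuous.
exact: cfun_cts.
Qed.

Lemma flow_pull_inv_cts s c x : ((c \o flow s) @` flow_pull_dom s c) x ->
  {for x, continuous (flow (- s) \o cinv c)}.
Proof.
rewrite flow_pull_img => -[q [cq D] <-]; apply: continuous_comp.
  by apply: cinv_cts; exists q.
by rewrite cfunK//; exact: flow_continuous.
Qed.

(** The membership of these charts in the maximal atlas is the form in which smoothness of the flow
    enters the construction of the quotient. *)
Definition flow_pull s c : chart R n M :=
  Chart (@flow_pull_dom_open s c) (@flow_pull_img_open s c) (@flow_pullK s c)
    (@flow_pull_cts s c) (@flow_pull_inv_cts s c).

Lemma flow_pull_atlas s c : atlas c -> atlas (flow_pull s c).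
Proof.
move=> ac; apply: atlas_max => d ad; split; apply: smooth_near => k.
  move=> _ [p [[D cp] dp] <-] /=.
  have K := flowK D; have DV := flow_domV D.
  have cq : chart_at c (flow s p) by split.
  have dpp : chart_at d (flow (- s) (flow s p)) by rewrite K; split.
  exact: flow_Ck DV cq dpp.
move=> _ [p [[D cp] dp] <-] /=.
have cq : chart_at c (flow s p) by split.
have dpp : chart_at d p by split.
exact: flow_Ck D dpp cq.
Qed.

(** Invariance of X under its own flow, expressed through components. *)
Lemma flow_pull_field s c p : chart_at c (flow s p) -> flow_dom s p ->
  X (flow_pull s c) p = X c (flow s p).
Proof.
move=> [ac cq] D; have [d ad dp] := atlas_cover p.
have dpp : chart_at d p by split.
have fp : chart_at (flow_pull s c) p by split=> //; exact: flow_pull_atlas.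
by rewrite (vcomp_change X dpp fp) (flow_field D dpp (conj ac cq)).
Qed.

End flow_maps.

(** * The flow of a Killing field is isometric *)

Section isometries.
Context {R : realType} {n : nat} {M : manifold R n}.
Variables (X : vector_field M) (g : lorentz_metric M).
Hypothesis killing : forall c p, chart_at c p -> lie_metric g X c p = 0.
Implicit Types (s t h : R) (p q : M) (c d e : chart R n M).

(** The isometry equation is independent of the charts in which it is read, so it may be verified in
    the chart of a flow box. *)
Lemma flow_isometry_chart c d p q s (c0 d0 : chart R n M) : flow_rel X s p q ->
  chart_at c p -> chart_at d q -> chart_at c0 p -> chart_at d0 q ->
  (let A := jacobian (d0 \o flow X s \o cinv c0) (c0 p) in
   g c0 p = A *m g d0 q *m A^T) ->
  let A := jacobian (d \o flow X s \o cinv c) (c p) in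
  g c p = A *m g d q *m A^T.
Proof.
move=> F cp dq c0p d0q /=; set A0 := jacobian _ (c0 p) => E0; set A := jacobian _ _.
have FE := flowE F; have D := flow_relW F.
have cF := flow_continuous D.
have dq' : chart_at d (flow X s p) by rewrite FE.
have d0q' : chart_at d0 (flow X s p) by rewrite FE.
have [dA1 A1] := @jacobian_chart_comp _ _ M id (flow X s) c c0 d0 p p cp.2 c0p.2
  erefl (@cvg_id _ _) (transition_diff cp c0p) (flow_diff D c0p d0q').
have [_ A2] := @jacobian_chart_comp _ _ M (flow X s) id c d0 d p q cp.2 d0q.2 FE
  cF (flow_diff D cp d0q') (transition_diff d0q dq).
have AE : A = diff_mx id c c0 p *m A0 *m diff_mx id d0 d q.
  by transitivity (jacobian (d0 \o flow X s \o cinv c) (c p) *m diff_mx id d0 d q);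
    [exact: A2|congr (_ *m _); exact: A1].
rewrite (gcomp_change g cp c0p) E0 AE (gcomp_change g d0q dq).
exact: mx_congr_comp3.
Qed.

(** A flow box of order 1 provides the variational equation. Along a short orbit, the product of two
    transported vectors w and w' then has the derivative w (L_X g) w'^T, which vanishes by the
    Killing equation. *)
Lemma flow_isometry s p q : flow_rel X s p q ->
  flow_rel X s p q /\ forall c d, chart_at c p -> chart_at d q ->
    let A := jacobian (d \o flow X s \o cinv c) (c p) in
    g c p = A *m g d q *m A^T.
Proof.
move: s p q; apply: flow_induction.
  move=> s t p q r [F1 I1] [F2 I2]; split; first exact: flow_relD F1 F2.
  move=> c d cp dr A; have [e ae eq] := atlas_cover q.
  have eqq : chart_at e q by split.
  have E1 := flowE F1; have E2 := flowE F2.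
  have eqq' : chart_at e (flow X s p) by rewrite E1.
  have dr' : chart_at d (flow X t q) by rewrite E2.
  have D1 := flow_relW F1; have D2 := flow_relW F2.
  have [dA AE] := @jacobian_chart_comp _ _ M (flow X s) (flow X t) c e d p q
    cp.2 eq E1 (flow_continuous D1) (flow_diff D1 cp eqq') (flow_diff D2 eqq dr').
  have -> : A = jacobian (e \o flow X s \o cinv c) (c p) *m
      jacobian (d \o flow X t \o cinv e) (e q).
    rewrite -AE; apply: near_eq_jacobian dA.
    have N : \forall x \near p, flow_dom X t (flow X s x).
      apply: (flow_continuous D1); rewrite E1.
      exact: near_open (@flow_dom_open _ _ _ X t) D2.
    have N1 : \forall x \near p, flow_dom X s x := near_open (@flow_dom_open _ _ _ X s) D1.
    apply: filterS (near_chart cp.2 (filterI N1 N)) => x [_ [h1 h2]] /=.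
    by rewrite flow_comp.
  by rewrite (I1 c e cp eqq) (I2 e d eqq dr); exact: mx_congr_comp2.
move=> p0; have [c0 ac0 cp0] := atlas_cover p0.
have [eps [r [Phi [fb H]]]] := local_flow X 1 (conj ac0 cp0) openT I.
have e0 := fb_eps fb.
exists eps => //.
pose V := cdom c0 `&` [set x | `|c0 x - c0 p0| < r].
have oV : open V.
  exact: (@open_chart_preimage _ _ _ c0 _ (open_norm_ball (c0 p0) r)).
have Vp0 : V p0 by split=> //; rewrite /= subrr normr0 (fb_rad fb).
apply: filterS (near_open oV Vp0) => x Vx h y heps Fxy; split=> //.
have heps' : - eps < h < eps by rewrite -ltr_norml.
have FV t z : V z -> `|t| < eps -> flow_rel X t z (cinv c0 (Phi t (c0 z))).
  move=> [cz zr] te; have [cv v0 _] := H z cz zr.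
  have e00 : - eps < 0 < eps by rewrite oppr_lt0 e0.
  have te' : - eps < t < eps by rewrite -ltr_norml.
  by rewrite -{1}v0; exact: curve_on_flow cv e00 te'.
have Pimg t : `|t| < eps -> chart_at c0 (cinv c0 (Phi t (c0 x))) /\
    c0 (cinv c0 (Phi t (c0 x))) = Phi t (c0 x).
  by move=> te; have [z [cz _] zE] := fb_in fb Vx.2 te; rewrite -zE cfunK.
have yE : y = cinv c0 (Phi h (c0 x)) := flow_rel_unique Fxy (FV _ _ Vx heps).
have c0x : chart_at c0 x by split=> //; exact: Vx.1.
have c0y : chart_at c0 y by rewrite yE; case: (Pimg h heps).
move=> c d cx dy; apply: (flow_isometry_chart Fxy cx dy c0x c0y) => /=.
have NV := near_open oV Vx.
have PhiE : \forall z \near c0 x, Phi h z = (c0 \o flow X h \o cinv c0) z.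
  apply: filterS (near_chart Vx.1 NV) => z [/chart_img[_ zE] Vz] /=.
  rewrite (flowE (FV _ _ Vz heps)) zE.
  have zr : `|z - c0 p0| < r by have := Vz.2; rewrite /= zE.
  by have [w [cw _] wE] := fb_in fb zr heps; rewrite -wE cfunK.
have oB : open [set z : 'rV[R]_n.+1 | `|z - c0 p0| < r] by exact: open_norm_ball.
have dPhi t : `|t| < eps -> differentiable (Phi t) (c0 x).
  by move=> te; have /CkSP[dP _] := fb_Ck fb te; apply: dP; exact: Vx.2.
rewrite (near_eq_jacobian PhiE (dPhi h heps)).
pose G := g c0 \o cinv c0; pose f := X c0 \o cinv c0.
pose w (v : 'rV[R]_n.+1) t := 'D_v (Phi t) (c0 x).
have cimg t : `|t| < eps -> (c0 @` cdom c0) (Phi t (c0 x)).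
  move=> te; have [[_ cz] zE] := Pimg t te.
  by exists (cinv c0 (Phi t (c0 x))).
have dG t : `|t| < eps -> differentiable G (Phi t (c0 x)).
  by move=> /cimg; apply: smooth_differentiable (gcomp_smooth g ac0).
have df t : `|t| < eps -> differentiable f (Phi t (c0 x)).
  by move=> /cimg; apply: smooth_differentiable (vcomp_smooth X ac0).
(* Product of the transports of v and v' at time t; its values at h and at 0 are the two sides of
   the isometry equation. *)
pose u v v' t := w v t *m G (Phi t (c0 x)) *m (w v' t)^T.
have du v v' t : `|t| < eps -> is_derive t 1 (u v v') 0.
  move=> te; have [cpt ptE] := Pimg t te.
  have Dw z : is_derive t 1 (w z) (w z t *m jacobian f (Phi t (c0 x))).
    have := fb_variation fb isT z Vx.2 te.
    by rewrite deriveEjacobian//; exact: df.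
  have DG : is_derive t 1 (fun t => G (Phi t (c0 x)))
      ('D_(f (Phi t (c0 x))) G (Phi t (c0 x))).
    exact: is_derive_comp (fb_derive fb Vx.2 te) (dG t te).
  have := is_derive_mulmx (is_derive_mulmx (Dw v) DG) (is_derive_trmx (Dw v')).
  set J := jacobian f _; set DD := 'D_(f _) G _.
  have : DD + J *m G (Phi t (c0 x)) + G (Phi t (c0 x)) *m J^T = 0.
    by have := killing cpt; rewrite /lie_metric ptE.
  move=> K; rewrite [X in is_derive _ _ _ X -> _](_ : _ = 0) //.
  rewrite trmx_mul !mulmxA -mulmxDl -[RHS](mul0mx _ (w v' t)^T); congr (_ *m _).
  rewrite -[w v t *m J *m _]mulmxA -[w v t *m G _ *m _]mulmxA -!mulmxDr.
  by rewrite [J *m _ + _]addrC K mulmx0.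
have uE v v' : u v v' h = u v v' 0.
  apply/eqP; rewrite -subr_eq0 -normr_le0.
  have := @mean_value_dist _ _ (u v v') (fun=> 0) (fun t => `|t| < eps) 0 h 0.
  rewrite mul0r; apply => //.
  - exact: convex_ltn.
  - by rewrite normr0.
  - by move=> t _; rewrite normr0.
apply: mx_form_inj => v v'.
have eps0 : `|0 : R| < eps by rewrite normr0.
have w0 z : w z 0 = z.
  rewrite /w -[RHS](derive_id (c0 x) z); apply: near_eq_derive.
  apply: filterS (near_open oB Vx.2) => z' zr.
  have E0 : Phi 0 z' = z' := fb_init fb zr.
  exact: E0.
have := uE v v'; rewrite /u !w0 /w !(deriveEjacobian _ (dPhi h heps)).
rewrite (fb_init fb Vx.2) /G /= cfunK; last exact: Vx.1.
by rewrite -yE => <-; rewrite trmx_mul !mulmxA.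
Qed.

Lemma flow_pull_metric s c p : chart_at c (flow X s p) -> flow_dom X s p ->
  g (flow_pull X s c) p = g c (flow X s p).
Proof.
move=> [ac cq] D; have [d ad dp] := atlas_cover p.
have dpp : chart_at d p by split.
have fp : chart_at (flow_pull X s c) p by split=> //; exact: flow_pull_atlas.
have E1 := gcomp_change g dpp fp.
have [_ /(_ d c dpp (conj ac cq)) E2] := flow_isometry (flow_domP D).
apply: (mx_congr_inj (diff_mxV fp dpp)); rewrite -E1; exact: E2.
Qed.

End isometries.

(** * Gluing translates along the flow *)

Section globalization.
Context {R : realType} {n : nat} {M : manifold R n}.
Variable X : vector_field M.
Implicit Types (a b t s h : R) (p q : M) (c e : chart R n M) (u v : R * M).

(* [(t, p)] stands for the point reached from [p] after time [t]. *)
Definition glue_rel u v := flow_rel X (u.1 - v.1) u.2 v.2.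

Lemma glue_rel_refl u : glue_rel u u.
Proof. by rewrite /glue_rel subrr; exact: flow_rel0. Qed.

Lemma glue_rel_sym u v : glue_rel u v -> glue_rel v u.
Proof. by move=> /flow_relV; rewrite opprB. Qed.

Lemma glue_rel_trans u v w : glue_rel u v -> glue_rel v w -> glue_rel u w.
Proof. by move=> uv vw; have := flow_relD uv vw; rewrite subrKA. Qed.

Record globalization := Globalization {
  glob_class : set (R * M);
  glob_classP : exists u, glob_class = [set v | glue_rel u v] }.

HB.instance Definition _ := gen_eqMixin globalization.
HB.instance Definition _ := gen_choiceMixin globalization.

Definition iota_map t p : globalization :=
  Globalization (ex_intro _ (t, p) (erefl [set v | glue_rel (t, p) v])).

Lemma globalization_inj (x y : globalization) :
  glob_class x = glob_class y -> x = y.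
Proof.
case: x y => [A HA] [B HB] /= E; case: _ / E in HB *.
by congr Globalization; exact: Prop_irrelevance.
Qed.

Lemma iota_eq t p s q : iota_map t p = iota_map s q <-> flow_rel X (t - s) p q.
Proof.
split=> [E|F].
  suff : glob_class (iota_map t p) (s, q) by [].
  by rewrite E; exact: (glue_rel_refl (s, q)).
apply: globalization_inj; apply/seteqP; split=> v /= H.
  exact: glue_rel_trans (glue_rel_sym (F : glue_rel (t, p) (s, q))) H.
exact: glue_rel_trans (F : glue_rel (t, p) (s, q)) H.
Qed.

Lemma iota_surj (x : globalization) : exists t p, x = iota_map t p.
Proof.
case: x => A HA; have [[t p] E] := HA; exists t, p.
exact: globalization_inj.
Qed.

Lemma iota_inj t : injective (iota_map t).
Proof.
by move=> p q /iota_eq; rewrite subrr => /(flow_rel_unique (flow_rel0 X p)).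
Qed.

Lemma iota_flow t s p q : flow_rel X s p q -> iota_map t q = iota_map (t + s) p.
Proof.
by move=> F; apply/esym/iota_eq; rewrite [t + s]addrC addrK.
Qed.

(** Final topology of the slice maps. Time is an index without topology here, so that each slice,
    and not a product with the line, becomes an open subset of the quotient. *)
Definition glob_op : set_system globalization :=
  [set U | forall t, open (iota_map t @^-1` U)].

Lemma glob_opT : glob_op setT.
Proof. by move=> t; rewrite preimage_setT; exact: openT. Qed.

Lemma glob_opI : setI_closed glob_op.
Proof. by move=> A B oA oB t; rewrite preimage_setI; exact: openI. Qed.

Lemma glob_op_bigU (I : Type) (f : I -> set globalization) :
  (forall i, glob_op (f i)) -> glob_op (\bigcup_i f i).
Proof.
by move=> H t; rewrite preimage_bigcup; apply: bigcup_open => i _; exact: H.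
Qed.

HB.instance Definition _ :=
  isOpenTopological.Build globalization glob_opT glob_opI glob_op_bigU.

Lemma glob_openE (U : set globalization) :
  open U = (forall t, open (iota_map t @^-1` U)).
Proof. by []. Qed.

Lemma iota_continuous t : continuous (iota_map t).
Proof. by apply/continuousP => A; rewrite glob_openE. Qed.

(** The passage from one slice to another is a flow map at a fixed time; openness of the slice maps
    thus reduces to the openness of its domain and to its continuity. *)
Lemma iota_preimage t s (A : set M) :
  iota_map s @^-1` (iota_map t @` A) =
  flow_dom X (s - t) `&` flow X (s - t) @^-1` A.
Proof.
apply/seteqP; split=> q /=.
  by move=> [p Ap /esym/iota_eq F]; split; [exists p|rewrite /= (flowE F)].
move=> [/flow_domP F Aq]; exists (flow X (s - t) q) => //.
exact/esym/iota_eq.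
Qed.

Lemma iota_open t (A : set M) : open A -> open (iota_map t @` A).
Proof.
move=> oA; rewrite glob_openE => s; rewrite iota_preimage openE => p [D Ap].
suff : \forall q \near p, (flow_dom X (s - t) `&` flow X (s - t) @^-1` A) q by [].
have h1 := near_open (@flow_dom_open _ _ _ X (s - t)) D.
have h2 : \forall q \near p, A (flow X (s - t) q).
  exact: (flow_continuous D (near_open oA Ap)).
exact: filterI h1 h2.
Qed.

Lemma iota_near t p (P : set globalization) :
  (\forall x \near iota_map t p, P x) <-> (\forall q \near p, P (iota_map t q)).
Proof.
split=> [|H]; first exact: iota_continuous.
have oA : open (iota_map t @` [set q | P (iota_map t q)]°).
  by apply: iota_open; exact: open_interior.
have : (iota_map t @` [set q | P (iota_map t q)]°) (iota_map t p) by exists p.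
by move=> /(near_open oA); apply: filterS => _ [q /interior_subset Pq <-].
Qed.

Definition glob_repr (x : globalization) : R * M := projT1 (cid (glob_classP x)).

Lemma glob_reprE x : iota_map (glob_repr x).1 (glob_repr x).2 = x.
Proof.
rewrite /glob_repr; case: cid => -[t p] /= E.
by apply: globalization_inj; rewrite E.
Qed.

Definition iota_inv t (x : globalization) : M :=
  xget (glob_repr x).2 [set p | iota_map t p = x].

Lemma iotaK t : cancel (iota_map t) (iota_inv t).
Proof.
move=> p; apply: (@iota_inj t).
exact: (@xgetPex _ _ [set q | iota_map t q = iota_map t p] (ex_intro _ p erefl)).
Qed.

Lemma iota_invK t x : range (iota_map t) x -> iota_map t (iota_inv t x) = x.
Proof. by move=> [p _ <-]; rewrite iotaK. Qed.

Lemma iota_range_open t : open (range (iota_map t)).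
Proof. exact/iota_open/openT. Qed.

Lemma iota_inv_continuous t x : range (iota_map t) x ->
  {for x, continuous (iota_inv t)}.
Proof.
move=> [p _ <-] A; rewrite iotaK => nA; apply/iota_near.
by apply: filterS nA => q; rewrite /= iotaK.
Qed.

Implicit Types d : chart R n globalization.

Lemma pull_chart_dom_open t d : open (iota_map t @^-1` cdom d).
Proof. by have := cdom_open d; rewrite glob_openE. Qed.

Lemma pull_chart_img t d : (d \o iota_map t) @` (iota_map t @^-1` cdom d) =
  d @` (cdom d `&` range (iota_map t)).
Proof.
apply/seteqP; split=> y.
  by move=> [p dp <-]; exists (iota_map t p) => //; split=> //; exists p.
by move=> [x [dx [p _ px]] <-]; exists p; rewrite /= px.
Qed.

Lemma pull_chart_img_open t d :
  open ((d \o iota_map t) @` (iota_map t @^-1` cdom d)).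
Proof. by rewrite pull_chart_img; apply/chart_img_open/iota_range_open. Qed.

Lemma pull_chartK t d p : (iota_map t @^-1` cdom d) p ->
  (iota_inv t \o cinv d) ((d \o iota_map t) p) = p.
Proof. by move=> dp /=; rewrite cfunK// iotaK. Qed.

Lemma pull_chart_cts t d p : (iota_map t @^-1` cdom d) p ->
  {for p, continuous (d \o iota_map t)}.
Proof.
move=> dp; apply: continuous_comp; [exact: iota_continuous|exact: cfun_cts].
Qed.

Lemma pull_chart_inv_cts t d y :
  ((d \o iota_map t) @` (iota_map t @^-1` cdom d)) y ->
  {for y, continuous (iota_inv t \o cinv d)}.
Proof.
rewrite pull_chart_img => -[x [dx rx] <-]; apply: continuous_comp.
  by apply: cinv_cts; exists x.
by rewrite cfunK//; exact: iota_inv_continuous.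
Qed.

Definition pull_chart t d : chart R n M :=
  Chart (@pull_chart_dom_open t d) (@pull_chart_img_open t d) (@pull_chartK t d)
    (@pull_chart_cts t d) (@pull_chart_inv_cts t d).

Lemma push_chart_dom_open t c : open (iota_map t @` cdom c).
Proof. exact/iota_open/cdom_open. Qed.

Lemma push_chart_img t c : (c \o iota_inv t) @` (iota_map t @` cdom c) = c @` cdom c.
Proof.
apply/seteqP; split=> y.
  by move=> [_ [p cp <-] <-]; exists p; rewrite /= ?iotaK.
by move=> [p cp <-]; exists (iota_map t p); [exists p|rewrite /= iotaK].
Qed.

Lemma push_chart_img_open t c : open ((c \o iota_inv t) @` (iota_map t @` cdom c)).
Proof. by rewrite push_chart_img; exact: cimg_open. Qed.

Lemma push_chartK t c x : (iota_map t @` cdom c) x ->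
  (iota_map t \o cinv c) ((c \o iota_inv t) x) = x.
Proof. by move=> [p cp <-] /=; rewrite iotaK cfunK. Qed.

Lemma push_chart_cts t c x : (iota_map t @` cdom c) x ->
  {for x, continuous (c \o iota_inv t)}.
Proof.
move=> [p cp <-]; apply: continuous_comp.
  by apply: iota_inv_continuous; exists p.
by rewrite iotaK; exact: cfun_cts.
Qed.

Lemma push_chart_inv_cts t c y :
  ((c \o iota_inv t) @` (iota_map t @` cdom c)) y ->
  {for y, continuous (iota_map t \o cinv c)}.
Proof.
rewrite push_chart_img => cy; apply: continuous_comp; first exact: cinv_cts.
exact: iota_continuous.
Qed.

Definition push_chart t c : chart R n globalization :=
  Chart (@push_chart_dom_open t c) (@push_chart_img_open t c) (@push_chartK t c)
    (@push_chart_cts t c) (@push_chart_inv_cts t c).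

(** Charts that agree on their domain may still differ in the irrelevant values outside of it and in
    the field [cinv]; maximality makes membership in the atlas insensitive to this. *)
Lemma atlas_congr c e : atlas c -> cdom c = cdom e ->
  (forall p, cdom c p -> c p = e p) -> atlas e.
Proof.
move=> ac ce E; apply: atlas_max => d ad; have [S1 S2] := atlas_compat ac ad.
split=> k.
  have -> : e @` (cdom e `&` cdom d) = c @` (cdom c `&` cdom d).
    by rewrite ce; apply/seteqP; split=> _ [p [h1 h2] <-]; exists p;
      rewrite ?E ?ce.
  apply: Ck_eq (S1 k); first exact/chart_img_open/cdom_open.
  move=> _ [p [h1 h2] <-] /=; rewrite cfunK// E// cfunK//.
  by rewrite -ce.
rewrite -ce; apply: Ck_eq (S2 k).
  by rewrite setIC; apply: chart_img_open; exact: cdom_open.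
by move=> _ [p [h1 h2] <-] /=; rewrite cfunK// E.
Qed.

(** Compatibility of charts tested on every slice is inherited from M; that there are enough of them
    is the content of [push_chart_atlas]. *)
Definition glob_atlas : set (chart R n globalization) :=
  [set d | forall t, atlas (pull_chart t d)].

(** Seen from slice s, the chart pushed forward from slice t is c after the flow for the time s - t,
    that is [flow_pull] of c. *)
Lemma push_chart_atlas t c : atlas c -> glob_atlas (push_chart t c).
Proof.
move=> ac s; apply: atlas_congr (flow_pull_atlas X (s - t) ac) _ _.
  by rewrite /= iota_preimage.
move=> p [D cp] /=; congr (c _).
have /iota_eq -> := flow_domP D.
by rewrite iotaK.
Qed.

Lemma glob_atlas_cover x : exists2 d, glob_atlas d & cdom d x.
Proof.
have [t [p ->]] := iota_surj x; have [c ac cp] := atlas_cover p.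
by exists (push_chart t c); [exact: push_chart_atlas|exists p].
Qed.

Lemma near_pull_inv t d p : cdom d (iota_map t p) ->
  \forall z \near d (iota_map t p),
    [/\ cdom d (cinv d z), d (cinv d z) = z &
        iota_map t (iota_inv t (cinv d z)) = cinv d z].
Proof.
move=> dp.
have rp : range (iota_map t) (iota_map t p) by exists p.
apply: filterS (near_chart dp (near_open (@iota_range_open t) rp)).
by move=> z [/chart_img[h1 h2] h3]; rewrite iota_invK.
Qed.

Lemma glob_transition_Ck k d d' t p : glob_atlas d -> glob_atlas d' ->
  cdom d (iota_map t p) -> cdom d' (iota_map t p) ->
  Ck_near k (d' \o cinv d) (d (iota_map t p)).
Proof.
move=> ad ae dp ep.
have := @transition_Ck _ _ M k (pull_chart t d) (pull_chart t d') p
  (conj (ad t) dp) (conj (ae t) ep).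
apply: Ck_near_eq; apply: filterS (near_pull_inv dp) => z [_ _] /= ->.
by [].
Qed.

Lemma glob_atlas_compat d d' : glob_atlas d -> glob_atlas d' -> chart_compat d d'.
Proof.
move=> ad ae; split; apply: smooth_near => k _ [x [dx ex] <-];
  have [t [p E]] := iota_surj x; rewrite E in dx ex *; exact: glob_transition_Ck.
Qed.

Lemma glob_atlas_max d : (forall d', glob_atlas d' -> chart_compat d d') ->
  glob_atlas d.
Proof.
move=> H t; apply: atlas_max => e ae.
have [S1 S2] := H _ (push_chart_atlas t ae); split=> k.
  apply: Ck_sub (S1 k) => _ [p [dp ep] <-].
  by exists (iota_map t p) => //; split=> //; exists p.
apply: Ck_sub (S2 k) => _ [p [dp ep] <-].
by exists (iota_map t p); [split=> //; exists p|rewrite /= iotaK].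
Qed.

(** Every point has a representative in a slice of rational index, since p can be flowed for some
    short time. The images of a countable base of M under the rational slice maps therefore form a
    base. *)
Lemma glob_second_countable : @second_countable globalization.
Proof.
have [B cB [oB bB]] := @manifold_second_countable _ _ M.
exists [set iota_map (ratr x.1) @` x.2 | x in [set: rat] `*` B].
  by apply: card_le_trans (card_image_le _ _) _; exact: countableX.
split; first by move=> _ [[r b] [_ Bb] <-]; apply: iota_open; exact: oB.
move=> x A nA; have [t [p E]] := iota_surj x; rewrite E in nA *.
have [a [b [g [/andP[a0 b0] cg g0 gE]]]] := flow_curve X p.
(* With this choice t - r lies in the interval ]a, b[ where the orbit of p is known to exist. *)
have [|r] := @rat_in_itvoo R (t - b) (t - a).
  by rewrite ltrD2l ltrN2 (lt_trans a0).
rewrite in_itv => /andP[/= r1 r2].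
have sab : a < t - ratr r < b by rewrite ltrBrDl -ltrBrDr r2 ltrBlDl -ltrBlDr.
have F : flow_rel X (t - ratr r) p (g (t - ratr r)).
  by rewrite -{1}g0; apply: (curve_on_flow cg) => //; rewrite a0 b0.
have E' := iota_flow (ratr r) F; rewrite [ratr r + _]addrC subrK in E'.
rewrite -E' in nA *.
have /bB[U [BU Up] UA] := (iota_near _ _ _).1 nA.
exists (iota_map (ratr r) @` U); last by move=> _ [q Uq <-]; exact: UA.
by split; [exists (r, U)|exists (g (t - ratr r))].
Qed.

(** Discharged by [globalization_hausdorff] for globally hyperbolic M and future-directed X. *)
Hypothesis glob_hausdorff : hausdorff_space globalization.

Definition glob_manifold : manifold R n :=
  Manifold glob_atlas_cover glob_atlas_compat glob_atlas_max glob_hausdorff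
    glob_second_countable.

Lemma pull_chart_at t d p : @chart_at _ _ glob_manifold d (iota_map t p) ->
  chart_at (pull_chart t d) p.
Proof. by move=> [ad dp]; split=> //; exact: ad. Qed.

Lemma diff_mx_germ c e p : chart_at c p -> (\forall q \near p, c q = e q) ->
  diff_mx id c e p = 1%:M.
Proof.
move=> cp ce; rewrite -(jacobian_id (c p)); apply: near_eq_jacobian => //.
apply: filterS (near_chart cp.2 ce) => z [/chart_img[_ E] ce'].
by rewrite /= -ce' E.
Qed.

Lemma vcomp_germ (Z : vector_field M) c e p : chart_at c p -> chart_at e p ->
  (\forall q \near p, c q = e q) -> Z c p = Z e p.
Proof.
by move=> cp ep ce; rewrite (vcomp_change Z cp ep) (diff_mx_germ cp ce) mulmx1.
Qed.

Lemma gcomp_germ (g : lorentz_metric M) c e p : chart_at c p -> chart_at e p ->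
  (\forall q \near p, c q = e q) -> g c p = g e p.
Proof.
move=> cp ep ce; rewrite (gcomp_change g cp ep) (diff_mx_germ cp ce).
by rewrite trmx1 mulmx1 mul1mx.
Qed.

Lemma pull_flow_germ t s d p : flow_dom X (t - s) p ->
  \forall q \near p, flow_pull X (t - s) (pull_chart s d) q = pull_chart t d q.
Proof.
move=> D; apply: filterS (near_open (@flow_dom_open _ _ _ X (t - s)) D).
by move=> q /flow_domP/iota_eq /= ->.
Qed.

(** Two representatives of a point differ by a flow map, under which the components of X are
    unchanged. The components of the field on the quotient may thus be computed from any
    representative. *)
Lemma pull_chart_vcomp d t p s q :
  @chart_at _ _ glob_manifold d (iota_map t p) -> iota_map t p = iota_map s q ->
  X (pull_chart s d) q = X (pull_chart t d) p.
Proof.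
move=> dp E; have F := (iota_eq _ _ _ _).1 E; have D := flow_relW F.
have dq := dp; rewrite E in dq.
have dq' : chart_at (pull_chart s d) (flow X (t - s) p).
  by rewrite (flowE F); exact: pull_chart_at.
rewrite -(flowE F) -(flow_pull_field dq' D).
apply: vcomp_germ (pull_flow_germ d D).
  by split; [exact: flow_pull_atlas dq'.1|split=> //; exact: dq'.2].
exact: pull_chart_at.
Qed.

Definition glob_vcomp d (x : glob_manifold) : 'rV[R]_n.+1 :=
  X (pull_chart (glob_repr x).1 d) (glob_repr x).2.

Lemma glob_vcompE d t p : @chart_at _ _ glob_manifold d (iota_map t p) ->
  glob_vcomp d (iota_map t p) = X (pull_chart t d) p.
Proof.
by move=> dp; apply: (pull_chart_vcomp dp); rewrite glob_reprE.
Qed.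

Lemma near_pull d t p : @chart_at _ _ glob_manifold d (iota_map t p) ->
  \forall z \near d (iota_map t p), exists2 q, chart_at (pull_chart t d) q &
    cinv d z = iota_map t q /\ cinv (pull_chart t d) z = q.
Proof.
move=> [ad dp]; apply: filterS (near_pull_inv dp) => z [h1 h2 h3].
exists (iota_inv t (cinv d z)); last by rewrite h3.
by split; [exact: ad|rewrite /= h3].
Qed.

Lemma near_glob_vcomp d t p : @chart_at _ _ glob_manifold d (iota_map t p) ->
  \forall z \near d (iota_map t p),
    (X (pull_chart t d) \o cinv (pull_chart t d)) z = (glob_vcomp d \o cinv d) z.
Proof.
move=> dp; apply: filterS (near_pull dp) => z [q cq [E1 E2]].
transitivity (X (pull_chart t d) q); first by rewrite -E2.
rewrite /= E1 glob_vcompE//.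
by split; [exact: dp.1|exact: cq.2].
Qed.

Lemma glob_vcomp_smooth d : glob_atlas d ->
  smooth (d @` cdom d) (glob_vcomp d \o cinv d).
Proof.
move=> ad; apply: smooth_near => k _ [x dx <-].
have [t [p E]] := iota_surj x; rewrite E in dx *.
have dp : @chart_at _ _ glob_manifold d (iota_map t p) by split.
apply: Ck_near_eq (near_glob_vcomp dp) _.
apply: Ck_near_open (vcomp_smooth X (ad t) k); first exact: cimg_open.
by exists p.
Qed.

Lemma diff_mx_pull d d' t p : @chart_at _ _ glob_manifold d (iota_map t p) ->
  @chart_at _ _ glob_manifold d' (iota_map t p) ->
  @diff_mx _ _ glob_manifold glob_manifold id d d' (iota_map t p) =
  diff_mx id (pull_chart t d) (pull_chart t d') p.
Proof.
move=> dp dp'; apply: near_eq_jacobian.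
  apply: filterS (near_pull dp) => z [q cq [E1 E2]].
  transitivity (pull_chart t d' q); first by rewrite -E2.
  by rewrite /= E1.
exact: (@transition_diff _ _ M (pull_chart t d) (pull_chart t d') p
  (pull_chart_at dp) (pull_chart_at dp')).
Qed.

Lemma glob_vcomp_change d d' x : @chart_at _ _ glob_manifold d x ->
  @chart_at _ _ glob_manifold d' x ->
  glob_vcomp d' x =
  glob_vcomp d x *m @diff_mx _ _ glob_manifold glob_manifold id d d' x.
Proof.
have [t [p ->]] := iota_surj x => dp dp'.
rewrite !glob_vcompE// diff_mx_pull//.
by apply: vcomp_change; exact: pull_chart_at.
Qed.

Definition glob_field : vector_field glob_manifold :=
  @VectorField _ _ glob_manifold glob_vcomp glob_vcomp_smooth glob_vcomp_change.

Variable g : lorentz_metric M.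
Hypothesis killing : forall c p, chart_at c p -> lie_metric g X c p = 0.

Lemma pull_chart_gcomp d t p s q :
  @chart_at _ _ glob_manifold d (iota_map t p) -> iota_map t p = iota_map s q ->
  g (pull_chart s d) q = g (pull_chart t d) p.
Proof.
move=> dp E; have F := (iota_eq _ _ _ _).1 E; have D := flow_relW F.
have dq := dp; rewrite E in dq.
have dq' : chart_at (pull_chart s d) (flow X (t - s) p).
  by rewrite (flowE F); exact: pull_chart_at.
rewrite -(flowE F) -(flow_pull_metric killing dq' D).
apply: gcomp_germ (pull_flow_germ d D).
  by split; [exact: flow_pull_atlas dq'.1|split=> //; exact: dq'.2].
exact: pull_chart_at.
Qed.

Definition glob_gcomp d (x : glob_manifold) : 'M[R]_n.+1 :=
  g (pull_chart (glob_repr x).1 d) (glob_repr x).2.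

Lemma glob_gcompE d t p : @chart_at _ _ glob_manifold d (iota_map t p) ->
  glob_gcomp d (iota_map t p) = g (pull_chart t d) p.
Proof.
by move=> dp; apply: (pull_chart_gcomp dp); rewrite glob_reprE.
Qed.

Lemma near_glob_gcomp d t p : @chart_at _ _ glob_manifold d (iota_map t p) ->
  \forall z \near d (iota_map t p),
    (g (pull_chart t d) \o cinv (pull_chart t d)) z = (glob_gcomp d \o cinv d) z.
Proof.
move=> dp; apply: filterS (near_pull dp) => z [q cq [E1 E2]].
transitivity (g (pull_chart t d) q); first by rewrite -E2.
rewrite /= E1 glob_gcompE//.
by split; [exact: dp.1|exact: cq.2].
Qed.

Lemma glob_gcomp_smooth d : glob_atlas d ->
  smooth (d @` cdom d) (glob_gcomp d \o cinv d).
Proof.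
move=> ad; apply: smooth_near => k _ [x dx <-].
have [t [p E]] := iota_surj x; rewrite E in dx *.
have dp : @chart_at _ _ glob_manifold d (iota_map t p) by split.
apply: Ck_near_eq (near_glob_gcomp dp) _.
apply: Ck_near_open (gcomp_smooth g (ad t) k); first exact: cimg_open.
by exists p.
Qed.

Lemma glob_gcomp_change d d' x : @chart_at _ _ glob_manifold d x ->
  @chart_at _ _ glob_manifold d' x ->
  glob_gcomp d x =
  @diff_mx _ _ glob_manifold glob_manifold id d d' x *m glob_gcomp d' x *m
  (@diff_mx _ _ glob_manifold glob_manifold id d d' x)^T.
Proof.
have [t [p ->]] := iota_surj x => dp dp'.
rewrite !glob_gcompE// diff_mx_pull//.
by apply: gcomp_change; exact: pull_chart_at.
Qed.

Lemma glob_gcomp_lorentz d x : @chart_at _ _ glob_manifold d x ->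
  lorentz_signature (glob_gcomp d x).
Proof.
have [t [p ->]] := iota_surj x => dp; rewrite glob_gcompE//.
by apply: (gcomp_lorentz g); exact: pull_chart_at.
Qed.

Definition glob_metric : lorentz_metric glob_manifold :=
  @LorentzMetric _ _ glob_manifold glob_gcomp glob_gcomp_smooth
    glob_gcomp_change glob_gcomp_lorentz.

Lemma glob_lie_metric d x : @chart_at _ _ glob_manifold d x ->
  lie_metric glob_metric glob_field d x = 0.
Proof.
have [t [p ->]] := iota_surj x => dp; have cp := pull_chart_at dp.
rewrite -(killing cp) /lie_metric.
have NX := near_glob_vcomp dp; have NG := near_glob_gcomp dp.
have dX : differentiable (X (pull_chart t d) \o cinv (pull_chart t d))
    (d (iota_map t p)).
  apply: (smooth_differentiable (vcomp_smooth X cp.1)).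
  by exists p => //; exact: cp.2.
have JE : jacobian (glob_field d \o cinv d) (d (iota_map t p)) =
    jacobian (X (pull_chart t d) \o cinv (pull_chart t d)) (pull_chart t d p).
  exact: near_eq_jacobian NX dX.
have XE : glob_field d (iota_map t p) = X (pull_chart t d) p := glob_vcompE dp.
have GE : glob_metric d (iota_map t p) = g (pull_chart t d) p := glob_gcompE dp.
have DE : 'D_(X (pull_chart t d) p) (glob_metric d \o cinv d) (d (iota_map t p)) =
    'D_(X (pull_chart t d) p) (g (pull_chart t d) \o cinv (pull_chart t d))
      (pull_chart t d p).
  by apply/esym; exact: near_eq_derive NG.
by rewrite JE XE GE DE.
Qed.

(** Increasing the index moves a point along the field. Near t1 the curve equals
    [iota_map (t0 + t1) (h (t - t1))] for a local integral curve h of X through p, and the same germ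
    of h at 0 serves for every t1; hence completeness. *)
Lemma glob_integral_curve t0 p :
  integral_curve glob_field (fun t => iota_map (t0 + t) p).
Proof.
have [a [b [h [ab0 ch h0 hE]]]] := flow_curve X p.
have [c0 D0] := ch _ ab0; rewrite h0 in D0.
have E t1 : \forall t \near t1, iota_map (t0 + t1) (h (t - t1)) = iota_map (t0 + t) p.
  have tab : a + t1 < t1 < b + t1.
    by case/andP: ab0 => a0 b0; rewrite gtrDr a0 ltrDr.
  apply: filterS (near_itvoo tab) => t tab'.
  have tt1 : a < t - t1 < b by rewrite ltrBrDr ltrBlDr.
  have F := curve_on_flow ch ab0 tt1; rewrite h0 in F.
  by rewrite (iota_flow _ F) -addrA (addrC t1) subrK.
have ct1 t1 : {for t1, continuous (fun t => h (t - t1))}.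
  apply: (@continuous_comp _ _ _ (fun t => t - t1) h).
    by apply: cvgB; [exact: cvg_id|exact: cvg_cst].
  by rewrite /= subrr.
split=> [t1|t1 d dp].
  have C : {for t1, continuous (iota_map (t0 + t1) \o (fun t => h (t - t1)))}.
    by apply: continuous_comp; [exact: ct1|exact: iota_continuous].
  rewrite /continuous_at -(nbhs_singleton (E t1)).
  by apply: cvg_trans C; apply: near_eq_cvg; exact: E.
have DD := D0 _ (pull_chart_at dp).
have DD' : is_derive t1 1 (fun t => (pull_chart (t0 + t1) d \o h) (t + - t1))
    (X (pull_chart (t0 + t1) d) p).
  by apply: is_derive_translate; rewrite subrr.
rewrite [X in is_derive _ _ _ X](_ : _ = X (pull_chart (t0 + t1) d) p); last first.
  exact: glob_vcompE.
by apply: near_eq_is_derive DD'; apply: filterS (E t1) => t /= ->.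
Qed.

Lemma glob_complete : complete_field glob_field.
Proof.
move=> x; have [t0 [p ->]] := iota_surj x.
by exists (fun t => iota_map (t0 + t) p); [exact: glob_integral_curve|rewrite addr0].
Qed.

(** Each slice is connected and meets one fixed integral curve L, which runs through all indices.
    Empty M is treated apart. *)
Lemma glob_connected : connected [set: M] -> connected [set: glob_manifold].
Proof.
move=> cM.
have [[p0 _]|M0] := pselect (exists p : M, True); last first.
  have -> : [set: glob_manifold] = set0.
    by apply/seteqP; split=> // x _; have [_ [p _]] := iota_surj x; case: M0; exists p.
  exact: connected0.
have [cg _] := glob_integral_curve 0 p0.
pose L : set glob_manifold := (fun t => iota_map (0 + t) p0) @` [set: R].
have cL : connected L.
  apply: connected_continuous_connected; last exact: continuous_subspaceT.
  by apply/connected_intervalP => a b _ _ c _.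
have -> : [set: glob_manifold] = \bigcup_(t in [set: R]) (iota_map t @` setT `|` L).
  apply/seteqP; split=> // x _; have [t [p ->]] := iota_surj x.
  by exists t => //; left; exists p.
apply: bigcup_connected.
  by exists (iota_map 0 p0) => t _; right; exists 0; rewrite ?addr0.
move=> t _; apply: connectedU => //.
  by exists (iota_map t p0); split; [exists p0|exists t; rewrite ?add0r].
apply: connected_continuous_connected => //.
exact/continuous_subspaceT/iota_continuous.
Qed.

End globalization.

(** * Global hyperbolicity and the Hausdorff property *)

Section causal_curves.
Context {R : realType} {n : nat} {M : spacetime R n}.
Implicit Types (a b t s e r : R) (p q x : M) (c d : chart R n M).

Lemma gdot_change (N : manifold R n) (g : lorentz_metric N) (c d : chart R n N)
    (p : N) (v w : 'rV[R]_n.+1) : chart_at c p -> chart_at d p ->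
  gdot g d p (v *m diff_mx id c d p) (w *m diff_mx id c d p) = gdot g c p v w.
Proof.
by move=> cp dp; rewrite /gdot (gcomp_change g cp dp) trmx_mul !mulmxA.
Qed.

Lemma gdot_rV0 (N : manifold R n) (g : lorentz_metric N) (c : chart R n N)
  (p : N) (w : 'rV[R]_n.+1) : gdot g c p 0 w = 0.
Proof. by rewrite /gdot !mul0mx mxE. Qed.

Lemma future_causal_change c d p v : chart_at c p -> chart_at d p ->
  future_causal c p v -> future_causal d p (v *m diff_mx id c d p).
Proof.
move=> cp dp [v0 vv Tv]; split.
- apply: contra_neq v0 => E; have := congr1 (mulmx^~ (diff_mx id d c p)) E.
  by rewrite -mulmxA diff_mxV// mulmx1 mul0mx.
- by rewrite gdot_change.
- by rewrite (vcomp_change (torient M) cp dp) gdot_change.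
Qed.

Lemma future_timelike_causal c p v : future_timelike c p v ->
  future_causal c p v.
Proof.
move=> [vv Tv]; split=> //; last exact: ltW.
by apply/eqP => v0; move: vv; rewrite v0 gdot_rV0 ltxx.
Qed.

Lemma smooth_curve_in_sub (N : manifold R n)
    (K : chart R n N -> N -> 'rV[R]_n.+1 -> Prop) (J J' : set R) (gam : R -> N) :
  J `<=` J' -> smooth_curve_in K J' gam -> smooth_curve_in K J gam.
Proof.
move=> JJ' [h1 h2 h3]; split=> [t /JJ'|c ac k|t c /JJ']; [exact: h1| |exact: h3].
by apply: Ck_sub (h2 c ac k) => t [/JJ'].
Qed.

Lemma derive1_is_derive (V : normedModType R) (f : R -> V) t (d' : V) :
  is_derive t 1 f d' -> f^`()%classic t = d'.
Proof. by move=> [_ <-]; rewrite derive1E. Qed.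

Lemma open_preim_curve (T : topologicalType) (J : set R) (gam : R -> T) (A : set T) :
  open J -> open A -> (forall t, J t -> {for t, continuous gam}) ->
  open (J `&` gam @^-1` A).
Proof.
move=> oJ oA cg; rewrite openE => t [Jt At].
suff : \forall s \near t, (J `&` gam @^-1` A) s by [].
have h : \forall s \near t, A (gam s) := cg t Jt _ (near_open oA At).
exact: filterI (near_open oJ Jt) h.
Qed.

Lemma smooth_curve_in_shift (N : manifold R n)
    (K : chart R n N -> N -> 'rV[R]_n.+1 -> Prop) t e s (gam : R -> N) :
  smooth_curve_in K (ball t e) gam ->
  smooth_curve_in K (ball (t + s) e) (fun u => gam (u - s)).
Proof.
move=> [h1 h2 h3].
have bE u : ball (t + s) e u -> ball t e (u - s).
  by rewrite -!ball_normE /= opprB addrA addrAC.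
have hc u : ball (t + s) e u -> {for u, continuous (fun u => gam (u - s))}.
  move=> /bE/h1 cg; apply: (@continuous_comp _ _ _ (fun u => u - s) gam) => //.
  by apply: cvgB; [exact: cvg_id|exact: cvg_cst].
have oball : open (ball (t + s) e) by exact: ball_open.
split=> // [c ac k|u c /bE Ju cu].
  have oA : open (ball t e `&` gam @^-1` cdom c).
    by apply: open_preim_curve => //; [exact: ball_open|exact: cdom_open].
  apply: (@Ck_comp_real _ _ _ _ _ (ball t e `&` gam @^-1` cdom c) (fun u => u - s)
    (c \o gam)) (h2 c ac k) => //.
  - by apply: open_preim_curve => //; exact: cdom_open.
  - by move=> u [/bE ? ?]; split.
  - apply: Ck_eq (Ck_affine _ _ (- s) (1 : R)) => //.
      by apply: open_preim_curve => //; exact: cdom_open.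
    by move=> u _; rewrite addrC /GRing.scale/= mulr1.
have df : differentiable (c \o gam) (u - s).
  by have /CkSP[dg _] := h2 c cu.1 1%N; apply: dg; split=> //; exact: cu.2.
have D : is_derive (u - s) 1 (c \o gam) ('D_1 (c \o gam) (u - s)).
  by apply: derivableP; exact: diff_derivable.
have := h3 _ c Ju cu; rewrite (derive1_is_derive D).
by rewrite (derive1_is_derive (is_derive_translate D)).
Qed.

Lemma itvccP a b t : a <= t <= b -> `[a, b]%classic t.
Proof. by rewrite /= in_itv. Qed.

(** Piecewise smoothness asks for one smooth curve on either side of each parameter, so
    concatenation creates at worst a break at the junction. *)
Lemma causally_precedes_trans p q x :
  causally_precedes p q -> causally_precedes q x -> causally_precedes p x.
Proof.
move=> [a [b [g [ab cg ga gb]]]] [a' [b' [g' [ab' cg' ga' gb']]]].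
pose s := b - a'; have sE : s = b - a' by [].
pose gam t := if t <= b then g t else g' (t - s).
have bs : b - s = a' by rewrite /s subKr.
have gamb t : b <= t -> gam t = g' (t - s).
  rewrite /gam le_eqVlt => /orP[/eqP <-|bt]; first by rewrite lexx bs ga' gb.
  by rewrite leNgt bt.
exists a, (b' + s), gam; split.
- lra.
- move=> t; rewrite /= in_itv/= => /andP[at_ tb].
  have sub (e e1 u : R) : e1 <= e -> ball u e1 `<=` ball u e.
    by move=> ee v; exact: le_ball.
  case: (ltgtP t b) => tb'.
  + have [|e e0 [al [be [ha hb E1 E2]]]] := cg t; first by rewrite /= in_itv/= at_ ltW.
    exists (Num.min e (b - t)); first by rewrite lt_min e0 subr_gt0.
    have ee : Num.min e (b - t) <= e by rewrite ge_min lexx.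
    have eb : Num.min e (b - t) <= b - t by rewrite ge_min lexx orbT.
    exists al, be; split.
    * exact: smooth_curve_in_sub (sub _ _ _ ee) ha.
    * exact: smooth_curve_in_sub (sub _ _ _ ee) hb.
    * move=> u; rewrite /= in_itv/= => /andP[au _] /andP[u1 u2].
      have ub : u <= b by lra.
      by rewrite /gam ub; apply: E1; [apply: itvccP|]; apply/andP; split; lra.
    * move=> u; rewrite /= in_itv/= => /andP[au _] /andP[u1 u2].
      have ub : u <= b by lra.
      by rewrite /gam ub; apply: E2; [apply: itvccP|]; apply/andP; split; lra.
  + have [|e e0 [al [be [ha hb E1 E2]]]] := cg' (t - s).
      by apply: itvccP; apply/andP; split; lra.
    exists (Num.min e (t - b)); first by rewrite lt_min e0 subr_gt0.
    have ee : Num.min e (t - b) <= e by rewrite ge_min lexx.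
    have eb : Num.min e (t - b) <= t - b by rewrite ge_min lexx orbT.
    exists (fun u => al (u - s)), (fun u => be (u - s)); split.
    * have := smooth_curve_in_shift s ha; rewrite subrK.
      exact: smooth_curve_in_sub (sub _ _ _ ee).
    * have := smooth_curve_in_shift s hb; rewrite subrK.
      exact: smooth_curve_in_sub (sub _ _ _ ee).
    * move=> u; rewrite /= in_itv/= => /andP[_ ub] /andP[u1 u2].
      have bu : b <= u by lra.
      rewrite gamb//; apply: E1; [apply: itvccP|]; apply/andP; split; lra.
    * move=> u; rewrite /= in_itv/= => /andP[_ ub] /andP[u1 u2].
      have bu : b <= u by lra.
      rewrite gamb//; apply: E2; [apply: itvccP|]; apply/andP; split; lra.
  (* At the junction the left branch is taken from the first curve and the right branch from the
     second. *)
  + have [|e e0 [al [_ [ha _ E1 _]]]] := cg b; first by rewrite /= in_itv/= lexx ltW.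
    have [|e' e0' [_ [be [_ hb _ E2]]]] := cg' a'; first by rewrite /= in_itv/= lexx ltW.
    exists (Num.min e e'); first by rewrite lt_min e0.
    have ee : Num.min e e' <= e by rewrite ge_min lexx.
    have ee' : Num.min e e' <= e' by rewrite ge_min lexx orbT.
    rewrite tb'; exists al, (fun u => be (u - s)); split.
    * exact: smooth_curve_in_sub (sub _ _ _ ee) ha.
    * have := smooth_curve_in_shift s hb; rewrite /s addrC subrK.
      exact: smooth_curve_in_sub (sub _ _ _ ee').
    * move=> u; rewrite /= in_itv/= => /andP[au _] /andP[u1 u2].
      by rewrite /gam u2; apply: E1; [apply: itvccP|]; apply/andP; split; lra.
    * move=> u; rewrite /= in_itv/= => /andP[_ ub] /andP[u1 u2].
      rewrite gamb//; apply: E2; [apply: itvccP|]; apply/andP; split; lra.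
- by rewrite /gam (ltW ab).
- by rewrite gamb ?addrK//; lra.
Qed.

Lemma smooth_curve_precedes a b (gam : R -> M) e : a < b -> 0 < e ->
  smooth_curve_in (@future_causal R n M) [set t | a - e < t < b + e] gam ->
  causally_precedes (gam a) (gam b).
Proof.
move=> ab e0 sg; exists a, b, gam; split=> // t; rewrite /= in_itv/= => /andP[at_ tb].
exists e => //; exists gam, gam; split=> //; apply: smooth_curve_in_sub sg => u;
  rewrite -ball_normE/= ltr_norml => /andP[? ?]; apply/andP; split; lra.
Qed.

(** Bootstrapping: the derivative of the curve in a chart is X evaluated along the curve, hence as
    regular as the curve itself. *)
Lemma curve_on_Ck (X : vector_field M) k a b (gam : R -> M) c : atlas c ->
  curve_on X a b gam ->
  Ck k ([set t | a < t < b] `&` gam @^-1` cdom c) (c \o gam).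
Proof.
move=> ac cg; set J := _ `&` _.
have oJ : open J.
  apply: open_preim_curve; [|exact: cdom_open|by move=> t /cg[]].
  by rewrite openE => t /near_itvoo.
have der t : J t -> is_derive t 1 (c \o gam) (X c (gam t)).
  by move=> [/cg[_ D] ct]; exact: D.
elim: k => [|k IH].
  by move=> t [/cg[cgt _] ct]; apply: continuous_comp => //; exact: cfun_cts.
have dif t : J t -> differentiable (c \o gam) t.
  by move=> /der[d _]; apply/derivable1_diffP.
split=> [t /dif//|v].
have : Ck k J (fun t => v *: ((X c \o cinv c) \o (c \o gam)) t).
  apply: Ck_scale => //; first exact: Ck_cst.
  apply: (Ck_comp (A := c @` cdom c)) => //.
  - exact: cimg_open.
  - by move=> t [_ ct]; exists (gam t).
  - exact: vcomp_smooth.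
apply: Ck_eq => // t Jt.
rewrite /= cfunK; last by case: Jt.
have [_ <-] := der _ Jt.
rewrite -(derive_dirZ (1 : R) v (dif _ Jt)); congr ('D__ _ _).
by rewrite /GRing.scale/= mulr1.
Qed.

Definition future_field (X : vector_field M) := forall c p, chart_at c p ->
  future_timelike c p (X c p).

Lemma curve_on_smooth_curve (X : vector_field M) a b (gam : R -> M) :
  future_field X -> curve_on X a b gam ->
  smooth_curve_in (@future_timelike R n M) [set t | a < t < b] gam.
Proof.
move=> fX cg; split.
- by move=> t /cg[].
- by move=> c ac k; exact: (curve_on_Ck k ac cg).
- move=> t c /cg[_ D] cp; rewrite (derive1_is_derive (D c cp)); exact: fX.
Qed.

Lemma smooth_curve_in_causal (J : set R) (gam : R -> M) :
  smooth_curve_in (@future_timelike R n M) J gam ->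
  smooth_curve_in (@future_causal R n M) J gam.
Proof.
move=> [h1 h2 h3]; split=> // t c Jt cp; exact/future_timelike_causal/h3.
Qed.

Lemma flow_precedes (X : vector_field M) s p q : future_field X -> 0 < s ->
  flow_rel X s p q -> causally_precedes p q.
Proof.
move=> fX s0 [a [b [g [/andP[a0 b0] /andP[as_ sb] cg <- <-]]]].
apply: (@smooth_curve_precedes _ _ _ (Num.min (- a) (b - s))) => //.
  by rewrite lt_min oppr_gt0 a0 subr_gt0.
have e1 : Num.min (- a) (b - s) <= - a by rewrite ge_min lexx.
have e2 : Num.min (- a) (b - s) <= b - s by rewrite ge_min lexx orbT.
apply: smooth_curve_in_sub (smooth_curve_in_causal (curve_on_smooth_curve fX cg)).
by move=> t /= /andP[? ?]; apply/andP; split; lra.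
Qed.

(** Both inequalities are open conditions on the point and the vector jointly, whence a common
    radius r. *)
Lemma cone_open c p v : chart_at c p -> future_timelike c p v ->
  exists2 r, 0 < r & forall y w : 'rV[R]_n.+1, `|y - c p| < r -> `|w - v| < r ->
    (c @` cdom c) y /\ future_timelike c (cinv c y) w.
Proof.
move=> [ac cp] [vv Tv]; set g := metric M; set T := torient M.
pose V := ('rV[R]_n.+1 * 'rV[R]_n.+1)%type.
pose U : set V := fst @^-1` (c @` cdom c).
have oU : open U.
  by apply: open_comp => [z _|]; [exact: cvg_fst|exact: cimg_open].
have C2 : Ck 0 U (snd : V -> 'rV[R]_n.+1) by move=> z _; exact: cvg_snd.
have Cg : Ck 0 U ((g c \o cinv c) \o fst : V -> 'M[R]_n.+1).
  move=> z Uz; apply: continuous_comp; first exact: cvg_fst.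
  exact: smooth_continuous (gcomp_smooth g ac) Uz.
have CT : Ck 0 U ((T c \o cinv c) \o fst : V -> 'rV[R]_n.+1).
  move=> z Uz; apply: continuous_comp; first exact: cvg_fst.
  exact: smooth_continuous (vcomp_smooth T ac) Uz.
have Cvv := Ck_entry 0 0 oU (Ck_mulmx oU (Ck_mulmx oU C2 Cg) (Ck_trmx oU C2)).
have CTv := Ck_entry 0 0 oU (Ck_mulmx oU (Ck_mulmx oU CT Cg) (Ck_trmx oU C2)).
have Uz0 : U (c p, v) by exists p.
have N1 : \forall z \near (c p, v), gdot g c (cinv c z.1) z.2 z.2 < 0.
  have := Cvv _ Uz0 => /cvgr_lt; apply; by rewrite /= cfunK.
have N2 : \forall z \near (c p, v), gdot g c (cinv c z.1) (T c (cinv c z.1)) z.2 < 0.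
  have := CTv _ Uz0 => /cvgr_lt; apply; by rewrite /= cfunK.
have N : \forall z \near (c p, v), U z /\ gdot g c (cinv c z.1) z.2 z.2 < 0 /\
    gdot g c (cinv c z.1) (T c (cinv c z.1)) z.2 < 0.
  exact: filterI (near_open oU Uz0) (filterI N1 N2).
have /nbhs_normP[r /= r0 Hr] := N.
exists r => // y w yr wr.
have : (ball_ Num.Def.normr (c p, v) r) (y, w).
  rewrite /ball_/= prod_normE/= gt_max.
  by rewrite distrC yr distrC wr.
by move=> /Hr[/= Uy [h1 h2]].
Qed.

(** A straight coordinate segment with velocity close to v is timelike as long as it stays near p.
    The parameter interval exceeds [0, e] on both sides because causal curves have to be smooth
    around their end parameters. *)
Lemma straight_precedes c p v r y0 w e : chart_at c p ->
  (forall y w : 'rV[R]_n.+1, `|y - c p| < r -> `|w - v| < r ->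
    (c @` cdom c) y /\ future_timelike c (cinv c y) w) ->
  0 < e -> `|w - v| < r ->
  (forall t, - e < t < 2 * e -> `|y0 + t *: w - c p| < r) ->
  causally_precedes (cinv c y0) (cinv c (y0 + e *: w)).
Proof.
move=> [ac cp] Hr e0 wr lr.
pose l t := y0 + t *: w.
have -> : cinv c y0 = (cinv c \o l) 0 by rewrite /l /= scale0r addr0.
rewrite -[cinv c (y0 + _)]/((cinv c \o l) e).
apply: (@smooth_curve_precedes _ _ _ e) => //.
set J := [set t | _].
have JE : J = [set t | - e < t < 2 * e].
  by apply/seteqP; split=> t /=; rewrite /J/= => /andP[? ?]; apply/andP; split; lra.
have Jl t : J t -> (c @` cdom c) (l t) /\ future_timelike c (cinv c (l t)) w.
  by rewrite JE => /lr lt; exact: Hr.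
have cl t : {for t, continuous l}.
  by apply: (is_derive_continuous (d := w)); exact: is_derive_affine.
have cg t : J t -> {for t, continuous (cinv c \o l)}.
  by move=> /Jl[lt _]; apply: continuous_comp => //; exact: cinv_cts.
have oJ : open J by rewrite openE => t /near_itvoo.
split=> // [d ad k|t d Jt dp].
  apply: (Ck_comp (A := c @` (cdom c `&` cdom d)) (f := l) (g := d \o cinv c)).
  - by apply: open_preim_curve => //; exact: cdom_open.
  - by apply: chart_img_open; exact: cdom_open.
  - move=> t [/Jl[[q cq ql] _]]; rewrite /= -ql cfunK// => dq.
    by exists q.
  - exact: Ck_affine.
  - exact: transition_smooth.
have [lt ft] := Jl t Jt; have [cq qE] := chart_img lt.
have cq' : chart_at c (cinv c (l t)) by split.
have D := is_derive_comp (is_derive_affine y0 w t) _.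
have dd : differentiable (d \o cinv c) (l t).
  by rewrite -qE; exact: transition_diff.
rewrite (derive1_is_derive (D _ _ dd)) (deriveEjacobian _ dd).
have := future_causal_change cq' dp (future_timelike_causal ft).
by rewrite /diff_mx qE.
Qed.

(** A single q has to precede a whole neighbourhood of p: step back from p by e v in a chart, then
    reach x by the straight segment of velocity v + (c x - c p) / e, which is close to v when x is
    close to p. *)
Lemma exists_past_point (X : vector_field M) p : future_field X ->
  exists q, \forall x \near p, causally_precedes q x.
Proof.
move=> fX; have [c ac cp] := atlas_cover p; have cpp : chart_at c p by split.
have [r r0 Hr] := cone_open cpp (fX c p cpp); set v := X c p in Hr.
(* For |t| <= 2 e the segment departs from [c p] by at most e |v| + 2 e (|v| + r), which this choice
   makes less than r. *)
pose e := r / (3 * `|v| + 2 * r + 1).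
have D0 : 0 < 3 * `|v| + 2 * r + 1 by rewrite ltr_wpDl// addr_ge0 ?mulr_ge0// ltW.
have e0 : 0 < e by rewrite divr_gt0.
have eE : e * (3 * `|v| + 2 * r + 1) = r by rewrite mulfVK ?gt_eqF.
have ev : 0 <= e * `|v| by rewrite mulr_ge0// ltW.
have er : 0 < e * r by rewrite mulr_gt0.
exists (cinv c (c p - e *: v)).
have N : \forall x \near p, cdom c x /\ `|c x - c p| < e * r.
  apply: filterI; first exact: near_open (cdom_open c) cp.
  have b : `|c p - c p| < e * r by rewrite subrr normr0.
  exact: (cfun_cts cp (near_norm_ball b)).
apply: filterS N => x [cx xr].
pose w := v + e^-1 *: (c x - c p).
have wv : `|w - v| < r.
  rewrite /w [v + _]addrC addrK normrZ gtr0_norm ?invr_gt0//.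
  by rewrite mulrC ltr_pdivrMr// mulrC.
have -> : x = cinv c (c p - e *: v + e *: w).
  by rewrite /w scalerDr scalerA mulfV ?gt_eqF// scale1r addrA subrK addrC subrK cfunK.
apply: (straight_precedes cpp Hr e0 wv) => t /andP[t1 t2].
have wn : `|w| <= `|v| + r.
  by rewrite -(subrK v w) addrC (le_trans (ler_normD _ _))// lerD2l ltW.
rewrite addrAC [c p - _]addrC addrK.
have nev : `|e *: v| = e * `|v| by rewrite normrZ gtr0_norm.
rewrite (le_lt_trans (ler_normD _ _))// normrN nev normrZ.
have t2' : `|t| <= 2 * e by rewrite ler_norml; apply/andP; split; lra.
have : `|t| * `|w| <= 2 * e * (`|v| + r) by apply: ler_pM.
by move: eE; lra.
Qed.

Lemma exists_future_point (X : vector_field M) p : future_field X ->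
  exists q, \forall x \near p, causally_precedes x q.
Proof.
move=> fX; have [c ac cp] := atlas_cover p; have cpp : chart_at c p by split.
have [r r0 Hr] := cone_open cpp (fX c p cpp); set v := X c p in Hr.
(* The segment now starts at [c x], so the initial offset is bounded by e r instead of e |v|; this
   choice again keeps it within r of [c p]. *)
pose e := r / (3 * `|v| + 4 * r + 1).
have D0 : 0 < 3 * `|v| + 4 * r + 1 by rewrite ltr_wpDl// addr_ge0 ?mulr_ge0// ltW.
have e0 : 0 < e by rewrite divr_gt0.
have eE : e * (3 * `|v| + 4 * r + 1) = r by rewrite mulfVK ?gt_eqF.
have ev : 0 <= e * `|v| by rewrite mulr_ge0// ltW.
have er : 0 < e * r by rewrite mulr_gt0.
exists (cinv c (c p + e *: v)).
have N : \forall x \near p, cdom c x /\ `|c x - c p| < e * r.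
  apply: filterI; first exact: near_open (cdom_open c) cp.
  have b : `|c p - c p| < e * r by rewrite subrr normr0.
  exact: (cfun_cts cp (near_norm_ball b)).
apply: filterS N => x [cx xr].
pose w := v - e^-1 *: (c x - c p).
have wv : `|w - v| < r.
  rewrite /w addrAC subrr add0r normrN normrZ gtr0_norm ?invr_gt0//.
  by rewrite mulrC ltr_pdivrMr// mulrC.
have -> : x = cinv c (c x) by rewrite cfunK.
have -> : c p + e *: v = c x + e *: w.
  rewrite /w scalerBr scalerA mulfV ?gt_eqF// scale1r.
  by apply/rowP => i; rewrite !mxE; ring.
apply: (straight_precedes cpp Hr e0 wv) => t /andP[t1 t2].
have wn : `|w| <= `|v| + r.
  by rewrite -(subrK v w) addrC (le_trans (ler_normD _ _))// lerD2l ltW.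
rewrite addrAC (le_lt_trans (ler_normD _ _))// normrZ.
have t2' : `|t| <= 2 * e by rewrite ler_norml; apply/andP; split; lra.
have : `|t| * `|w| <= 2 * e * (`|v| + r) by apply: ler_pM.
by move: eE; lra.
Qed.

End causal_curves.

(** * Separation of points in the quotient *)

Section hausdorff.
Context {R : realType} {n : nat} {M : spacetime R n}.
Variable X : vector_field M.
Implicit Types (a b t s e r : R) (p q x : M).

(** A common lifetime on a neighbourhood: an orbit that comes close to p cannot stop within the time
    e. *)
Lemma near_flow_dom p : exists2 e, 0 < e &
  \forall x \near p, forall h, `|h| < e -> flow_dom X h x.
Proof.
have [c ac cp] := atlas_cover p.
have [eps [r [Phi [fb H]]]] := local_flow X 0 (conj ac cp) openT I.
have e0 := fb_eps fb; exists eps => //.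
pose V := cdom c `&` [set x | `|c x - c p| < r].
have oV : open V by exact: (@open_chart_preimage _ _ _ c _ (open_norm_ball (c p) r)).
have Vp : V p by split=> //; rewrite /= subrr normr0 (fb_rad fb).
apply: filterS (near_open oV Vp) => x [cx xr] h he.
have [cv v0 _] := H x cx xr; exists (cinv c (Phi h (c x))); rewrite -{1}v0.
by apply: (curve_on_flow cv); rewrite ?oppr_lt0 ?e0// -ltr_norml.
Qed.

Hypothesis fX : future_field X.
Hypothesis hyp : globally_hyperbolic M.

Lemma flow_rel_closed s p' p : 0 <= s ->
  (forall V W : set M, nbhs p' V -> nbhs p W ->
    exists x y, [/\ V x, W y & flow_rel X s x y]) -> flow_rel X s p' p.
Proof.
move=> s0 H.
have [q' nq'] := exists_past_point p' fX.
have [q nq] := exists_future_point p fX.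
pose K := causal_future q' `&` causal_past q.
have cK : compact K by case: hyp => _; apply.
have clK : closed K := compact_closed (@manifold_hausdorff _ _ M) cK.
have dom u : 0 <= u <= s -> flow_dom X u p'.
  apply: (@real_induction _ (fun u => flow_dom X u p') 0 s).
  - by exists p'; exact: flow_rel0.
  - move=> t _ D; have [e e0 /nbhs_singleton He] := near_flow_dom (flow X t p').
    exists e => // w /andP[tw we] _.
    have : flow_dom X (w - t) (flow X t p').
      by apply: He; rewrite ger0_norm ?subr_ge0 1?ltW// ltrBlDl.
    move=> [y Fy]; exists y; have := flow_relD (flow_domP D) Fy.
    by rewrite addrC subrK.
  - move=> t /andP[t0 ts] Ht.
    (* The point at time w on the orbit of p' is a limit of points at time w on orbits from x to y,
       where q' precedes x and y precedes q; those points lie in the closed set K. *)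
    have inK w : 0 <= w < t -> K (flow X w p').
      move=> /andP[w0 wt]; apply: clK => O nO.
      have D : flow_dom X w p' by apply: Ht; rewrite w0.
      have N1 : \forall x \near p', O (flow X w x) := flow_continuous D nO.
      have N2 : \forall x \near p', flow_dom X w x := near_open (@flow_dom_open _ _ _ X w) D.
      have [x [y [[q'x [Ox Dx]] yq Fxy]]] := H _ _ (filterI nq' (filterI N1 N2)) nq.
      have Fm := flow_domP Dx.
      exists (flow X w x); split=> //; split; right.
        move: w0; rewrite le_eqVlt => /orP[/eqP w0|w0]; last first.
          exact: causally_precedes_trans q'x (flow_precedes fX w0 Fm).
        by rewrite -w0 (flowE (flow_rel0 X x)).
      have Fmy : flow_rel X (s - w) (flow X w x) y.
        by have := flow_relD (flow_relV Fm) Fxy; rewrite addrC.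
      apply: causally_precedes_trans (flow_precedes fX _ Fmy) yq.
      by rewrite subr_gt0 (lt_le_trans wt).
    pose F := (fun w => flow X w p') @ t^'-.
    have FK : F K.
      rewrite /F /=; near=> w; apply: inK; apply/andP; split.
        by near: w; exact: nbhs_left_ge.
      by near: w; exact: nbhs_left_lt.
    have [z [Kz cz]] := cK F _ FK.
    (* At some time within e of t the orbit is close to the cluster point z, where the lifetime is
       at least e; hence it continues up to t. *)
    have [e e0 He] := near_flow_dom z.
    have Fn : F [set y | exists2 w, 0 <= w < t & t - w < e /\ y = flow X w p'].
      rewrite /F /=; near=> w; exists w => //.
        apply/andP; split; first by near: w; exact: nbhs_left_ge.
        by near: w; exact: nbhs_left_lt.
      split=> //; rewrite ltrBlDl -ltrBlDr.
      by near: w; apply: nbhs_left_gt; rewrite gtrBl.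
    have [_ [[w wt [we ->]] Hw]] := cz _ _ Fn He.
    have D := Ht w wt; have [w0 wt'] := andP wt.
    have [|y Fy] := Hw (t - w); first by rewrite ger0_norm ?subr_ge0 1?ltW.
    by exists y; have := flow_relD (flow_domP D) Fy; rewrite addrC subrK.
have D : flow_dom X s p' by apply: dom; rewrite s0 lexx.
suff -> : p = flow X s p' by exact: flow_domP.
apply/esym/(@manifold_hausdorff _ _ M) => A B nA nB.
have N : \forall x \near p', A (flow X s x) := flow_continuous D nA.
have [x [y [Ax By /flowE E]]] := H _ _ N nB; exists y; split=> //.
by rewrite -E.
Unshelve. all: by end_near. Qed.

(** If two points cannot be separated, there are points related by the flow arbitrarily close to
    their representatives, which is the hypothesis of [flow_rel_closed]. Symmetry allows the time
    difference to be nonnegative. *)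
Lemma globalization_hausdorff : hausdorff_space (globalization X).
Proof.
suff sep t t' p p' : t' <= t ->
    cluster (nbhs (iota_map X t p)) (iota_map X t' p') ->
    iota_map X t p = iota_map X t' p'.
  move=> x y; have [t [p ->]] := iota_surj x; have [t' [p' ->]] := iota_surj y.
  have [tt'|/ltW tt'] := leP t' t; first exact: sep.
  move=> cl; apply/esym/sep => // A B nA nB.
  by have [z [Bz Az]] := cl _ _ nB nA; exists z.
move=> tt' cl; apply/iota_eq/flow_rel_closed; first by rewrite subr_ge0.
move=> V W nV nW.
have nV' : nbhs (iota_map X t p) (iota_map X t @` V).
  by apply/iota_near; apply: filterS nV => x Vx; exists x.
have nW' : nbhs (iota_map X t' p') (iota_map X t' @` W).
  by apply/iota_near; apply: filterS nW => x Wx; exists x.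
have [_ [[x Vx <-] [y Wy E]]] := cl _ _ nV' nW'.
by exists x, y; split=> //; apply/iota_eq.
Qed.

End hausdorff.

(** * Conformal rescaling *)

Section scalar_derivatives.
Context {R : realType}.

Lemma is_derive_entry m n (e : R -> 'M[R]_(m, n)) (t : R) (d' : 'M[R]_(m, n)) i j :
  is_derive t 1 e d' -> is_derive t 1 (fun s => e s i j) (d' i j).
Proof.
move=> [de <-]; apply: DeriveDef; first by have /derivable_mxP := de; apply.
by rewrite derive_mx// mxE.
Qed.

Lemma is_derive_oppr (f : R -> R) (t d' : R) : is_derive t 1 f d' ->
  is_derive t 1 (fun s => - f s) (- d').
Proof. by move=> D; exact: is_deriveN. Qed.

Lemma is_derive_scalar_unique (f : R -> R) (t d1 d2 : R) :
  is_derive t 1 f d1 -> is_derive t 1 f d2 -> d1 = d2.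
Proof. by move=> [_ <-] [_ <-]. Qed.

End scalar_derivatives.

(** * Normalising a conformal Killing field to unit length *)

Section rescaling.
Context {R : realType} {n : nat} {M : manifold R n}.
Variables (g : lorentz_metric M) (X : vector_field M).
Hypothesis tX : timelike_field g X.
Implicit Types (p q : M) (c d : chart R n M) (u v w : 'rV[R]_n.+1).

Lemma smooth_gdot (Y Z : vector_field M) c k : atlas c ->
  Ck k (c @` cdom c) (fun z => gdot g c (cinv c z) (Y c (cinv c z)) (Z c (cinv c z))).
Proof.
move=> ac; have oU := @cimg_open _ _ _ c.
apply: (Ck_entry 0 0 oU).
apply: (Ck_mulmx oU); last exact: (Ck_trmx oU (vcomp_smooth Z ac k)).
exact: (Ck_mulmx oU (vcomp_smooth Y ac k) (gcomp_smooth g ac k)).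
Qed.

Definition some_chart p : chart R n M := projT1 (cid2 (atlas_cover p)).

Lemma some_chart_at p : chart_at (some_chart p) p.
Proof. by rewrite /some_chart; case: cid2. Qed.

(** The function -g(X, X), computed in a chosen chart; [sqspeedE] shows that any chart gives the
    same value. *)
Definition sqspeed p := - gdot g (some_chart p) p (X (some_chart p) p) (X (some_chart p) p).

Lemma sqspeedE c p : chart_at c p -> sqspeed p = - gdot g c p (X c p) (X c p).
Proof.
move=> cp; have dp := some_chart_at p.
by rewrite /sqspeed (vcomp_change X cp dp) gdot_change.
Qed.

Lemma sqspeed_gt0 p : 0 < sqspeed p.
Proof. by rewrite oppr_gt0; apply: tX; exact: some_chart_at. Qed.

Lemma sqspeed_smooth : smooth_fun sqspeed.
Proof.
move=> c ac k; have oU := @cimg_open _ _ _ c.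
have : Ck k (c @` cdom c) (fun z => -1 *
    gdot g c (cinv c z) (X c (cinv c z)) (X c (cinv c z))).
  by apply: CkM => //; [exact: Ck_cst|exact: smooth_gdot].
apply: Ck_eq => // _ [p cp <-]; rewrite mulN1r /= cfunK// (@sqspeedE c)//.
Qed.

Definition unit_gcomp c p := (sqspeed p)^-1 *: g c p.

Lemma unit_gcomp_smooth c : atlas c ->
  smooth (c @` cdom c) (unit_gcomp c \o cinv c).
Proof.
move=> ac k; apply: Ck_scale; first exact: cimg_open.
  apply: Ck_inv; first exact: cimg_open.
    by move=> z _; rewrite gt_eqF// sqspeed_gt0.
  exact: sqspeed_smooth.
exact: gcomp_smooth.
Qed.

Lemma unit_gcomp_change c d p : chart_at c p -> chart_at d p ->
  unit_gcomp c p = diff_mx id c d p *m unit_gcomp d p *m (diff_mx id c d p)^T.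
Proof.
move=> cp dp; rewrite /unit_gcomp (gcomp_change g cp dp).
by rewrite -scalemxAr -scalemxAl.
Qed.

Lemma unit_gcomp_lorentz c p : chart_at c p -> lorentz_signature (unit_gcomp c p).
Proof.
move=> cp; have [P uP EP] := gcomp_lorentz g cp.
have s0 := sqspeed_gt0 p.
(* Dividing g by its conformal factor is compensated by multiplying the orthonormal basis by the
   square root of that factor. *)
exists (Num.sqrt (sqspeed p) *: P).
  by rewrite unitmxZ// unitfE gt_eqF// sqrtr_gt0.
have -> : (Num.sqrt (sqspeed p) *: P)^T = Num.sqrt (sqspeed p) *: P^T.
  by apply/matrixP => i j; rewrite !mxE.
rewrite /unit_gcomp -!(scalemxAl, scalemxAr) -EP !scalerA.
have s2 : Num.sqrt (sqspeed p) * Num.sqrt (sqspeed p) = sqspeed p.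
  by rewrite -expr2 sqr_sqrtr ?ltW.
transitivity ((1 : R) *: (P *m g c p *m P^T)); last exact: scale1r.
congr (_ *: _); transitivity (sqspeed p / sqspeed p).
  by congr (_ / _); exact: s2.
by rewrite mulfV ?gt_eqF.
Qed.

Definition unit_metric : lorentz_metric M :=
  LorentzMetric unit_gcomp_smooth unit_gcomp_change unit_gcomp_lorentz.

Lemma unit_gdot c p u v :
  gdot unit_metric c p u v = (sqspeed p)^-1 * gdot g c p u v.
Proof. by rewrite /gdot /= /unit_gcomp -scalemxAr -scalemxAl mxE. Qed.

Lemma unit_metric_norm c p : chart_at c p -> gdot unit_metric c p (X c p) (X c p) = -1.
Proof.
move=> cp; rewrite unit_gdot (sqspeedE cp) invrN mulNr mulVf//.
by rewrite lt_eqF// tX.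
Qed.

Variable sigma : M -> R.
Hypothesis kX : forall c p, chart_at c p ->
  lie_metric g X c p = (2 * sigma p) *: g c p.

(** Contract L_X g = 2 sigma g twice with X: since [X, X] = 0, the left-hand side becomes the
    derivative of g(X, X) along X. It is computed along the coordinate line through [c p] with
    velocity X. *)
Lemma sqspeed_derive c p : chart_at c p ->
  'D_(X c p) (sqspeed \o cinv c) (c p) = 2 * sigma p * sqspeed p.
Proof.
move=> cp; set v := X c p.
have Ux : (c @` cdom c) (c p) by case: cp => _ ?; exists p.
pose l (t : R) := c p + t *: v.
have l0 : l 0 = c p by rewrite /l scale0r addr0.
have Dl : is_derive (0 : R) 1 l v by exact: is_derive_affine.
have dX : differentiable (X c \o cinv c) (l 0).
  by rewrite l0; exact: smooth_differentiable (vcomp_smooth X cp.1) Ux.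
have dG : differentiable (g c \o cinv c) (l 0).
  by rewrite l0; exact: smooth_differentiable (gcomp_smooth g cp.1) Ux.
have dS : differentiable (sqspeed \o cinv c) (l 0).
  by rewrite l0; exact: smooth_differentiable (sqspeed_smooth cp.1) Ux.
have DX := is_derive_comp Dl dX; have DG := is_derive_comp Dl dG.
have := is_derive_entry 0 0 (is_derive_mulmx (is_derive_mulmx DX DG) (is_derive_trmx DX)).
move=> /is_derive_oppr; rewrite /= l0 (cfunK cp.2) -/v (deriveEjacobian _ _); last first.
  by rewrite -l0.
move=> D.
have DS : is_derive (0 : R) 1 ((sqspeed \o cinv c) \o l) ('D_v (sqspeed \o cinv c) (c p)).
  by rewrite -l0; exact: is_derive_comp.
have N : \forall t \near (0 : R), - ((X c \o cinv c) (l t) *m (g c \o cinv c) (l t) *m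
    ((X c \o cinv c) (l t))^T) 0 0 = ((sqspeed \o cinv c) \o l) t.
  have : {for (0 : R), continuous l} by exact: is_derive_continuous Dl.
  move=> cl; have h : \forall t \near (0 : R), (c @` cdom c) (l t).
    by apply: cl; rewrite l0; exact: near_open (@cimg_open _ _ _ c) Ux.
  apply: filterS h => t /chart_img[ct _].
  by rewrite /= (@sqspeedE c)//; split=> //; exact: cp.1.
have -> := is_derive_scalar_unique DS (near_eq_is_derive N D).
have := kX cp; rewrite /lie_metric -/v; set J := jacobian _ _ => K.
rewrite (sqspeedE cp) /gdot -/v mulrN; congr (- _).
have := congr1 (fun A => (v *m A *m v^T) 0 0) K.
rewrite -(scalemxAr _ v (g c p)) -scalemxAl => E.
have -> : 2 * sigma p * (v *m g c p *m v^T) 0 0 =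
    ((2 * sigma p) *: (v *m g c p *m v^T)) 0 0 by rewrite [RHS]mxE.
rewrite -E.
congr (fun_of_matrix _ 0 0); rewrite trmx_mul !mulmxA -mulmxDl; congr (_ *m _).
by rewrite !mulmxDr !mulmxA [v *m J *m _ + _]addrC.
Qed.

(** Let s = -g(X, X), so that X(s) = 2 sigma s. The product rule for g as s times g/s gives 2 sigma
    g = 2 sigma g + s L_X(g/s). *)
Lemma unit_metric_killing c p : chart_at c p -> lie_metric unit_metric X c p = 0.
Proof.
move=> cp; set v := X c p.
have Ux : (c @` cdom c) (c p) by case: cp => _ ?; exists p.
pose l (t : R) := c p + t *: v.
have l0 : l 0 = c p by rewrite /l scale0r addr0.
have Dl : is_derive (0 : R) 1 l v by exact: is_derive_affine.
have dG : differentiable (g c \o cinv c) (c p).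
  exact: smooth_differentiable (gcomp_smooth g cp.1) Ux.
have dG' : differentiable (unit_metric c \o cinv c) (c p).
  exact: smooth_differentiable (gcomp_smooth unit_metric cp.1) Ux.
have dS : differentiable (sqspeed \o cinv c) (c p).
  exact: smooth_differentiable (sqspeed_smooth cp.1) Ux.
have comp (W : normedModType R) (h : 'rV[R]_n.+1 -> W) : differentiable h (c p) ->
    is_derive (0 : R) 1 (h \o l) ('D_v h (c p)).
  by move=> dh; rewrite -l0; apply: is_derive_comp => //; rewrite l0.
have DG := comp _ _ dG; have DG' := comp _ _ dG'; have DS := comp _ _ dS.
have E q : g c q = sqspeed q *: unit_metric c q.
  by rewrite /= /unit_gcomp scalerA mulfV ?scale1r// gt_eqF// sqspeed_gt0.
have DGE : 'D_v (g c \o cinv c) (c p) = (2 * sigma p * sqspeed p) *: unit_metric c p +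
    sqspeed p *: 'D_v (unit_metric c \o cinv c) (c p).
  apply/matrixP => i j; rewrite !mxE.
  apply: is_derive_scalar_unique (is_derive_entry i j DG) _.
  have D := is_deriveM DS (is_derive_entry i j DG').
  have -> : (fun s => g c (cinv c (l s)) i j) =
      (sqspeed \o cinv c \o l) * (fun s => unit_metric c (cinv c (l s)) i j).
    by apply/funext => s; rewrite E mxE.
  apply: (is_derive_eq D).
  rewrite sqspeed_derive// /= l0 (cfunK cp.2) mxE addrC; congr (_ + _).
  by rewrite /GRing.scale/= mulrC.
have := kX cp; rewrite /lie_metric -/v; set J := jacobian _ _ => K.
have s0 : sqspeed p != 0 by rewrite gt_eqF// sqspeed_gt0.
apply: (scalerI s0); rewrite scaler0; move: K.
rewrite DGE (E p).
move: (unit_metric c p) ('D_v (unit_metric c \o _) _) => G' D'.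
rewrite -!addrA scalerA => /eqP; rewrite -subr_eq0 addrAC subrr add0r => /eqP <-.
by rewrite !scalerDr (scalemxAr _ J) (scalemxAl _ _ J^T).
Qed.

End rescaling.

(** * Bilinear forms of Lorentzian signature *)

Section lorentz_forms.
Context {R : realType} {n : nat}.
Implicit Types (G : 'M[R]_n.+1) (u v w : 'rV[R]_n.+1).

Lemma lorentz_sym G : lorentz_signature G -> G^T = G.
Proof.
move=> [P uP E]; have E' : P *m G^T *m P^T = P *m G *m P^T.
  rewrite [RHS]E -[RHS]tr_diag_mx -E !trmx_mul trmxK !mulmxA.
  by [].
apply: (mx_congr_inj (mulVmx uP)).
exact: E'.
Qed.

(** The kernel of the covector a is the span of the spacelike vectors of an orthonormal basis; it
    contains no timelike vector. *)
Lemma lorentz_hyperplane G : lorentz_signature G -> exists a : 'cV[R]_n.+1,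
  forall w, (w *m a) 0 0 = 0 -> 0 <= (w *m G *m w^T) 0 0.
Proof.
move=> [P uP E]; exists (col ord0 (invmx P)) => w.
have -> : w *m G *m w^T = (w *m invmx P) *m (P *m G *m P^T) *m (w *m invmx P)^T.
  rewrite trmx_mul !mulmxA mulmxKV// -(mulmxA (w *m G)) -trmx_mul mulVmx//.
  by rewrite trmx1 mulmx1.
have -> : (w *m col ord0 (invmx P)) 0 0 = (w *m invmx P) 0 ord0.
  by rewrite !mxE; apply: eq_bigr => j _; rewrite mxE.
rewrite E; move: (w *m invmx P) => z z0; rewrite mxE.
apply: sumr_ge0 => i _; rewrite mul_mx_diag !mxE.
case: eqP => [->|_]; first by rewrite z0 !mul0r.
by rewrite mulr1 -expr2 sqr_ge0.
Qed.

End lorentz_forms.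

Lemma jacobianN {R : realType} m n (f : 'rV[R]_m -> 'rV[R]_n) x :
  differentiable f x -> jacobian (- f) x = - jacobian f x.
Proof.
move=> df; have dNf : differentiable (- f) x by exact: differentiableN.
apply/row_matrixP => i; rewrite !rowE mulmxN.
transitivity ('D_(delta_mx 0 i) (- f) x); first exact/esym/deriveEjacobian.
transitivity (- 'D_(delta_mx 0 i) f x).
  by apply: deriveN; exact: diff_derivable.
congr (- _); exact: deriveEjacobian.
Qed.

(** * Time orientation and the opposite field *)

Section orientation.
Context {R : realType} {n : nat} {M : manifold R n}.
Variable g : lorentz_metric M.
Implicit Types (p q : M) (c d : chart R n M) (u v w : 'rV[R]_n.+1).

Lemma gdot_sym c p u v : chart_at c p -> gdot g c p u v = gdot g c p v u.
Proof.
move=> cp; rewrite /gdot -{1}(lorentz_sym (gcomp_lorentz g cp)).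
transitivity ((u *m (g c p)^T *m v^T)^T 0 0); first by rewrite [RHS]mxE.
by rewrite !trmx_mul !trmxK mulmxA.
Qed.

Lemma gdot_comb c p (a b : R) u v : chart_at c p ->
  gdot g c p (a *: u + b *: v) (a *: u + b *: v) =
  a ^+ 2 * gdot g c p u u + 2 * a * b * gdot g c p u v + b ^+ 2 * gdot g c p v v.
Proof.
move=> cp; have := gdot_sym u v cp; rewrite /gdot => S.
have E z : (a *: u + b *: v) *m g c p *m z^T =
    a *: (u *m g c p *m z^T) + b *: (v *m g c p *m z^T).
  by rewrite !mulmxDl -!scalemxAl.
have E' z : z *m g c p *m (a *: u + b *: v)^T =
    a *: (z *m g c p *m u^T) + b *: (z *m g c p *m v^T).
  have -> : (a *: u + b *: v)^T = a *: u^T + b *: v^T.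
    by apply/matrixP => i j; rewrite !mxE.
  by rewrite !mulmxDr -!scalemxAr.
rewrite E !E'; move: S.
set uu := u *m _ *m u^T; set uv := u *m _ *m v^T; set vu := v *m _ *m u^T.
set vv := v *m _ *m v^T; move: uu uv vu vv => uu uv vu vv S.
by rewrite !mxE -S; ring.
Qed.

(** Let l be the covector of [lorentz_hyperplane]. If u and v were orthogonal, l(v) u - l(u) v would
    lie in the kernel of l and yet have a negative square. *)
Lemma gdot_timelike_neq0 c p u v : chart_at c p ->
  gdot g c p u u < 0 -> gdot g c p v v < 0 -> gdot g c p u v != 0.
Proof.
move=> cp uu vv; apply/eqP => uv0.
have [a Ha] := lorentz_hyperplane (gcomp_lorentz g cp).
pose l w := (w *m a) 0 0.
have lu : l u != 0 by apply/eqP => /Ha; rewrite leNgt => /negP; apply.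
have := Ha (l v *: u + (- l u) *: v).
rewrite -[(_ *m g c p *m _) 0 0]/(gdot g c p (_ + _) (_ + _)) gdot_comb// uv0 mulr0 addr0.
rewrite mulmxDl -!scalemxAl => H; have : 0 <= l v ^+ 2 * gdot g c p u u + (- l u) ^+ 2 * gdot g c p v v.
  by apply: H; rewrite !mxE /l !mxE; ring.
apply/negP; rewrite -ltNge sqrrN.
have h1 : l v ^+ 2 * gdot g c p u u <= 0 by rewrite mulr_ge0_le0 ?sqr_ge0// ltW.
have h2 : l u ^+ 2 * gdot g c p v v < 0 by rewrite pmulr_rlt0// exprn_even_gt0.
lra.
Qed.

(** The function g(T, X) is continuous and has no zero, hence a constant sign on the connected M. *)
Lemma timelike_fields_sign (T X : vector_field M) : connected [set: M] ->
  timelike_field g T -> timelike_field g X ->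
  (forall c p, chart_at c p -> gdot g c p (T c p) (X c p) < 0) \/
  (forall c p, chart_at c p -> 0 < gdot g c p (T c p) (X c p)).
Proof.
move=> cM tT tX.
pose F p := gdot g (some_chart p) p (T (some_chart p) p) (X (some_chart p) p).
have FE c p : chart_at c p -> F p = gdot g c p (T c p) (X c p).
  move=> cp; have dp := some_chart_at p.
  by rewrite /F (vcomp_change T cp dp) (vcomp_change X cp dp) gdot_change.
have F0 p : F p != 0.
  by have cp := some_chart_at p; apply: gdot_timelike_neq0; [|exact: tT|exact: tX].
have cF : continuous F.
  move=> p; have cp := some_chart_at p; set c := some_chart p in cp.
  have Ux : (c @` cdom c) (c p) by exists p => //; case: cp.
  have C := smooth_gdot g T X 0%N cp.1 _ Ux.
  have C' : {for p, continuous ((fun z => gdot g c (cinv c z) (T c (cinv c z))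
      (X c (cinv c z))) \o c)}.
    by apply: continuous_comp => //; apply: cfun_cts; case: cp.
  have N : \forall q \near p, ((fun z => gdot g c (cinv c z) (T c (cinv c z))
      (X c (cinv c z))) \o c) q = F q.
    apply: filterS (near_open (@cdom_open _ _ _ c) cp.2) => q cq.
    by rewrite /= cfunK// (@FE c)//; split=> //; exact: cp.1.
  rewrite /continuous_at -(nbhs_singleton N).
  by apply: cvg_trans C'; apply: near_eq_cvg; exact: N.
have oL : open (F @^-1` [set x | x < 0]) by apply: open_comp => //; exact: lt_open.
have oG : open (F @^-1` [set x | 0 < x]) by apply: open_comp => //; exact: gt_open.
have [[p Fp]|N] := pselect (exists p, F p < 0); last first.
  right=> c p cp; rewrite -FE// lt_neqAle eq_sym F0 leNgt.
  by apply/negP => Fp; apply: N; exists p.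
left=> c q cq; rewrite -FE//.
suff E : F @^-1` [set x | x < 0] = [set: M].
  by have : [set: M] q by []; rewrite -E.
apply: cM; first by exists p.
  by exists (F @^-1` [set x | x < 0]); rewrite ?setTI.
exists (~` (F @^-1` [set x | 0 < x])); first exact: open_closedC.
rewrite setTI; apply/seteqP; split=> x /= Fx.
  by apply/negP; rewrite -leNgt ltW.
by rewrite lt_neqAle F0 leNgt; apply/negP.
Qed.

Variable X : vector_field M.

Lemma oppr_vcomp_smooth c : atlas c ->
  smooth (c @` cdom c) ((fun p => - X c p) \o cinv c).
Proof.
move=> ac k; have := vcomp_smooth X ac k => /(Ck_scale (@cimg_open _ _ _ c) (Ck_cst k _ (-1 : R))).
by apply: Ck_eq; [exact: cimg_open|move=> z _; rewrite /= scaleN1r].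
Qed.

Lemma oppr_vcomp_change c d p : chart_at c p -> chart_at d p ->
  - X d p = - X c p *m diff_mx id c d p.
Proof. by move=> cp dp; rewrite mulNmx (vcomp_change X cp dp). Qed.

Definition opp_field : vector_field M :=
  VectorField oppr_vcomp_smooth oppr_vcomp_change.

Lemma opp_lie_metric c p : chart_at c p ->
  lie_metric g opp_field c p = - lie_metric g X c p.
Proof.
move=> [ac cp]; have Ux : (c @` cdom c) (c p) by exists p.
have dG := smooth_differentiable (gcomp_smooth g ac) Ux.
have dX := smooth_differentiable (vcomp_smooth X ac) Ux.
have dY := smooth_differentiable (vcomp_smooth opp_field ac) Ux.
have JE : jacobian (opp_field c \o cinv c) (c p) = - jacobian (X c \o cinv c) (c p).
  exact: jacobianN.
rewrite /lie_metric JE.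
have -> : opp_field c p = (-1 : R) *: X c p by rewrite scaleN1r.
rewrite derive_dirZ// scaleN1r mulNmx linearN mulmxN.
by rewrite -!opprD.
Qed.

Lemma opp_complete : complete_field X -> complete_field opp_field.
Proof.
move=> cX p; have [gam [cg dg] g0] := cX p.
exists (fun t => gam (- t)); last by rewrite oppr0.
split=> [t|t c cp].
  by apply: (@continuous_comp _ _ _ (fun t : R => - t) gam); [exact: opp_continuous|exact: cg].
have := is_derive_reflect (dg (- t) c cp); exact.
Qed.

Lemma opp_gdot c p : gdot g c p (opp_field c p) (opp_field c p) = gdot g c p (X c p) (X c p).
Proof.
rewrite /gdot /= !mulNmx; have -> : (- X c p)^T = - (X c p)^T by rewrite linearN.
by rewrite mulmxN opprK.
Qed.

End orientation.

Lemma diff_mx_unit {R : realType} {n : nat} (M : manifold R n)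
    (c d : chart R n M) (p : M) : chart_at c p -> chart_at d p ->
  diff_mx id c d p \in unitmx.
Proof.
move=> cp dp; have := diff_mxV cp dp.
by move: (diff_mx id c d p) (diff_mx id d c p) => A B /mulmx1_unit[].
Qed.

(** * The enlarged spacetime *)

Section hull.
Context {R : realType} {n : nat} {M : spacetime R n}.
Variables (X : vector_field M) (sigma : M -> R).
Hypotheses (gh : globally_hyperbolic M) (fX : future_field X).
Hypothesis kX : forall c p, chart_at c p ->
  lie_metric (metric M) X c p = (2 * sigma p) *: metric M c p.
Implicit Types (t : R) (p q : M) (c : chart R n M) (u v w : 'rV[R]_n.+1).

Lemma future_field_timelike : timelike_field (metric M) X.
Proof. by move=> c p /fX[]. Qed.

Let tX := future_field_timelike.
Let gX := unit_metric tX.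
Let kgX := unit_metric_killing tX kX.

Definition hull_manifold := glob_manifold (globalization_hausdorff fX gh).
Implicit Types (d : chart R n hull_manifold).

Definition hull_field : vector_field hull_manifold :=
  glob_field (globalization_hausdorff fX gh).

Definition hull_metric : lorentz_metric hull_manifold :=
  glob_metric (globalization_hausdorff fX gh) kgX.

Definition hull_map t : M -> hull_manifold := iota_map X t.

Lemma hull_surj (x : hull_manifold) : exists t p, x = hull_map t p.
Proof. exact: iota_surj. Qed.

Lemma hull_pull_at d t p : chart_at d (hull_map t p) ->
  chart_at (pull_chart t d) p.
Proof. exact: pull_chart_at. Qed.

Lemma hull_fieldE d t p : chart_at d (hull_map t p) ->
  hull_field d (hull_map t p) = X (pull_chart t d) p.
Proof. exact: glob_vcompE. Qed.

Lemma hull_metricE d t p : chart_at d (hull_map t p) ->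
  hull_metric d (hull_map t p) = gX (pull_chart t d) p.
Proof. exact: glob_gcompE. Qed.

Lemma hull_gdot d t p u v : chart_at d (hull_map t p) ->
  gdot hull_metric d (hull_map t p) u v =
  (sqspeed (metric M) X p)^-1 * gdot (metric M) (pull_chart t d) p u v.
Proof. by move=> dp; rewrite -(unit_gdot tX) /gdot hull_metricE. Qed.

Lemma hull_norm d x : chart_at d x ->
  gdot hull_metric d x (hull_field d x) (hull_field d x) = -1.
Proof.
have [t [p ->]] := hull_surj x => dp.
rewrite hull_fieldE// hull_gdot// -(unit_gdot tX).
by apply: unit_metric_norm; exact: hull_pull_at.
Qed.

Lemma hull_timelike : timelike_field hull_metric hull_field.
Proof. by move=> d x dx; rewrite hull_norm// ltrN10. Qed.

(** The unit Killing field is itself the time orientation; this is why the study of slices below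
    speaks of the flow of [torient]. *)
Definition hull : spacetime R n :=
  Spacetime (@glob_connected _ _ _ _ (globalization_hausdorff fX gh) (@st_connected _ _ M))
    hull_timelike.

Lemma hull_killing d (x : hull) : chart_at d x ->
  lie_metric (metric hull) hull_field d x = 0.
Proof. exact: glob_lie_metric. Qed.

Lemma hull_complete : complete_field hull_field.
Proof. exact: glob_complete. Qed.

Lemma hull_timelike_killing : @timelike_killing _ _ hull hull_field.
Proof.
split; first exact: hull_timelike.
split=> [d ad k|d x dx]; first exact: Ck_cst.
by rewrite mulr0 scale0r; exact: hull_killing.
Qed.

Lemma hull_smooth_map t : smooth_map (hull_map t).
Proof.
split=> [|c d ac ad]; first exact: iota_continuous.
exact: (transition_smooth ac (ad t)).
Qed.

(** The embedding read in the charts c and d is the transition map from c to [pull_chart t d]. The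
    conformal and pushforward properties are therefore change-of-chart formulas in M. *)
Lemma hull_diff_mx t c d p :
  diff_mx (hull_map t) c d p = diff_mx id c (pull_chart t d) p.
Proof. by []. Qed.

Lemma hull_extends t : extends_pushforward (hull_map t) X hull_field.
Proof.
move=> c d p cp dp; rewrite hull_diff_mx hull_fieldE//.
by apply: vcomp_change => //; exact: hull_pull_at.
Qed.

Lemma hull_embedding t : smooth_embedding (hull_map t).
Proof.
split; [exact: hull_smooth_map| |exact: iota_inj|].
  move=> c d p cp dp; rewrite hull_diff_mx row_free_unit.
  exact: diff_mx_unit cp (hull_pull_at dp).
move=> U oU; exists (hull_map t @` U); first exact: iota_open.
by apply/seteqP; split=> [x Ux|x [Ux _]]; [split=> //; case: Ux => p _ <-; exists p|].
Qed.

Lemma hull_conformal t : @open_conformal_embedding _ _ M hull (hull_map t).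
Proof.
split; [exact: hull_embedding|exact: iota_range_open|].
(* The square of this factor is the ratio of the unit metric to g. *)
exists (fun p => Num.sqrt (sqspeed (metric M) X p)^-1).
have s0 p := sqspeed_gt0 tX p.
split=> [c ac k|p|c d p cp dp].
- apply: Ck_sqrt; first exact: cimg_open.
    by move=> z _; rewrite invr_gt0.
  apply: Ck_inv; first exact: cimg_open.
    by move=> z _; rewrite gt_eqF.
  exact: sqspeed_smooth.
- by rewrite sqrtr_gt0 invr_gt0.
- rewrite sqr_sqrtr ?invr_ge0 ?ltW// hull_diff_mx.
  have -> : metric hull d (hull_map t p) = gX (pull_chart t d) p by exact: hull_metricE.
  by apply/esym; apply: (gcomp_change gX) => //; exact: hull_pull_at.
Qed.

End hull.

(* The time orientation plays no role in the first assertion, so a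
   past-directed field may be replaced by its opposite. *)
Lemma future_or_opposite {R : realType} {n : nat} (M : spacetime R n)
    (X : vector_field M) : timelike_conformal_killing X ->
  exists (X' : vector_field M) (sigma : M -> R),
    [/\ future_field X',
        forall c p, chart_at c p ->
          lie_metric (metric M) X' c p = (2 * sigma p) *: metric M c p &
        X' = X \/ X' = opp_field X].
Proof.
move=> [tX [sigma [_ kX]]].
have [H|H] := timelike_fields_sign (@st_connected _ _ M) (@torient_timelike _ _ M) tX.
  by exists X, sigma; split=> //; [move=> c p cp; split; [exact: tX|exact: H]|left].
exists (opp_field X), (fun p => - sigma p); split; last by right.
  move=> c p cp; split; first by rewrite opp_gdot; exact: tX.
  rewrite /gdot /= (_ : (- X c p)^T = - (X c p)^T); last by rewrite linearN.
  by rewrite mulmxN mxE oppr_lt0; exact: H.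
by move=> c p cp; rewrite opp_lie_metric// kX// mulrN scaleNr.
Qed.

Section opposite.
Context {R : realType} {n : nat} {M N : spacetime R n}.
Variables (phi : M -> N) (X : vector_field M) (Y : vector_field N).

Lemma opp_extends : extends_pushforward phi (opp_field X) Y ->
  extends_pushforward phi X (opp_field Y).
Proof.
move=> H c d p cp dp.
by have /= -> := H c d p cp dp; rewrite mulNmx opprK.
Qed.

Lemma opp_timelike_killing : timelike_killing Y -> timelike_killing (opp_field Y).
Proof.
move=> [tY [s0 kY]]; split=> [d q dq|]; first by rewrite opp_gdot; exact: tY.
split; [exact: s0|move=> d q dq]; have := kY d q dq.
by rewrite (opp_lie_metric _ _ dq) mulr0 !scale0r => ->; rewrite oppr0.
Qed.

End opposite.

(** * Cauchy hypersurfaces *)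

Section scalar_monotonicity.
Context {R : realType}.
Implicit Types (a b t : R) (h : R -> R).

Lemma scalar_mean_value (h h' : R -> R) a b : a < b ->
  (forall t, a <= t <= b -> is_derive t 1 h (h' t)) ->
  exists2 t, a <= t <= b & h b - h a = h' t * (b - a).
Proof.
move=> ab dh.
have D t : t \in `]a, b[ -> is_derive t 1 h (h' t).
  by rewrite in_itv/= => /andP[/ltW ? /ltW ?]; apply/dh/andP.
have C : {within `[a, b], continuous h}.
  apply: derivable_within_continuous => t; rewrite in_itv/= => tab.
  by have [] := dh _ tab.
by have [t tab E] := MVT_segment (ltW ab) D C; exists t; first by rewrite in_itv in tab.
Qed.

Lemma derive_gt0_lt (h h' : R -> R) a b : a < b ->
  (forall t, a <= t <= b -> is_derive t 1 h (h' t)) ->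
  (forall t, a <= t <= b -> 0 < h' t) -> h a < h b.
Proof.
move=> ab dh h0; have [t tab E] := scalar_mean_value ab dh.
by rewrite -subr_gt0 E mulr_gt0 ?h0// subr_gt0.
Qed.

Lemma derive_ge0_le (h h' : R -> R) a b : a < b ->
  (forall t, a <= t <= b -> is_derive t 1 h (h' t)) ->
  (forall t, a <= t <= b -> 0 <= h' t) -> h a <= h b.
Proof.
move=> ab dh h0; have [t tab E] := scalar_mean_value ab dh.
by rewrite -subr_ge0 E mulr_ge0 ?h0// subr_ge0 ltW.
Qed.

(** A mean value inequality with a majorant varying with t. It integrates the cone condition |v| <=
    k v_0 into a bound on displacements. *)
Lemma derive_bound_le n (e e' : R -> 'rV[R]_n) (h h' : R -> R) a b : a < b ->
  (forall t, a <= t <= b -> is_derive t 1 e (e' t)) ->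
  (forall t, a <= t <= b -> is_derive t 1 h (h' t)) ->
  (forall t, a <= t <= b -> `|e' t| <= h' t) -> `|e b - e a| <= h b - h a.
Proof.
move=> ab de dh eh.
have hh : 0 <= h b - h a.
  rewrite subr_ge0; apply: (derive_ge0_le ab dh) => t tab.
  exact: le_trans (normr_ge0 _) (eh t tab).
apply: rV_norm_le => // i; rewrite !mxE ler_norml.
have b1 t : a <= t <= b -> - h' t <= e' t 0 i <= h' t.
  by move=> tab; rewrite -ler_norml; exact: le_trans (rV_coord_le _ _) (eh t tab).
have := @derive_ge0_le (fun t => h t - e t 0 i) (fun t => h' t - e' t 0 i) a b ab.
have := @derive_ge0_le (fun t => h t + e t 0 i) (fun t => h' t + e' t 0 i) a b ab.
move=> H1 H2.
have {}H1 : h a + e a 0 i <= h b + e b 0 i.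
  apply: H1 => t tab; first exact: is_deriveD (dh t tab) (is_derive_coord i (de t tab)).
  by have := b1 t tab; lra.
have {}H2 : h a - e a 0 i <= h b - e b 0 i.
  apply: H2 => t tab; first exact: is_deriveB (dh t tab) (is_derive_coord i (de t tab)).
  by have := b1 t tab; lra.
by apply/andP; split; lra.
Qed.

End scalar_monotonicity.

(** * Joint continuity of flows and complete fields *)

Section complete_flow.
Context {R : realType} {n : nat} {M : manifold R n}.
Variable Y : vector_field M.
Implicit Types (a b s t : R) (x p : M).

(** A flow box at the image of p, with orbits confined to the interior of U, handles all times near
    s and all points near p at once. *)
Lemma flow_continuous2 s p (U : set M) : flow_dom Y s p -> nbhs (flow Y s p) U ->
  exists2 e, 0 < e & \forall x \near p, forall t, `|t - s| < e -> U (flow Y t x).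
Proof.
move=> D nU; set q := flow Y s p in nU.
have [c ac cq] := atlas_cover q.
have [eps [r [Phi [fb H]]]] := local_flow Y 0 (conj ac cq) (open_interior U) nU.
have e0 := fb_eps fb; exists eps => //.
pose V := cdom c `&` [set x | `|c x - c q| < r].
have oV : open V by exact: (@open_chart_preimage _ _ _ c _ (open_norm_ball (c q) r)).
have Vq : V q by split=> //; rewrite /= subrr normr0 (fb_rad fb).
have N1 : \forall x \near p, V (flow Y s x) := flow_continuous D (near_open oV Vq).
have N2 := near_open (@flow_dom_open _ _ _ Y s) D.
have N : \forall x \near p, V (flow Y s x) /\ flow_dom Y s x by exact: filterI N1 N2.
apply: filterS N => x [[cx xr] Dx] t te.
have [cv v0 HA] := H _ cx xr; have [_ /interior_subset] := HA _ te.
have F : flow_rel Y (t - s) (flow Y s x) (cinv c (Phi (t - s) (c (flow Y s x)))).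
  by rewrite -{1}v0; apply: (curve_on_flow cv); rewrite ?oppr_lt0 ?e0// -ltr_norml.
have := flow_relD (flow_domP Dx) F; rewrite addrC subrK => /flowE ->.
by [].
Qed.

Hypothesis cY : complete_field Y.

Lemma complete_flow_curve x : integral_curve Y (fun t => flow Y t x).
Proof.
have [gam [cg dg] g0] := cY x.
suff -> : (fun t => flow Y t x) = gam by [].
apply/funext => t; apply: flowE; rewrite -g0.
apply: (@curve_on_flow _ _ _ _ (- `|t| - 1) (`|t| + 1)).
- by move=> u _; split; [exact: cg|exact: dg].
- by have := normr_ge0 t; lra.
- by have := ler_norm t; have := ler_norm (- t); rewrite normrN; lra.
Qed.

Lemma complete_flow_dom s x : flow_dom Y s x.
Proof.
have [gam [cg dg] g0] := cY x; exists (gam s); rewrite -g0.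
apply: (@curve_on_flow _ _ _ _ (- `|s| - 1) (`|s| + 1)).
- by move=> u _; split; [exact: cg|exact: dg].
- by have := normr_ge0 s; lra.
- by have := ler_norm s; have := ler_norm (- s); rewrite normrN; lra.
Qed.

Lemma complete_flowD s t x : flow Y (s + t) x = flow Y t (flow Y s x).
Proof. by apply: flow_comp; exact: complete_flow_dom. Qed.

Lemma flow0 x : flow Y 0 x = x.
Proof. exact: flowE (flow_rel0 _ _). Qed.

End complete_flow.

(** * Causal cones in slice charts *)

Section slice_cones.
Context {R : realType} {n : nat} {N : spacetime R n}.
Let g := metric N.
Let Y := torient N.
Variable S : set N.
Hypothesis sS : spacelike S.
Implicit Types (p q x : N) (c d : chart R n N) (v w : 'rV[R]_n.+1).

(** Let l be the quotient of the coordinates of index 0 of v and Y. If l <= 0, then v - l Y is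
    tangent to S with a nonpositive square, hence zero; but v = l Y contradicts the signs. Dividing
    by the coordinate of Y makes the conclusion independent of the side on which the chart counts
    positively. *)
Lemma slice_cone c p v : slice_chart S c -> cdom c p -> S p -> v != 0 ->
  gdot g c p v v <= 0 -> gdot g c p (Y c p) v <= 0 ->
  0 < (Y c p 0 ord0)^-1 * v 0 ord0.
Proof.
move=> sc cp Sp v0 vv Yv; have cpp : chart_at c p by split=> //; case: sc.
have pos w : w 0 ord0 = 0 -> w != 0 -> 0 < gdot g c p w w by exact: sS.
have YY : gdot g c p (Y c p) (Y c p) < 0 by exact: torient_timelike.
have Y0 : Y c p 0 ord0 != 0.
  apply/eqP => Y0; have := pos _ Y0; case: eqP => [E|_ /(_ isT)]; last by lra.
  by move: YY; rewrite E gdot_rV0 ltxx.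
set l := _^-1 * _; have lE : v 0 ord0 = l * Y c p 0 ord0 by rewrite /l mulrAC mulVf// mul1r.
rewrite ltNge; apply/negP => l0.
pose w := (1 : R) *: v + (- l) *: Y c p.
have w0 : w 0 ord0 = 0 by rewrite /w !mxE lE; ring.
have ww : gdot g c p w w <= 0.
  rewrite gdot_comb// (gdot_sym g _ _ cpp : gdot g c p v (Y c p) = _).
  have h1 : 0 <= - l * - gdot g c p (Y c p) v by rewrite mulr_ge0; lra.
  have h2 : 0 <= (- l) ^+ 2 * - gdot g c p (Y c p) (Y c p).
    by rewrite mulr_ge0 ?sqr_ge0//; lra.
  lra.
have wE : w = 0 by apply/eqP; apply: contraTT ww => /(pos _ w0); rewrite ltNge.
have vE : v = l *: Y c p.
  by have := wE; rewrite /w scale1r scaleNr => /eqP; rewrite subr_eq0 => /eqP.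
have : gdot g c p (Y c p) v = l * gdot g c p (Y c p) (Y c p).
  rewrite vE /gdot (_ : (l *: Y c p)^T = l *: (Y c p)^T); last first.
    by apply/matrixP => i j; rewrite !mxE.
  by rewrite -scalemxAr [LHS]mxE.
move=> E; have l00 : l = 0.
  apply/eqP; rewrite eq_le l0/= leNgt; apply/negP => l1.
  have : 0 < l * gdot g c p (Y c p) (Y c p) by rewrite nmulr_rgt0.
  by lra.
by move: v0; rewrite vE l00 scale0r eqxx.
Qed.

Lemma unit_sphere_compact : compact [set v : 'rV[R]_n.+1 | `|v| = 1].
Proof.
apply: bounded_closed_compact.
  by exists 1; split=> // y y1 v /= ->; exact: ltW.
have -> : [set v : 'rV[R]_n.+1 | `|v| = 1] = Num.Def.normr @^-1` [set x : R | x = 1] by [].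
apply: (@preimage_closed _ _ (Num.Def.normr : 'rV[R]_n.+1 -> R)).
  by move=> v _; exact: norm_continuous.
by have := @closed_eq R 1.
Qed.

(* Tube lemma over the compact unit sphere. *)
Lemma cone_bound c p : slice_chart S c -> cdom c p -> S p -> exists k : R,
  \forall x \near p, forall v, future_causal c x v -> `|v| <= k * v 0 ord0.
Proof.
move=> sc cp Sp; have cpp : chart_at c p by split=> //; case: sc.
have [ac _] := cpp.
pose V := ('rV[R]_n.+1 * 'rV[R]_n.+1)%type.
pose U : set V := fst @^-1` (c @` cdom c).
have oU : open U.
  by apply: open_comp => [z _|]; [exact: cvg_fst|exact: cimg_open].
have C2 : Ck 0 U (snd : V -> 'rV[R]_n.+1) by move=> z _; exact: cvg_snd.
have Cg : Ck 0 U ((g c \o cinv c) \o fst : V -> 'M[R]_n.+1).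
  move=> z Uz; apply: continuous_comp; first exact: cvg_fst.
  exact: smooth_continuous (gcomp_smooth g ac) Uz.
have CY : Ck 0 U ((Y c \o cinv c) \o fst : V -> 'rV[R]_n.+1).
  move=> z Uz; apply: continuous_comp; first exact: cvg_fst.
  exact: smooth_continuous (vcomp_smooth Y ac) Uz.
have Cvv := Ck_entry 0 0 oU (Ck_mulmx oU (Ck_mulmx oU C2 Cg) (Ck_trmx oU C2)).
have CYv := Ck_entry 0 0 oU (Ck_mulmx oU (Ck_mulmx oU CY Cg) (Ck_trmx oU C2)).
have Uz v : U (c p, v) by exists p.
pose y0 := (Y c p 0 ord0)^-1.
pose K := [set v : 'rV[R]_n.+1 | `|v| = 1].
(* The parameter i pairs the coordinates of a point near p with a number tending to 0 from the
   right. Compactness then yields a neighbourhood and a positive lower bound at the same time. *)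
pose P (i : 'rV[R]_n.+1 * R) v := gdot g c (cinv c i.1) v v <= 0 ->
  gdot g c (cinv c i.1) (Y c (cinv c i.1)) v <= 0 -> i.2 < y0 * v 0 ord0.
pose F := filter_prod (nbhs (c p)) (at_right (0 : R)).
have FF : ProperFilter F by exact: filter_prod_proper.
have cov v : K v -> \forall v' \near v & i \near F, P i v'.
  move=> Kv; have v0 : v != 0 by rewrite -normr_eq0 Kv oner_eq0.
  (* If one of the two causal inequalities fails at v, it fails nearby and P holds vacuously; the
     remaining vectors are those of [slice_cone]. *)
  have open_case (h : V -> R) : {for (c p, v), continuous h} -> 0 < h (c p, v) ->
      (forall z w m, P (z, m) w \/ h (z, w) <= 0) ->
      \forall v' \near v & i \near F, P i v'.
    move=> ch h0 hP; have N0 : \forall z \near (c p, v), 0 < h z by apply: (cvgr_gt _ ch).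
    have [[A B] [/= nA nB] AB] := N0.
    exists (B, [set i | A i.1]) => /=.
      split=> //; exists (A, setT) => //=; first by split=> //; exact: filterT.
      by move=> [z m] [].
    move=> [w [z m]] [/= Bw Az]; have [//|] := hP z w m.
    by rewrite leNgt (AB (z, w)).
  have [vv|vv] := leP (gdot g c p v v) 0; last first.
    apply: (open_case (fun z : V => gdot g c (cinv c z.1) z.2 z.2)).
    - exact: Cvv _ (Uz v).
    - by rewrite /= cfunK.
    - by move=> z w m; have [h|h] := leP (gdot g c (cinv c z) w w) 0; [right|left=> ?; lra].
  have [Yv|Yv] := leP (gdot g c p (Y c p) v) 0; last first.
    apply: (open_case (fun z : V => gdot g c (cinv c z.1) (Y c (cinv c z.1)) z.2)).
    - exact: CYv _ (Uz v).
    - by rewrite /= cfunK.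
    - move=> z w m; have [h|h] := leP (gdot g c (cinv c z) (Y c (cinv c z)) w) 0.
        by right.
      by left=> ? ?; lra.
  have l0 := slice_cone sc cp Sp v0 vv Yv; rewrite -/y0 in l0.
  have N1 : \forall w \near v, y0 * v 0 ord0 / 2 < y0 * (w : 'rV[R]_n.+1) 0 ord0.
    have cl : {for v, continuous (fun w : 'rV[R]_n.+1 => y0 * w 0 ord0)}.
      apply: (@Ck_continuous _ 0 _ _ setT) => //.
      by apply: CkM openT (Ck_cst _ _ _) (Ck_entry _ _ openT (Ck_id _ _)).
    by apply: (cvgr_gt _ cl); lra.
  exists ([set w : 'rV[R]_n.+1 | y0 * v 0 ord0 / 2 < y0 * w 0 ord0], [set i | i.2 < y0 * v 0 ord0 / 2]).
    split=> //=; exists (setT, [set m | m < y0 * v 0 ord0 / 2]) => //=; last first.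
      by move=> [z m] [].
    split; first exact: filterT.
    by apply: nbhs_right_lt; lra.
  by move=> [w [z m]] [/= h1 h2] _ _ /=; exact: lt_trans h2 h1.
have [[A C] [/= nA nC] AC] := (compact_near_coveringP K).1 unit_sphere_compact _ F P _ cov.
have [m [Cm m0]] : exists m, C m /\ 0 < m.
  have h : \forall m \near (0 : R)^'+, C m /\ 0 < m.
    by apply: filterI => //; exact: nbhs_right_gt.
  by have [m] := filter_ex h; exists m.
(* By homogeneity m |v| < y0 v_0, whence this constant; its sign is that of the coordinate of index
   0 of Y at p. *)
exists (m^-1 * y0).
have NA : \forall x \near p, A (c x) := cfun_cts cp nA.
have NcA : \forall x \near p, cdom c x /\ A (c x).
  exact: filterI (near_open (@cdom_open _ _ _ c) cp) NA.
apply: filterS NcA => x [cx Ax] v [v0 vv Yv].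
have nv : 0 < `|v| by rewrite normr_gt0.
have gZ (a : R) (u w : 'rV[R]_n.+1) : gdot g c x u (a *: w) = a * gdot g c x u w.
  rewrite /gdot (_ : (a *: w)^T = a *: w^T); last by apply/matrixP => i j; rewrite !mxE.
  by rewrite -scalemxAr [LHS]mxE.
have gZl (a : R) (u w : 'rV[R]_n.+1) : gdot g c x (a *: u) w = a * gdot g c x u w.
  by rewrite /gdot -!scalemxAl [LHS]mxE.
have Ku : K (`|v|^-1 *: v).
  by rewrite /K/= normrZ gtr0_norm ?invr_gt0// mulVf// gt_eqF.
have iv : 0 <= `|v|^-1 by rewrite invr_ge0.
have := AC (c x, m) (conj Ax Cm) _ Ku; rewrite /P/= cfunK// gZ gZl.
move=> H; have {}H : m < y0 * (`|v|^-1 *: v) 0 ord0.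
  by apply: H; [rewrite !mulr_ge0_le0// mulr_ge0_le0|rewrite gZ mulr_ge0_le0// ltW].
move: H; rewrite mxE mulrCA mulrC ltr_pdivlMr// => /ltW H.
by rewrite -mulrA ler_pdivlMl.
Qed.

End slice_cones.

(** * The hitting time of a slice and causal curves *)

Section flow_slices.
Context {R : realType} {n : nat} {N : spacetime R n}.
Let g := metric N.
Let Y := torient N.
Hypotheses (cY : complete_field Y)
  (kY : forall c p, chart_at c p -> lie_metric g Y c p = 0).
Variable S : set N.
Hypotheses (hS : smooth_hypersurface S) (sS : spacelike S) (kS : compact S).
Hypothesis hit : forall x, exists! s, S (flow Y s x).
Implicit Types (a b e s t k : R) (p q x : N) (c d : chart R n N) (W : set N)
  (v w : 'rV[R]_n.+1) (I : set R) (gam : R -> N).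

Definition hit_time x : R := xget 0 [set s | S (flow Y s x)].
Let rho := hit_time.

Lemma hit_timeP x : S (flow Y (rho x) x).
Proof.
have [s [Ss _]] := hit x.
exact: (@xgetPex _ _ [set s | S (flow Y s x)] (ex_intro _ s Ss)).
Qed.

Lemma hit_time_unique x s : S (flow Y s x) -> rho x = s.
Proof.
by have [u [_ H]] := hit x => /H <-; rewrite (H _ (hit_timeP x)).
Qed.

Lemma hit_time_flow t x : rho (flow Y t x) = rho x - t.
Proof.
apply: hit_time_unique; rewrite -complete_flowD// addrC subrK.
exact: hit_timeP.
Qed.

Lemma hit_time_slice x : S x -> rho x = 0.
Proof. by move=> Sx; apply: hit_time_unique; rewrite flow0. Qed.

(** k is negative when the coordinate of index 0 decreases towards the future; its product with that
    coordinate increases along future causal curves in either case. *)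
Definition adapted d W k := [/\ atlas d, open W, W `<=` cdom d &
  forall x v, W x -> future_causal d x v -> `|v| <= k * v 0 ord0].

Lemma adapted_speed d W k x v : adapted d W k -> W x -> future_causal d x v ->
  0 < k * v 0 ord0.
Proof.
move=> [_ _ _ H] Wx fv; apply: lt_le_trans (H x v Wx fv).
by case: fv => v0 _ _; rewrite normr_gt0.
Qed.

Lemma torient_future d x : chart_at d x -> future_causal d x (Y d x).
Proof.
move=> dx; apply: future_timelike_causal; split; exact: torient_timelike.
Qed.

(* Slice charts of [S] carried along the flow, which is isometric. *)
Lemma adapted_exists x0 : exists d W k,
  [/\ adapted d W k, W x0 &
      forall x, W x -> d x 0 ord0 = 0 <-> rho x = rho x0].
Proof.
set s0 := rho x0; have Sp := hit_timeP x0; rewrite -/s0 in Sp.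
have [c [ac sc] cp] := hS Sp; have [k Hk] := cone_bound sS (conj ac sc) cp Sp.
pose d := flow_pull Y s0 c.
have ad : atlas d by exact: flow_pull_atlas.
have D x : flow_dom Y s0 x by exact: complete_flow_dom.
pose A := [set x | cdom d x /\ forall v, future_causal d x v -> `|v| <= k * v 0 ord0].
have nA : nbhs x0 A.
  have N1 : \forall x \near x0, cdom c (flow Y s0 x).
    exact: (flow_continuous (D x0) (near_open (@cdom_open _ _ _ c) cp)).
  have N2 : \forall x \near x0, forall v, future_causal c (flow Y s0 x) v ->
      `|v| <= k * v 0 ord0 := flow_continuous (D x0) Hk.
  apply: filterS (filterI N1 N2) => x [cx H]; split; first by split.
  have cx' : chart_at c (flow Y s0 x) by split.
  move=> v [v0 vv Yv]; apply: H; split=> //.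
    by move: vv; rewrite /gdot (flow_pull_metric kY cx' (D x)).
  move: Yv; rewrite /gdot (flow_pull_metric kY cx' (D x)).
  by rewrite (flow_pull_field cx' (D x)).
exists d, A°, k; split=> //.
- split=> //; first exact: open_interior.
    by move=> x /interior_subset[].
  by move=> x v /interior_subset[_]; exact.
- move=> x /interior_subset[[_ cx] _]; rewrite -[d x]/(c (flow Y s0 x)).
  rewrite -(sc _ cx); split=> [|<-]; first exact: hit_time_unique.
  exact: hit_timeP.
Qed.

(** Along each orbit near x0, the product of k and the coordinate of index 0 increases and changes
    sign within [-m, m]. The intermediate value theorem gives a zero at some time u, where the
    hitting time is that of x0; hence rho x = rho x0 + u, and the sign of the product at x is
    opposite to that of u. *)
Lemma hit_time_local d W k x0 e : adapted d W k -> W x0 ->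
  (forall x, W x -> d x 0 ord0 = 0 <-> rho x = rho x0) -> 0 < e ->
  \forall x \near x0, [/\ `|rho x - rho x0| < e,
    0 < k * d x 0 ord0 -> rho x < rho x0 &
    k * d x 0 ord0 < 0 -> rho x0 < rho x].
Proof.
move=> adW Wx0 zero e0; have [ad oW Wd cone] := adW.
have nW : nbhs (flow Y 0 x0) W by rewrite flow0; exact: near_open.
have [e1 e10 N1] := flow_continuous2 (complete_flow_dom cY 0 x0) nW.
pose m := Num.min (e / 2) (e1 / 2).
have m0 : 0 < m by rewrite lt_min !divr_gt0.
have me : m < e by rewrite gt_min ltr_pdivrMr// ltr_pMr// ltr1n.
have me1 : m < e1 by rewrite gt_min orbC ltr_pdivrMr// ltr_pMr// ltr1n.
pose h x t := k * d (flow Y t x) 0 ord0.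
have der x t : W (flow Y t x) ->
    is_derive t 1 (h x) (k * Y d (flow Y t x) 0 ord0).
  move=> Wt; have dt : chart_at d (flow Y t x) by split=> //; exact: Wd.
  have [_ /(_ t d dt) D] := complete_flow_curve cY x.
  exact: (is_deriveZ k (is_derive_coord ord0 D)).
have Wm x : (forall t, `|t - 0| < e1 -> W (flow Y t x)) -> forall t, - m <= t <= m ->
    W (flow Y t x).
  move=> H t /andP[t1 t2]; apply: H; rewrite subr0 ltr_norml; apply/andP; split; lra.
have inc x : (forall t, `|t - 0| < e1 -> W (flow Y t x)) ->
    forall s t, - m <= s -> s < t -> t <= m -> h x s < h x t.
  move=> H s t ms st tm; apply: (derive_gt0_lt st) => u /andP[su ut].
    by apply: der; apply: Wm => //; apply/andP; split; lra.
  have Wu : W (flow Y u x) by apply: Wm => //; apply/andP; split; lra.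
  by apply: (adapted_speed adW Wu); apply: torient_future; split=> //; exact: Wd.
have H0 := nbhs_singleton N1.
have h0 : h x0 0 = 0.
  by rewrite /h flow0 (_ : d x0 0 ord0 = 0) ?mulr0//; apply/zero.
have cont t : - m <= t <= m -> {for x0, continuous (fun x => h x t)}.
  move=> tm; have Wt := Wm _ H0 t tm.
  apply: (@continuous_comp _ _ _ (flow Y t) (fun y => k * d y 0 ord0)).
    exact/flow_continuous/complete_flow_dom.
  apply: (@continuous_comp _ _ _ d (fun z : 'rV[R]_n.+1 => k * z 0 ord0)).
    exact/cfun_cts/Wd.
  apply: (@Ck_continuous _ 0 _ _ setT) => //.
  by apply: CkM openT (Ck_cst _ _ _) (Ck_entry _ _ openT (Ck_id _ _)).
have N2 : \forall x \near x0, 0 < h x m.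
  have cm : {for x0, continuous (fun x => h x m)} by apply: cont; apply/andP; split; lra.
  apply: (cvgr_gt _ cm); rewrite -h0; apply: inc => //; lra.
have N3 : \forall x \near x0, h x (- m) < 0.
  have cm : {for x0, continuous (fun x => h x (- m))} by apply: cont; apply/andP; split; lra.
  apply: (cvgr_lt _ cm); rewrite -h0; apply: inc => //; lra.
apply: filterS (filterI N1 (filterI N2 N3)) => x [Hx [hm hM]].
have C : {within `[- m, m], continuous (h x)}.
  apply: derivable_within_continuous => t; rewrite in_itv/= => tm.
  by have [] := der x t (Wm _ Hx t tm).
have mm : - m <= m by lra.
have [u um hu] : exists2 u, u \in `[- m, m] & h x u = 0.
  apply: IVT => //; have hh : h x (- m) <= h x m by lra.
  by rewrite (min_idPl hh) (max_idPr hh); apply/andP; split; exact: ltW.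
move: um; rewrite in_itv/= => um; have [um1 um2] := andP um.
have Wu := Wm _ Hx u um.
have k0 : k != 0.
  by apply/eqP => k0; move: hm; rewrite /h k0 mul0r ltxx.
have zu : d (flow Y u x) 0 ord0 = 0 by apply/eqP; move/eqP: hu; rewrite mulf_eq0 (negPf k0).
have := (zero _ Wu).1 zu; rewrite hit_time_flow => E.
have rE : rho x = rho x0 + u by rewrite -E subrK.
have hx : h x 0 = k * d x 0 ord0 by rewrite /h flow0.
rewrite rE -hx; split=> [|p0|p0].
- rewrite addrC addKr; rewrite ltr_norml; apply/andP; split; lra.
- rewrite gtrDl ltNge; apply/negP; rewrite le_eqVlt => /orP[/eqP u0|u0].
    by move: hu; rewrite -u0 => hu; lra.
  have := inc x Hx 0 u; rewrite hu => H; have : h x 0 < 0 by apply: H => //; lra.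
  lra.
- rewrite ltrDl ltNge; apply/negP; rewrite le_eqVlt => /orP[/eqP u0|u0].
    by move: hu; rewrite u0 => hu; lra.
  have := inc x Hx u 0; rewrite hu => H; have : 0 < h x 0 by apply: H => //; lra.
  lra.
Qed.

(** Integrated form of the cone condition; eps is 1 for a future-directed parametrisation and -1 for
    a reversed one. *)
Definition transverse (eps : R) d k s t gam :=
  `|d (gam t) - d (gam s)| <= eps * k * (d (gam t) 0 ord0 - d (gam s) 0 ord0).

Lemma causal_piece_local d W k (al : R -> N) t0 e0 : adapted d W k -> 0 < e0 ->
  smooth_curve_in (@future_causal R n N) (ball t0 e0) al -> W (al t0) ->
  exists2 e, 0 < e & forall s t, t0 - e < s -> s < t -> t < t0 + e ->
    [/\ W (al s), transverse 1 d k s t al &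
        k * d (al s) 0 ord0 < k * d (al t) 0 ord0].
Proof.
move=> adW e00 [h1 h2 h3] W0; have [ad oW Wd cone] := adW.
have t0b : ball t0 e0 t0 by exact: ballxx.
have N1 : \forall t \near t0, ball t0 e0 t /\ W (al t).
  apply: filterI; first exact: nbhsx_ballx.
  exact: (h1 t0 t0b _ (near_open oW W0)).
have /nbhs_normP[e /= e_0 He] := N1.
exists e => // s t es st te.
have He' u : s <= u <= t -> ball t0 e0 u /\ W (al u).
  by move=> /andP[su ut]; apply: He; rewrite /ball_/= ltr_norml; apply/andP; split; lra.
have D u : s <= u <= t -> is_derive u 1 (d \o al) ((d \o al)^`()%classic u).
  move=> /He'[bu Wu]; have [dg _] := (CkSP _ _ _).1 (h2 d ad 1%N).
  have df : differentiable (d \o al) u by apply: dg; split=> //; exact: Wd.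
  by rewrite derive1E; apply: derivableP; exact: diff_derivable.
have F u : s <= u <= t -> future_causal d (al u) ((d \o al)^`()%classic u).
  by move=> /He'[bu Wu]; apply: h3 => //; split=> //; exact: Wd.
have Dk u : s <= u <= t -> is_derive u 1 (fun u => k * (d \o al) u 0 ord0)
    (k * (d \o al)^`()%classic u 0 ord0).
  by move=> su; exact: (is_deriveZ k (is_derive_coord ord0 (D u su))).
split.
- by have [|_] := He' s; first by rewrite lexx ltW.
- rewrite /transverse mul1r mulrBr; apply: (derive_bound_le st D Dk) => u su.
  by have [_ Wu] := He' u su; exact: cone (F u su).
- apply: (derive_gt0_lt st Dk) => u su.
  by have [_ Wu] := He' u su; exact: adapted_speed adW Wu (F u su).
Qed.

Lemma causal_local I gam d W k t : causal_curve I gam -> adapted d W k -> I t ->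
  W (gam t) -> exists2 e, 0 < e & forall s, I s ->
    (t - e < s -> s < t -> transverse 1 d k s t gam /\
       k * d (gam s) 0 ord0 < k * d (gam t) 0 ord0) /\
    (t < s -> s < t + e -> transverse 1 d k t s gam /\
       k * d (gam t) 0 ord0 < k * d (gam s) 0 ord0).
Proof.
move=> cg adW It Wt; have [e0 e00 [al [be [ha hb Ea Eb]]]] := cg t It.
have at_ : gam t = al t by apply: Ea => //; apply/andP; split; lra.
have bt : gam t = be t by apply: Eb => //; apply/andP; split; lra.
have [|e1 e10 H1] := causal_piece_local adW e00 ha; first by rewrite -at_.
have [|e2 e20 H2] := causal_piece_local adW e00 hb; first by rewrite -bt.
exists (Num.min e0 (Num.min e1 e2)); first by rewrite !lt_min e00 e10.
have m0 : Num.min e0 (Num.min e1 e2) <= e0 by rewrite ge_min lexx.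
have m1 : Num.min e0 (Num.min e1 e2) <= e1 by rewrite !ge_min lexx orbT.
have m2 : Num.min e0 (Num.min e1 e2) <= e2 by rewrite !ge_min lexx !orbT.
move=> s Is; split=> ts st.
  rewrite /transverse at_ (Ea s Is); last by apply/andP; split; lra.
  by have [| | |_ ? ?] := H1 s t => //; lra.
rewrite /transverse bt (Eb s Is); last by apply/andP; split; lra.
by have [| | |_ ? ?] := H2 t s => //; lra.
Qed.

Lemma causal_continuous I gam t U : causal_curve I gam -> I t -> nbhs (gam t) U ->
  exists2 e, 0 < e & forall s, I s -> `|s - t| < e -> U (gam s).
Proof.
move=> cg It nU; have [e0 e00 [al [be [[ha _ _] [hb _ _] Ea Eb]]]] := cg t It.
have at_ : gam t = al t by apply: Ea => //; apply/andP; split; lra.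
have bt : gam t = be t by apply: Eb => //; apply/andP; split; lra.
have tb : ball t e0 t by exact: ballxx.
have NA : \forall s \near t, U (al s) by apply: ha => //; rewrite -at_.
have NB : \forall s \near t, U (be s) by apply: hb => //; rewrite -bt.
have N1 : \forall s \near t, U (al s) /\ U (be s) by exact: filterI.
have /nbhs_normP[e /= e_0 He] := N1.
exists (Num.min e0 e); first by rewrite lt_min e00.
move=> s Is; rewrite lt_min => /andP[s0 se].
have [As Bs] : U (al s) /\ U (be s) by apply: He; rewrite /ball_/= distrC.
move: s0; rewrite ltr_norml => /andP[s1 s2].
have [st|ts] := leP s t.
  by rewrite (Ea s Is)//; apply/andP; split; lra.
by rewrite (Eb s Is)//; apply/andP; split; lra.
Qed.

(** In a chart adapted to [gam t], the product of k and the coordinate of index 0 increases through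
    zero at t, and [hit_time_local] converts its sign into a comparison of hitting times. Real
    induction globalises this monotonicity at each parameter. *)
Lemma hit_time_decreasing I gam : is_interval I -> causal_curve I gam ->
  forall s t, I s -> I t -> s < t -> rho (gam t) < rho (gam s).
Proof.
move=> iI cg.
have loc t : I t -> exists2 e, 0 < e & forall s, I s ->
    (t - e < s -> s < t -> rho (gam t) < rho (gam s)) /\
    (t < s -> s < t + e -> rho (gam s) < rho (gam t)).
  move=> It; have [d [W [k [adW Wt zero]]]] := adapted_exists (gam t).
  have [e1 e10 H1] := causal_local cg adW It Wt.
  have [e2 e20 H2] := causal_continuous cg It (hit_time_local adW Wt zero ltr01).
  have z0 : k * d (gam t) 0 ord0 = 0.
    by rewrite (_ : d _ _ _ = 0) ?mulr0//; apply/(zero _ Wt).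
  exists (Num.min e1 e2); first by rewrite lt_min e10.
  have m1 : Num.min e1 e2 <= e1 by rewrite ge_min lexx.
  have m2 : Num.min e1 e2 <= e2 by rewrite ge_min lexx orbT.
  move=> s Is; have [Ha Hb] := H1 s Is; split=> ts st.
    have [||_ L] := Ha; [lra|lra|].
    have [|_ _] := H2 s Is; first by rewrite ltr_norml; apply/andP; split; lra.
    by apply; lra.
  have [||_ L] := Hb; [lra|lra|].
  have [|_ H _] := H2 s Is; first by rewrite ltr_norml; apply/andP; split; lra.
  by apply: H; lra.
move=> s t Is It st.
(* The alternative t = s lets the induction start at s, where the strict inequality fails. *)
suff : t = s \/ rho (gam t) < rho (gam s) by case=> // E; move: st; rewrite E ltxx.
have Iu u : s <= u <= t -> I u by exact: iI.
apply: (@real_induction _ (fun u => u = s \/ rho (gam u) < rho (gam s)) s t).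
- by left.
- move=> u /andP[su ut] Pu; have [|e e0 He] := loc u; first by apply: Iu; rewrite su ltW.
  exists e => // w /andP[uw we] wt; right.
  have [|_ /(_ uw we) L] := He w; first by apply: Iu; rewrite (le_trans su (ltW uw)).
  by case: Pu => [<-//|]; exact: lt_trans.
- move=> u /andP[su ut] Pu; right; have [|e e0 He] := loc u; first by apply: Iu; rewrite ltW.
  pose w := Num.max s (u - e / 2).
  have sw : s <= w by rewrite le_max lexx.
  have wu : w < u by rewrite gt_max su; lra.
  have ew : u - e < w by rewrite lt_max; apply/orP; right; lra.
  have [|/(_ ew wu) L _] := He w; first by apply: Iu; rewrite sw (ltW (lt_le_trans wu ut)).
  by have [|E|] := Pu w; rewrite ?sw//; [by rewrite -E|exact: lt_trans].
- by rewrite ltW// lexx.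
Qed.

Lemma slice_acausal : acausal S.
Proof.
move=> p q Sp Sq [a [b [gam [ab cg ga gb]]]].
have := @hit_time_decreasing `[a, b]%classic gam (@interval_is_interval _ _) cg a b.
rewrite ga gb !hit_time_slice// ltxx => H; suff : false by [].
by apply: H => //; rewrite /= in_itv/= lexx ltW.
Qed.

(** The slab is swept out by the compact S when it flows for the times in [-A, A]. *)
Lemma slab_compact (A : R) : compact [set x | `|rho x| <= A].
Proof.
have -> : [set x | `|rho x| <= A] =
    (fun z : R * N => flow Y z.1 z.2) @` (`[- A, A]%classic `*` S).
  apply/seteqP; split=> [x /= xA|_ [[s p] /= [sA Sp] <-]].
    exists (- rho x, flow Y (rho x) x) => /=; last first.
      by rewrite -complete_flowD// subrr flow0.
    split; last exact: hit_timeP.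
    by rewrite in_itv/=; move: xA; rewrite ler_norml lerN2 lerNl andbC.
  by rewrite hit_time_flow hit_time_slice// sub0r normrN; move: sA; rewrite in_itv/= ler_norml.
apply: continuous_compact; last by apply: compact_setX => //; exact: segment_compact.
apply: continuous_subspaceT => -[s p] U /= nU.
have [e e0 H] := flow_continuous2 (complete_flow_dom cY s p) nU.
exists (ball s e, [set x | forall t, `|t - s| < e -> U (flow Y t x)]) => /=.
  by split=> //; exact: nbhsx_ballx.
move=> [t x] [/= ts]; apply; by move: ts; rewrite -ball_normE/= distrC.
Qed.

Lemma transverse_trans eps d k s t u gam : transverse eps d k s t gam ->
  transverse eps d k t u gam -> transverse eps d k s u gam.
Proof.
rewrite /transverse !mulrBr => st tu.
by have := ler_distD (d (gam t)) (d (gam u)) (d (gam s)); lra.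
Qed.

(* A causal curve confined to one side of [S] accumulates somewhere in a compact
   slab; there its displacement is bounded by the increment of a coordinate that
   stays nonpositive along the curve, so that it converges. *)
Lemma trapped_endpoint (eps : R) I gam t1 : eps = 1 \/ eps = -1 ->
  is_interval I -> I t1 ->
  (forall t U, I t -> nbhs (gam t) U ->
    exists2 e, 0 < e & forall s, I s -> `|s - t| < e -> U (gam s)) ->
  (forall d W k t, adapted d W k -> I t -> W (gam t) ->
    exists2 e, 0 < e & forall s, I s ->
      (t - e < s -> s < t -> transverse eps d k s t gam) /\
      (t < s -> s < t + e -> transverse eps d k t s gam)) ->
  (forall s t, I s -> I t -> s <= t -> eps * rho (gam t) <= eps * rho (gam s)) ->
  (forall t, I t -> rho (gam t) != 0) ->
  0 < eps * rho (gam t1) ->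
  exists q, future_endpoint I gam q.
Proof.
move=> eps1 iI It1 Hc Hl Hm Hn pos1.
have epsn (y : R) : `|eps * y| = `|y|.
  by case: eps1 => ->; rewrite ?mul1r// mulN1r normrN.
have eps0 : eps != 0 by case: eps1 => ->; rewrite ?oppr_eq0 oner_eq0.
have rc t e : I t -> 0 < e -> exists2 e', 0 < e' & forall s, I s -> `|s - t| < e' ->
    `|rho (gam s) - rho (gam t)| < e.
  move=> It e0; have [d [W [k [adW Wt zero]]]] := adapted_exists (gam t).
  have [e' e'0 H] := Hc t _ It (hit_time_local adW Wt zero e0).
  by exists e' => // s Is st; have [] := H s Is st.
have posn t : I t -> 0 < eps * rho (gam t).
  move=> It; have [tt1|/ltW t1t] := leP t t1.
    by apply: lt_le_trans pos1 _; exact: Hm.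
  have Iu u : t1 <= u <= t -> I u by exact: iI.
  apply: (@real_induction _ (fun u => 0 < eps * rho (gam u)) t1 t) => //.
  - move=> u /andP[u1 ut] pu; have Iu0 : I u by apply: Iu; rewrite u1 ltW.
    have [e e0 H] := rc u (eps * rho (gam u)) Iu0 pu.
    exists e => // s /andP[us se] st; have Is : I s.
      by apply: Iu; rewrite st (le_trans u1 (ltW us)).
    have [|] := boolP (`|s - u| < e); last by rewrite gtr0_norm; lra.
    move=> /(H s Is); rewrite -epsn mulrBr ltr_norml => /andP[h1 _]; lra.
  - move=> u /andP[u1 ut] pu; have Iu0 : I u by apply: Iu; rewrite ltW.
    have ne : eps * rho (gam u) != 0 by rewrite mulf_neq0// Hn.
    rewrite ltNge le_eqVlt negb_or ne/=; apply/negP => nu.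
    have nu' : 0 < - (eps * rho (gam u)) by rewrite oppr_gt0.
    have [e e0 H] := rc u _ Iu0 nu'.
    pose w := Num.max t1 (u - e / 2).
    have tw : t1 <= w by rewrite le_max lexx.
    have wu : w < u by rewrite gt_max u1; lra.
    have ew : u - e < w by rewrite lt_max; apply/orP; right; lra.
    have Iw : I w by apply: Iu; rewrite tw (ltW (lt_le_trans wu ut)).
    have pw : 0 < eps * rho (gam w) by apply: pu; rewrite tw.
    have wue : `|w - u| < e by rewrite ltr0_norm; lra.
    have := H w Iw wue; rewrite -epsn mulrBr ltr_norml => /andP[_ h2]; lra.
  - by rewrite t1t lexx.
(* Filter of the tails of the curve; it contains a compact slab and so has a cluster point. *)
pose F (A : set N) := exists2 t0, I t0 & forall t, I t -> t0 <= t -> A (gam t).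
have FF : ProperFilter F.
  apply: Build_ProperFilter_ex => [A [t0 It0 H]|].
    by exists (gam t0); apply: H.
  split.
  - by exists t1.
  - move=> A B [a Ia Ha] [b Ib Hb]; exists (Num.max a b).
      by rewrite /Num.max; case: ifP.
    by move=> t It; rewrite ge_max => /andP[? ?]; split; [exact: Ha|exact: Hb].
  - by move=> A B AB [a Ia Ha]; exists a => // t It ta; exact/AB/Ha.
have FK : F [set x | `|rho x| <= eps * rho (gam t1)].
  exists t1 => // t It t1t /=; rewrite -epsn gtr0_norm; last exact: posn.
  exact: Hm.
have [q [_ cq]] := slab_compact FF FK.
exists q => U nU.
have [d [W [k [adW Wq zero]]]] := adapted_exists q; have [ad oW Wd _] := adW.
(* As eps * rho decreases along the curve, its value at the cluster point q is a lower bound. *)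
have rq t : I t -> eps * rho q <= eps * rho (gam t).
  move=> It; rewrite leNgt; apply/negP => lt_q.
  have e0 : 0 < eps * rho q - eps * rho (gam t) by rewrite subr_gt0.
  have Ft : F [set x | exists2 s, I s /\ t <= s & x = gam s].
    by exists t => // s Is ts; exists s.
  have [_ [[s [Is ts] ->] [h _ _]]] := cq _ _ Ft (hit_time_local adW Wq zero e0).
  have := Hm t s It Is ts; move: h; rewrite -epsn mulrBr ltr_norml => /andP[? ?]; lra.
(* The quantity whose increments bound displacements. It vanishes at q, and it is nonpositive where
   the curve lies in W2, since there its sign tells on which side of [rho q] the hitting time is. *)
pose f x := eps * k * d x 0 ord0.
pose A := [set x | W x /\ (0 < k * d x 0 ord0 -> rho x < rho q) /\
  (k * d x 0 ord0 < 0 -> rho q < rho x)].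
pose W2 := A°.
have W2q : W2 q.
  have N1 := hit_time_local adW Wq zero ltr01.
  by apply: filterS (filterI (near_open oW Wq) N1) => x [Wx [_ h1 h2]].
have oW2 : open W2 by exact: open_interior.
have W2W x : W2 x -> W x by move=> /interior_subset[].
have fneg t : I t -> W2 (gam t) -> f (gam t) <= 0.
  move=> It /interior_subset[_ [h1 h2]]; rewrite leNgt /f -mulrA; apply/negP => fp.
  have := rq t It; case: eps1 fp => ->; rewrite ?mul1r ?mulN1r => fp.
    by have := h1 fp; lra.
  have fp' : k * d (gam t) 0 ord0 < 0 by lra.
  by have := h2 fp'; lra.
have dq : cdom d q by exact: Wd.
have N1 : \forall z \near d q, (d @` cdom d) z /\ (W2 `&` U) (cinv d z).
  apply: (near_chart dq); exact: filterI (near_open oW2 W2q) nU.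
have /nbhs_normP[r /= r0 Hr] := N1.
(* A closed coordinate ball inside W2 and U. It is compact, hence closed in N, which keeps the curve
   in it at left limits. *)
pose K := cinv d @` closed_ball_ Num.Def.normr (d q) (r / 2).
have inB z : closed_ball_ Num.Def.normr (d q) (r / 2) z ->
    [/\ cdom d (cinv d z), d (cinv d z) = z, W2 (cinv d z) & U (cinv d z)].
  move=> zr; have [/chart_img[h1 h2] [h3 h4]] : (d @` cdom d) z /\ (W2 `&` U) (cinv d z).
    by apply: Hr; rewrite /ball_/=; move: zr; rewrite /closed_ball_/=; lra.
  by [].
have cK : closed K.
  apply: compact_closed; first exact: manifold_hausdorff.
  apply: continuous_compact.
    apply: continuous_in_subspaceT => z /set_mem zr; apply: cinv_cts.
    by have [h1 h2 _ _] := inB z zr; exists (cinv d z).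
  apply: bounded_closed_compact; last exact: closed_closed_ball_.
  exists (`|d q| + r); split=> [|y yr z /= zr]; first exact: num_real.
  move: zr; rewrite /closed_ball_/= distrC => zr.
  by have := ler_normD (z - d q) (d q); rewrite subrK; lra.
have KP x : K x -> [/\ cdom d x, `|d x - d q| <= r / 2, W2 x & U x].
  by move=> [z zr <-]; have [h1 h2 h3 h4] := inB z zr; split=> //; rewrite h2 distrC.
have KI x : cdom d x -> `|d x - d q| <= r / 2 -> K x.
  by move=> dx xr; exists (d x); [rewrite /closed_ball_/= distrC|rewrite cfunK].
have fq : f q = 0.
  by rewrite /f (_ : d q 0 ord0 = 0) ?mulr0//; apply/(zero _ Wq).
(* If the curve starts within r/4 of q with f > - r/4 and f remains nonpositive, its displacement is
   less than r/4 and it stays within r/2 of q. *)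
have N2 : \forall x \near q, [/\ cdom d x, `|d x - d q| < r / 4 & - (r / 4) < f x].
  have cf : {for q, continuous f}.
    apply: (@continuous_comp _ _ _ d (fun z : 'rV[R]_n.+1 => eps * k * z 0 ord0)).
      exact/cfun_cts.
    apply: (@Ck_continuous _ 0 _ _ setT) => //.
    by apply: CkM openT (Ck_cst _ _ _) (Ck_entry _ _ openT (Ck_id _ _)).
  have M1 := near_open (@cdom_open _ _ _ d) dq.
  have M2 : \forall x \near q, `|d x - d q| < r / 4.
    have b : `|d q - d q| < r / 4 by rewrite subrr normr0; lra.
    exact: (cfun_cts dq (near_norm_ball b)).
  have M3 : \forall x \near q, - (r / 4) < f x by apply: (cvgr_gt _ cf); rewrite fq; lra.
  have M : \forall x \near q, cdom d x /\ (`|d x - d q| < r / 4 /\ - (r / 4) < f x).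
    exact: filterI M1 (filterI M2 M3).
  by apply: filterS M => x [? [? ?]].
have Ft : F [set x | exists2 s, I s & x = gam s] by exists t1 => // t It _; exists t.
have [_ [[t0 It0 ->] [d0 dr0 f0]]] := cq _ _ Ft N2.
exists t0 => // t It t0t.
have close u : I u -> W2 (gam u) -> transverse eps d k t0 u gam -> K (gam u).
  move=> Iu W2u; rewrite /transverse mulrBr -/(f (gam u)) -/(f (gam t0)) => tr.
  apply: KI; first exact/Wd/W2W.
  have := fneg u Iu W2u.
  by have := ler_distD (d (gam t0)) (d (gam u)) (d q); lra.
suff : K (gam t) /\ transverse eps d k t0 t gam by move=> [/KP[]].
have Iu u : t0 <= u <= t -> I u by exact: iI.
apply: (@real_induction _ (fun u => K (gam u) /\ transverse eps d k t0 u gam) t0 t).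
- split; last by rewrite /transverse !subrr normr0 mulr0.
  by apply: KI => //; lra.
- move=> u /andP[u0 ut] [Ku tu]; have Iu0 : I u by apply: Iu; rewrite u0 ltW.
  have [_ _ W2u _] := KP _ Ku.
  have [e1 e10 H1] := Hl d W k u adW Iu0 (W2W _ W2u).
  have [e2 e20 H2] := Hc u W2 Iu0 (near_open oW2 W2u).
  exists (Num.min e1 e2); first by rewrite lt_min e10.
  have m1 : Num.min e1 e2 <= e1 by rewrite ge_min lexx.
  have m2 : Num.min e1 e2 <= e2 by rewrite ge_min lexx orbT.
  move=> s /andP[us se] st; have Is : I s by apply: Iu; rewrite st (le_trans u0 (ltW us)).
  have W2s : W2 (gam s) by apply: H2 => //; rewrite gtr0_norm; lra.
  have [_ tus] := H1 s Is; have {}tus : transverse eps d k u s gam by apply: tus; lra.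
  have ts := transverse_trans tu tus.
  by split=> //; exact: close.
- move=> u /andP[u0 ut] Hu; have Iu0 : I u by apply: Iu; rewrite ltW.
  have back e : 0 < e -> exists w : R, [/\ t0 <= w, w < u, u - e < w & I w].
    move=> e0; exists (Num.max t0 (u - e / 2)).
    have wu : Num.max t0 (u - e / 2) < u by rewrite gt_max u0; lra.
    have tw : t0 <= Num.max t0 (u - e / 2) by rewrite le_max lexx.
    split=> //; first by rewrite lt_max; apply/orP; right; lra.
    by apply: Iu; rewrite tw ltW// (lt_le_trans wu).
  have Ku : K (gam u).
    apply: cK => V nV; have [e e0 He] := Hc u V Iu0 nV.
    have [w [tw wu ew Iw]] := back e e0; exists (gam w); split.
      by have [] := Hu w _; first by rewrite tw.
    by apply: He => //; rewrite ltr0_norm; lra.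
  have [_ _ W2u _] := KP _ Ku.
  have [e e0 He] := Hl d W k u adW Iu0 (W2W _ W2u).
  have [w [tw wu ew Iw]] := back e e0; have [H _] := He w Iw.
  split=> //; apply: transverse_trans (H ew wu).
  by have [] := Hu w _; first by rewrite tw.
- by rewrite t0t lexx.
Qed.

Lemma timelike_causal_curve I gam : timelike_curve I gam -> causal_curve I gam.
Proof.
move=> tg t It; have [e e0 [al [be [ha hb Ea Eb]]]] := tg t It.
by exists e => //; exists al, be; split=> //; exact: smooth_curve_in_causal.
Qed.

Lemma slice_cauchy : cauchy_hypersurface S.
Proof.
move=> I gam [t1 It1] iI /timelike_causal_curve cg [nf np].
have dec := hit_time_decreasing iI cg.
have SE x : S x <-> rho x = 0.
  by split=> [/hit_time_slice//|r0]; have := hit_timeP x; rewrite r0 flow0.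
suff [t [It St]] : exists t, I t /\ S (gam t).
  exists t; split=> // s [Is Ss]; have [st|ts|//] := ltgtP s t.
    by have := dec s t Is It st; rewrite !hit_time_slice// ltxx.
  by have := dec t s It Is ts; rewrite !hit_time_slice// ltxx.
apply: contrapT => nS.
have Hn t : I t -> rho (gam t) != 0.
  by move=> It; apply/eqP => r0; apply: nS; exists t; split=> //; exact/SE.
have Hm s t : I s -> I t -> s <= t -> rho (gam t) <= rho (gam s).
  by move=> Is It; rewrite le_eqVlt => /orP[/eqP ->//|st]; exact/ltW/dec.
have [r0|r0] := ltP 0 (rho (gam t1)).
  have [| | | | |q /nf//] := @trapped_endpoint 1 I gam t1 (or_introl erefl) iI It1.
  - by move=> t U It; exact: causal_continuous cg It.
  - move=> d W k t adW It Wt; have [e e0 H] := causal_local cg adW It Wt.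
    exists e => // s Is; have [h1 h2] := H s Is.
    by split=> a1 a2; [have [] := h1 a1 a2|have [] := h2 a1 a2].
  - by move=> s t Is It st; rewrite !mul1r; exact: Hm.
  - exact: Hn.
  - by rewrite mul1r.
(* When rho is negative it is the reversed curve that is trapped; its future endpoint is a past
   endpoint of [gam]. *)
pose J := [set t | I (- t)].
have iJ : is_interval J.
  by move=> a b Ja Jb c /andP[ac cb]; apply: (iI _ _ Jb Ja); rewrite !lerN2 ac cb.
have Jt1 : J (- t1) by rewrite /J/= opprK.
have [| | | | |q fe] := @trapped_endpoint (-1) J (fun t => gam (- t)) (- t1)
    (or_intror erefl) iJ Jt1.
- move=> t U Jt nU; have [e e0 H] := causal_continuous cg Jt nU.
  by exists e => // s Js st; apply: H => //; rewrite -opprD normrN.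
- move=> d W k t adW Jt Wt; have [e e0 H] := causal_local cg adW Jt Wt.
  exists e => // s Js; have [h1 h2] := H _ Js; rewrite /transverse.
  split=> a1 a2.
    have [||h _] := h2; [lra|lra|]; move: h; rewrite /transverse distrC.
    by move=> /le_trans; apply; rewrite le_eqVlt; apply/orP; left; apply/eqP; ring.
  have [||h _] := h1; [lra|lra|]; move: h; rewrite /transverse distrC.
  by move=> /le_trans; apply; rewrite le_eqVlt; apply/orP; left; apply/eqP; ring.
- by move=> s t Js Jt st; rewrite !mulN1r lerN2; apply: Hm => //; rewrite lerN2.
- by move=> t; exact: Hn.
- by rewrite opprK mulN1r oppr_gt0 lt_neqAle Hn.
apply: (np q) => U nU; have [t0 Jt0 H] := fe U nU.
exists (- t0) => // t It tt0; have := H (- t); rewrite opprK; apply.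
  by rewrite /J/= opprK.
by rewrite lerNr.
Qed.

End flow_slices.

(** * Orbits in the original spacetime *)

Section orbits.
Context {R : realType} {n : nat} {M : spacetime R n}.
Variable X : vector_field M.
Hypothesis fX : future_field X.
Implicit Types (a b e h s t : R) (p q : M).

Lemma orbit_interval p : is_interval [set t | flow_dom X t p].
Proof.
move=> s t [q1 [a [b [g [ab0 abs cg g0 _]]]]] [q2 [a' [b' [g' [ab0' abt cg' g0' _]]]]].
move=> u /andP[su ut]; have [u0|u0] := leP u 0.
  exists (g u); rewrite -g0; apply: (curve_on_flow cg) => //.
  by move: ab0 abs => /andP[? ?] /andP[? ?]; apply/andP; split; lra.
exists (g' u); rewrite -g0'; apply: (curve_on_flow cg') => //.
by move: ab0' abt => /andP[? ?] /andP[? ?]; apply/andP; split; lra.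
Qed.

Lemma orbit_timelike p : timelike_curve [set t | flow_dom X t p] (fun t => flow X t p).
Proof.
move=> t /= Dt.
have [a [b [g [/andP[a0 b0] cg g0 gE]]]] := flow_curve X (flow X t p).
have ma : Num.min (- a) b <= - a by rewrite ge_min lexx.
have mb : Num.min (- a) b <= b by rewrite ge_min lexx orbT.
have cf : curve_on X (a - - t) (b - - t) (fun u => flow X u p).
  move=> u uab; have := curve_on_shift (s := - t) cg uab; apply: curve_at_eq.
  apply: filterS (near_itvoo uab) => v /andP[v1 v2].
  have vab : a < v - t < b by apply/andP; split; lra.
  rewrite -gE// -flow_comp//; first by rewrite addrC subrK.
  by exists (g (v - t)); rewrite -g0; apply: (curve_on_flow cg) => //; rewrite a0 b0.
have sm := curve_on_smooth_curve fX cf.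
have sb : smooth_curve_in (@future_timelike R n M) (ball t (Num.min (- a) b))
    (fun u => flow X u p).
  apply: smooth_curve_in_sub sm => u; rewrite -ball_normE/= ltr_norml => /andP[? ?].
  by apply/andP; split; lra.
exists (Num.min (- a) b); first by rewrite lt_min oppr_gt0 a0.
by exists (fun u => flow X u p), (fun u => flow X u p); split.
Qed.

(* An orbit converging at an end of its domain would be defined for all times in
   that direction and its limit would be a zero of [X]. *)
Lemma orbit_no_endpoint (eps : R) p t1 q : eps * eps = 1 -> flow_dom X t1 p ->
  ~ (forall U : set M, nbhs q U -> exists2 t0, flow_dom X t0 p &
       forall t, flow_dom X t p -> 0 <= eps * (t - t0) -> U (flow X t p)).
Proof.
move=> eps1 Dt1 H; have [e e0 He] := near_flow_dom X q.
have Heq := nbhs_singleton He.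
have [t0 D0 H0] := H _ He.
(* Times advancing from t0 by steps e/2 in the direction eps. Each point reached lies where the
   lifetime is at least e, so the domain of the orbit is unbounded on that side. *)
pose T (k : nat) := t0 + eps * (k%:R * (e / 2)).
have TE k : eps * (T k - t0) = k%:R * (e / 2).
  by rewrite /T [t0 + _]addrC addrK mulrA eps1 mul1r.
have epsn (y : R) : `|eps * y| = `|y|.
  have : `|eps| ^+ 2 = 1 ^+ 2 by rewrite -normrX expr2 eps1 normr1 expr1n.
  by move=> /eqP; rewrite eqrXn2// => /eqP E; rewrite normrM E mul1r.
have e2 : `|eps * (e / 2)| < e by rewrite epsn gtr0_norm; lra.
have T_ge k : 0 <= eps * (T k - t0).
  by rewrite TE mulr_ge0// divr_ge0// ltW.
have DT k : flow_dom X (T k) p.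
  elim: k => [|k IH]; first by rewrite /T mul0r mulr0 addr0.
  have [y Fy] := H0 _ IH (T_ge k) _ e2.
  exists y; have := flow_relD (flow_domP IH) Fy.
  suff -> : T k + eps * (e / 2) = T k.+1 by [].
  by rewrite /T -natr1; ring.
(* Far along the orbit, both a point and its image under the flow for the time h are close to q, so
   q is fixed. *)
have fixed h : `|h| < e -> flow X h q = q.
  move=> he; have Dq : flow_dom X h q by exact: Heq.
  apply: (@manifold_hausdorff _ _ M) => A B nA nB.
  have N1 : \forall x \near q, A (flow X h x) := flow_continuous Dq nA.
  have N2 : \forall x \near q, (A (flow X h x) /\ B x) /\
      forall h, `|h| < e -> flow_dom X h x.
    exact: filterI (filterI N1 nB) He.
  have [t2 _ H2] := H _ N2.
  pose y := (`|t0 - t2| + `|h|) / (e / 2).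
  have y0 : 0 <= y by rewrite divr_ge0// ?addr_ge0// divr_ge0// ltW.
  pose k := Num.bound y.
  have kE : `|t0 - t2| + `|h| <= k%:R * (e / 2).
    rewrite -ler_pdivrMr; last by rewrite divr_gt0.
    exact/ltW/archi_boundP.
  have E1 : eps * (T k - t2) = k%:R * (e / 2) + eps * (t0 - t2).
    by rewrite -TE; ring.
  have n1 : - `|t0 - t2| <= eps * (t0 - t2).
    by rewrite -epsn lerNl -normrN; exact: ler_norm.
  have n2 : - `|h| <= eps * h by rewrite -epsn lerNl -normrN; exact: ler_norm.
  have h0 := normr_ge0 h.
  have [[Az _] Hz] : (A (flow X h (flow X (T k) p)) /\ B (flow X (T k) p)) /\
      forall h, `|h| < e -> flow_dom X h (flow X (T k) p).
    by apply: H2; [exact: DT|lra].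
  have Dz := Hz h he; have Ez := flow_comp (DT k) Dz.
  exists (flow X h (flow X (T k) p)); split=> //; rewrite -Ez.
  have Dw : flow_dom X (T k + h) p.
    by exists (flow X h (flow X (T k) p)); apply: flow_relD; exact: flow_domP.
  have [|[_ Bz] _] := H2 _ Dw; last exact: Bz.
  have -> : eps * (T k + h - t2) = eps * (T k - t2) + eps * h by ring.
  by lra.
have [a [b [g [ab0 cg g0 gE]]]] := flow_curve X q.
have [c ac cq] := atlas_cover q.
have [_ D] := cg 0 ab0; rewrite g0 in D.
have {}D := D c (conj ac cq).
have N1 : \forall t \near (0 : R), `|t| < e.
  have b0 : `|(0 : R) - 0| < e by rewrite subrr normr0.
  by apply: filterS (near_norm_ball b0) => t; rewrite subr0.
have N2 : \forall t \near (0 : R), (fun=> c q) t = (c \o g) t.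
  apply: filterS (filterI N1 (near_itvoo ab0)) => t [te tab].
  by rewrite /= -gE// fixed.
(* The orbit of q is constant near time 0, so X vanishes at q, against its timelikeness. *)
have Dc : is_derive (0 : R) 1 (fun=> c q) (0 : 'rV[R]_n.+1) by exact: is_derive_cst.
have D' := near_eq_is_derive N2 Dc.
have X0 := is_derive_unique D D'.
have [+ _] := fX (conj ac cq); by rewrite X0 gdot_rV0 ltxx.
Qed.

Lemma orbit_hits (S : set M) p : cauchy_hypersurface S ->
  exists! s, flow_dom X s p /\ S (flow X s p).
Proof.
move=> cS; have D0 : flow_dom X 0 p by exists p; exact: flow_rel0.
apply: (cS [set t | flow_dom X t p] (fun t => flow X t p)).
- by exists 0.
- exact: orbit_interval.
- exact: orbit_timelike.
- split=> q H.
    apply: (@orbit_no_endpoint 1 p 0 q); rewrite ?mulr1// => U /H[t0 I0 H0].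
    by exists t0 => // t It; rewrite mul1r subr_ge0; exact: H0.
  apply: (@orbit_no_endpoint (-1) p 0 q); rewrite ?mulrNN ?mulr1// => U /H[t0 I0 H0].
  by exists t0 => // t It; rewrite mulN1r oppr_ge0 subr_le0; exact: H0.
Qed.

End orbits.

(** * The image of the slice in the enlarged spacetime *)

Section hull_slice.
Context {R : realType} {n : nat} {M : spacetime R n}.
Variables (X : vector_field M) (sigma : M -> R).
Hypotheses (gh : globally_hyperbolic M) (fX : future_field X).
Hypothesis kX : forall c p, chart_at c p ->
  lie_metric (metric M) X c p = (2 * sigma p) *: metric M c p.
Variable S : set M.
Hypotheses (hS : smooth_hypersurface S) (sS : spacelike S) (kS : compact S)
  (cS : cauchy_hypersurface S).

Let N : spacetime R n := hull gh fX kX.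
Let phi : M -> N := hull_map gh fX 0.

Lemma hull_slice_mem p : (phi @` S) (phi p) <-> S p.
Proof.
by split=> [[q Sq /iota_inj <-]|Sp]; [|exists p].
Qed.

(** The flow merely shifts the index, so a hitting time in N is a hitting time in M minus the index
    of the slice. *)
Lemma hull_flow s t p :
  flow (torient N) s (hull_map gh fX t p) = hull_map gh fX (t + s) p.
Proof.
have [cg dg] := glob_integral_curve (globalization_hausdorff fX gh) t p.
apply: flowE; rewrite -[hull_map gh fX t p]/(iota_map X t p) -{1}[t]addr0.
apply: (@curve_on_flow _ _ N _ (- `|s| - 1) (`|s| + 1) (fun u => iota_map X (t + u) p)).
- by move=> u _; split; [exact: cg|exact: dg].
- by have := normr_ge0 s; lra.
- by have := ler_norm s; have := ler_norm (- s); rewrite normrN; lra.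
Qed.

Lemma hull_hit (x : N) : exists! s, (phi @` S) (flow (torient N) s x).
Proof.
have [t [p ->]] := hull_surj x.
have [u [[Du Su] uniq]] := orbit_hits fX p cS.
(* In M the orbit of p meets S at time u, and x is p placed in the slice of index t. *)
exists (u - t); split.
  rewrite hull_flow addrC subrK; exists (flow X u p) => //.
  by apply/esym/iota_eq; rewrite subr0; exact: flow_domP.
move=> s [q Sq]; rewrite hull_flow => /esym/iota_eq; rewrite subr0 => F.
rewrite (uniq (t + s)) ?[t + s]addrC ?addrK//.
by rewrite [s + t]addrC (flowE F); split=> //; exact: flow_relW F.
Qed.

Lemma hull_slice_hypersurface : smooth_hypersurface (phi @` S).
Proof.
move=> _ [p Sp <-]; have [c [ac sc] cp] := hS Sp.
exists (push_chart X 0 c); last by exists p.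
split=> [|x [q cq <-]]; first exact: push_chart_atlas.
have E : push_chart X 0 c (iota_map X 0 q) = c q by rewrite /= iotaK.
by rewrite E -sc//; exact: hull_slice_mem.
Qed.

Lemma hull_slice_spacelike : spacelike (phi @` S).
Proof.
move=> d x [ad sd] dx [p Sp px]; rewrite -px in dx *; move=> v v0 vn0.
have dp : chart_at d (phi p) by split.
have -> : gdot (metric N) d (phi p) v v = (sqspeed (metric M) X p)^-1 *
    gdot (metric M) (pull_chart 0 d) p v v by exact: hull_gdot.
have s0 : 0 < sqspeed (metric M) X p by apply: sqspeed_gt0; exact: future_field_timelike.
rewrite pmulr_rgt0 ?invr_gt0//; apply: sS => //.
split=> [|q dq]; first exact: ad.
by rewrite -(hull_slice_mem q); exact: sd.
Qed.

Lemma hull_slice_compact : compact (phi @` S).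
Proof.
apply: continuous_compact kS.
exact/continuous_subspaceT/(hull_smooth_map gh fX 0).1.
Qed.

Lemma hull_slice :
  [/\ smooth_hypersurface (phi @` S), spacelike (phi @` S), acausal (phi @` S),
      compact (phi @` S) & cauchy_hypersurface (phi @` S)].
Proof.
have cY : complete_field (torient N) by exact: hull_complete.
have kY c p : chart_at c p -> lie_metric (metric N) (torient N) c p = 0.
  exact: hull_killing.
have hN := hull_slice_hypersurface; have sN := hull_slice_spacelike.
have kN := hull_slice_compact.
have hN' (x : N) : exists! s, (phi @` S) (flow (torient N) s x) by exact: hull_hit.
split=> //.
- exact: (@slice_acausal _ _ N cY kY _ hN sN hN').
- exact: (@slice_cauchy _ _ N cY kY _ hN sN kN hN').
Qed.

End hull_slice.

Theorem theorem1p5 (R : realType) (n : nat) (n_ge1 : (1 <= n)%N)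
    (M : spacetime R n) (X : vector_field M) :
  globally_hyperbolic M ->
  timelike_conformal_killing X ->
  (exists (N : spacetime R n) (phi : M -> N) (Y : vector_field N),
    [/\ open_conformal_embedding phi,
        complete_field Y,
        timelike_killing Y,
        forall d q, chart_at d q -> gdot (metric N) d q (Y d q) (Y d q) = -1 &
        extends_pushforward phi X Y])
  /\
  (forall S : set M,
    [/\ smooth_hypersurface S, spacelike S, compact S
      & cauchy_hypersurface S] ->
    exists (N : spacetime R n) (phi : M -> N) (Y : vector_field N),
      [/\ open_conformal_embedding phi,
          complete_field Y,
          timelike_killing Y,
          forall d q, chart_at d q ->
            gdot (metric N) d q (Y d q) (Y d q) = -1 &
          extends_pushforward phi X Y]
      /\
      [/\ smooth_hypersurface (phi @` S),
          spacelike (phi @` S),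
          acausal (phi @` S),
          compact (phi @` S) &
          cauchy_hypersurface (phi @` S)]).
Proof.
move=> gh /future_or_opposite[X' [sigma [fX kX XX']]].
(* The same N and phi serve both assertions, whatever S is. *)
pose N := hull gh fX kX; pose phi : M -> N := hull_map gh fX 0.
have [Y HY] : exists Y : vector_field N,
    [/\ open_conformal_embedding phi, complete_field Y, timelike_killing Y,
        forall d q, chart_at d q -> gdot (metric N) d q (Y d q) (Y d q) = -1 &
        extends_pushforward phi X Y].
  have cN : open_conformal_embedding phi by exact: hull_conformal.
  have cY : @complete_field _ _ N (hull_field gh fX) by exact: hull_complete.
  have tY : @timelike_killing _ _ N (hull_field gh fX) by exact: hull_timelike_killing.
  have nY d q : chart_at d q -> gdot (metric N) d q (hull_field gh fX d q)
      (hull_field gh fX d q) = -1 by exact: hull_norm.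
  have eY : extends_pushforward phi X' (hull_field gh fX) by exact: hull_extends.
  case: XX' => E; subst X'; first by exists (hull_field gh fX).
  exists (opp_field (hull_field gh fX)); split.
  - exact: cN.
  - exact: opp_complete.
  - exact: opp_timelike_killing.
  - by move=> d q dq; rewrite opp_gdot; exact: nY.
  - exact: opp_extends.
split=> [|S [hS sS kS cS]]; first by exists N, phi, Y.
by exists N, phi, Y; split=> //; exact: hull_slice.
Qed.
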